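(* Let $\kappa$ be a cardinal, let $M=H_{\kappa^+}$ be the set of all sets of hereditary size at most $\kappa$, and let $\mathbb{P}\in M$ be a forcing notion of size $\gamma$ with $\kappa^\gamma=\kappa$. Then $M$ is definable in each of its forcing extensions $M[G]$ by $\mathbb{P}$ (with $G$ an $M$-generic filter on $\mathbb{P}$), using the ground model parameter $P_{\gamma^+}(\kappa)$. In particular: (1) if the ${\rm GCH}$ holds and $\mathbb{P}\in H_{\kappa^+}$ with $|\mathbb{P}|<\mathrm{cf}(\kappa)$, then $H_{\kappa^+}$ is definable in all its forcing extensions by $\mathbb{P}$; in particular, if $\mathrm{cf}(\kappa)>\omega$ (and ${\rm GCH}$ holds), then $H_{\kappa^+}$ is definable in its forcing extensions by $\mathrm{Add}(\omega,1)$; (2) if $\kappa^{<\kappa}=\kappa$, then $H_{\kappa^+}$ is definable in all its forcing extensions by posets of size less than $\kappa$.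
   Context: We work in ${\rm ZFC}$. $P_{\alpha}(\kappa)$ denotes the collection of all subsets of $\kappa$ of size less than $\alpha$. $\mathrm{Add}(\omega,1)$ is Cohen forcing (finite binary sequences). *)

(* Defs.v *)
Set Implicit Arguments.
Unset Strict Implicit.
Unset Printing Implicit Defensive.

(** * First-order structures in the language of set theory *)

Structure structure := Structure {
  carrier :> Type;
  mem : carrier -> carrier -> Prop
}.

Arguments mem {s} _ _.
Notation "x ∈ y" := (mem x y) (at level 70, no associativity).

(** De Bruijn indices: [f_all] binds index 0.  The metatheory is classical, so
    the remaining connectives and the existential quantifier are definable. *)
Inductive formula : Type :=
| f_mem (i k : nat)
| f_eq (i k : nat)
| f_false
| f_imp (phi psi : formula)
| f_all (phi : formula).

Definition scons (A : Type) (x : A) (env : nat -> A) (n : nat) : A :=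
  match n with 0 => x | S n => env n end.

Fixpoint sat (S : structure) (env : nat -> S) (phi : formula) : Prop :=
  match phi with
  | f_mem i k => env i ∈ env k
  | f_eq i k => env i = env k
  | f_false => False
  | f_imp phi psi => sat env phi -> sat env psi
  | f_all phi => forall x : S, sat (scons x env) phi
  end.

(** * Set theory inside a structure *)

Section SetTheory.
Context {S : structure}.
Implicit Types a b e f k r t w x y z p q : S.

Definition is_empty x := forall z, ~ z ∈ x.
Definition subset x y := forall z, z ∈ x -> z ∈ y.
Definition is_upair x a b := forall z, z ∈ x <-> z = a \/ z = b.
Definition is_succ x y := forall z, z ∈ y <-> z ∈ x \/ z = x.
Definition is_powerset p x := forall z, z ∈ p <-> subset z x.

(** [z] is the Kuratowski pair (a, b). *)
Definition is_opair z a b :=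
  exists u v, is_upair u a a /\ is_upair v a b /\ is_upair z u v.

(** (a, b) belongs to the set [r]. *)
Definition rel r a b := exists z, is_opair z a b /\ z ∈ r.

Definition is_relation r a b :=
  forall z, z ∈ r -> exists x y, x ∈ a /\ y ∈ b /\ is_opair z x y.

Definition is_fun f a b :=
  is_relation f a b /\ forall x, x ∈ a -> exists! y, rel f x y.

Definition is_injection f a b :=
  is_fun f a b /\ forall x x' y, rel f x y -> rel f x' y -> x = x'.

Definition is_bijection f a b :=
  is_injection f a b /\ forall y, y ∈ b -> exists x, rel f x y.

Definition equinumerous a b := exists f, is_bijection f a b.
Definition le_size a b := exists f, is_injection f a b.

(** ** Ordinals and cardinals *)

Definition transitive x := forall y, y ∈ x -> subset y x.

(** Well-foundedness of membership on [x] comes from the axiom of foundation. *)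
Definition is_ordinal x :=
  transitive x /\
  forall y z, y ∈ x -> z ∈ x -> y ∈ z \/ y = z \/ z ∈ y.

Definition is_limit x :=
  is_ordinal x /\ (exists y, y ∈ x) /\
  forall y, y ∈ x -> exists z, z ∈ x /\ y ∈ z.

Definition is_omega w := is_limit w /\ forall n, n ∈ w -> ~ is_limit n.

Definition is_cardinal k :=
  is_ordinal k /\ forall x, x ∈ k -> ~ equinumerous x k.

Definition is_infinite_cardinal k :=
  is_cardinal k /\ exists w, is_omega w /\ subset w k.

(** |x| = k *)
Definition has_card x k := is_cardinal k /\ equinumerous x k.

(** l = k^+ *)
Definition is_succ_cardinal k l :=
  is_cardinal l /\ k ∈ l /\ forall m, is_cardinal m -> k ∈ m -> subset l m.

(** c = cf(k), for [k] a limit ordinal *)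
Definition has_cofinal_map a k :=
  exists f, is_fun f a k /\
    forall x, x ∈ k -> exists b y, b ∈ a /\ rel f b y /\ (x = y \/ x ∈ y).

Definition is_cof k c :=
  is_ordinal c /\ has_cofinal_map c k /\ forall a, a ∈ c -> ~ has_cofinal_map a k.

(** k^g = k *)
Definition exp_eq_self k g :=
  exists e, (forall f, f ∈ e <-> is_fun f g k) /\ equinumerous e k.

(** k^{<k} = k, where k^{<k} is the number of functions from some ordinal
    below [k] to [k]. *)
Definition weak_exp_eq_self k :=
  exists e, (forall f, f ∈ e <-> exists a, a ∈ k /\ is_fun f a k) /\
            equinumerous e k.

(** [e] is P_a(k). *)
Definition is_small_subsets e a k :=
  forall x, x ∈ e <-> subset x k /\ exists m, has_card x m /\ m ∈ a.

(** ** Sets of hereditary size at most a cardinal *)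

Definition is_trcl x t :=
  subset x t /\ transitive t /\
  forall s, subset x s -> transitive s -> subset t s.

Definition hereditary_size_le x k := exists t, is_trcl x t /\ le_size t k.

(** [M] is H_{k^+}. *)
Definition is_H_succ k (M : S) := forall x, x ∈ M <-> hereditary_size_le x k.

(** ** Forcing *)

(** Nonempty preorders; the order relation [le] is a set of pairs, and [rel le
    p q] means that [p] is stronger than [q]. *)
Definition is_forcing (P le : S) :=
  (exists p, p ∈ P) /\ is_relation le P P /\
  (forall p, p ∈ P -> rel le p p) /\
  (forall p q r, rel le p q -> rel le q r -> rel le p r).

Definition is_dense (P le D : S) :=
  subset D P /\ forall p, p ∈ P -> exists d, d ∈ D /\ rel le d p.

Definition is_filter (P le G : S) :=
  subset G P /\ (exists p, p ∈ G) /\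
  (forall p q, p ∈ G -> rel le p q -> q ∈ G) /\
  (forall p q, p ∈ G -> q ∈ G -> exists r, r ∈ G /\ rel le r p /\ rel le r q).

Definition is_generic (M P le G : S) :=
  is_filter P le G /\
  forall D, D ∈ M -> is_dense P le D -> exists p, p ∈ D /\ p ∈ G.

(** A P-name is a set of pairs (s, p) with [s] a P-name and [p ∈ P]; by
    foundation the recursion amounts to the existence of a set [T] of names
    that contains the components of its members. *)
Definition is_name (P t : S) :=
  exists T, t ∈ T /\
    forall s z, s ∈ T -> z ∈ s ->
      exists s' p, s' ∈ T /\ p ∈ P /\ is_opair z s' p.

(** [f] is a partial solution, with domain closed under components of names,
    of the recursion  val(t) = { val(s) | (s, p) ∈ t for some p ∈ G }. *)
Definition is_valuation (G f : S) :=
  (forall t x x', rel f t x -> rel f t x' -> x = x') /\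
  forall t x, rel f t x ->
    (forall s p, rel t s p -> exists y, rel f s y) /\
    (forall y, y ∈ x <-> exists s p, p ∈ G /\ rel t s p /\ rel f s y).

Definition name_value (G t x : S) := exists f, is_valuation G f /\ rel f t x.

(** Add(ω,1): finite binary sequences ordered by end-extension. *)
Definition is_two x :=
  exists o i, is_empty o /\ is_succ o i /\ is_upair x o i.

Definition is_Cohen (P le : S) :=
  (exists w b, is_omega w /\ is_two b /\
     forall f, f ∈ P <-> exists n, n ∈ w /\ is_fun f n b) /\
  (forall z, z ∈ le <->
     exists f g, f ∈ P /\ g ∈ P /\ subset g f /\ is_opair z f g).

End SetTheory.

(** * Models of ZFC *)

Record ZFC (S : structure) : Prop := {
  zfc_extensionality : forall x y : S, (forall z, z ∈ x <-> z ∈ y) -> x = y;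
  zfc_foundation : forall x : S, (exists y, y ∈ x) ->
    exists y, y ∈ x /\ forall z, z ∈ y -> ~ z ∈ x;
  zfc_pairing : forall a b : S, exists x, is_upair x a b;
  zfc_union : forall a : S, exists u, forall z, z ∈ u <-> exists x, x ∈ a /\ z ∈ x;
  zfc_powerset : forall x : S, exists p, is_powerset p x;
  zfc_infinity : exists w : S, (exists o, is_empty o /\ o ∈ w) /\
    forall x, x ∈ w -> exists y, is_succ x y /\ y ∈ w;
  zfc_separation : forall (phi : formula) (env : nat -> S) (a : S),
    exists b, forall x, x ∈ b <-> x ∈ a /\ sat (scons x env) phi;
  zfc_replacement : forall (phi : formula) (env : nat -> S) (a : S),
    (forall x y y', x ∈ a ->
       sat (scons x (scons y env)) phi -> sat (scons x (scons y' env)) phi ->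
       y = y') ->
    exists b, forall y,
      y ∈ b <-> exists x, x ∈ a /\ sat (scons x (scons y env)) phi;
  zfc_choice : forall a : S,
    (forall x, x ∈ a -> exists z, z ∈ x) ->
    (forall x y z, x ∈ a -> y ∈ a -> z ∈ x -> z ∈ y -> x = y) ->
    exists c, forall x, x ∈ a -> exists! z, z ∈ x /\ z ∈ c
}.

Definition GCH (S : structure) : Prop :=
  forall k l p : S, is_infinite_cardinal k -> is_succ_cardinal k l ->
    is_powerset p k -> equinumerous p l.

(** [j] identifies [V] with a transitive submodel of [W]. *)
Record transitive_embedding (V W : structure) (j : V -> W) : Prop := {
  te_inj : forall x y, j x = j y -> x = y;
  te_mem : forall x y, j x ∈ j y <-> x ∈ y;
  te_trans : forall w y, w ∈ j y -> exists x, w = j x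
}.

(** * The forcing extension M[G] and definability of M in it *)

Definition extension (W : structure) (M P G : W) : structure :=
  {| carrier := {x : W | exists t, t ∈ M /\ is_name P t /\ name_value G t x};
     mem x y := proj1_sig x ∈ proj1_sig y |}.

(** M is a subclass of M[G] that is first-order definable over the structure
    M[G] from the single parameter [a], which belongs to M[G]. *)
Definition definable_in_extension (W : structure) (M P G a : W) : Prop :=
  exists (a' : extension M P G) (phi : formula),
    proj1_sig a' = a /\
    forall x : W, x ∈ M <->
      exists x' : extension M P G,
        proj1_sig x' = x /\ sat (scons x' (fun _ => a')) phi.

(* Main.v *)
From Stdlib Require Import Arith Lia Classical ClassicalEpsilon FunctionalExtensionality ProofIrrelevance.
Require Import Defs.

(** Write [q] for P_{γ⁺}(κ) and let A ⊆ κ be in M[G].  If A ∩ a ∈ [q] for all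
    a ∈ [q], then A ∈ M: for every condition p that does not decide A pick the
    least ordinal α_p whose membership in A is not decided by p; these form a
    set a of size at most γ, and a condition in G that decides A ∩ a decides
    every α_p, hence decides A.  So P(κ) ∩ M is definable in M[G] from [q].  A
    set x of hereditary size at most κ is coded by the membership relation of a
    transitive set containing x, transferred to κ and then, by Gödel's pairing
    (which is definable and maps κ × κ onto κ), to a subset of κ; so x is in M
    iff M[G] contains such a code A with A ∩ a ∈ [q] for all a ∈ [q], the
    converse direction by collapsing the code in V.  The cardinal arithmetic
    hypotheses only serve to show γ < κ and [q] ∈ M. *)

Set Implicit Arguments.
Unset Strict Implicit.

(** * Definability with parameters *)

(** Two obstacles shape the proof. First, [V] is not assumed definable in [W], and both may be
    ill-founded when seen from the metatheory. So every induction runs either in [V] on sets of [V],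
    or in [W] on images under [j] of such sets; the forcing relation and the canonical names are
    therefore built as sets in [V], and each appeal to Separation, Replacement or Foundation carries
    a proof that the predicate is first-order. Second, no axioms are available in the extension of
    M. Nothing is proved inside it: the defining formula is absolute between [V], the extension and
    [W], and all reasoning takes place in the two outer models. The code is a subset of κ and not a
    relation on κ because P_{γ⁺}(κ) only tests subsets of κ. The coding costs no further parameter,
    as κ is the union of P_{γ⁺}(κ) and any two Gödel pairings agree on κ × κ. Of the forcing theorem
    only the statements t = x̌ with x in M are used, which suffices to speak about the members of a
    subset of κ. *)

Definition lift (f : nat -> nat) (n : nat) : nat :=
  match n with 0 => 0 | S n => S (f n) end.

Fixpoint rename (f : nat -> nat) (phi : formula) : formula :=
  match phi with
  | f_mem i k => f_mem (f i) (f k)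
  | f_eq i k => f_eq (f i) (f k)
  | f_false => f_false
  | f_imp phi psi => f_imp (rename f phi) (rename f psi)
  | f_all phi => f_all (rename (lift f) phi)
  end.

Lemma sat_rename (U : structure) phi : forall f (env : nat -> U),
  sat env (rename f phi) <-> sat (fun n => env (f n)) phi.
Proof.
  induction phi as [| | |phi1 IH1 phi2 IH2|phi IH]; intros f env; cbn; try tauto.
  - rewrite IH1, IH2. tauto.
  - assert (E : forall x, scons x (fun n => env (f n)) = fun n => scons x env (lift f n)).
    { intros x. apply functional_extensionality. intros [|n]; reflexivity. }
    split; intros H x; specialize (H x); rewrite ?E, ?IH in *; exact H.
Qed.

Section Definability.
Context {U : structure}.
Variable C : U -> Prop.

(** Parameters are placed behind the n variables, so that passing under a quantifier changes only n
    ([vapp_scons]). *)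
Definition vapp (n : nat) (v env : nat -> U) (i : nat) : U :=
  if Nat.ltb i n then v i else env (i - n).

(** First-order definability with parameters in [C]; only the first [n]
    arguments of [Q] are variables. *)
Definition pdef (n : nat) (Q : (nat -> U) -> Prop) : Prop :=
  exists phi env, (forall i, C (env i)) /\ forall v, Q v <-> sat (vapp n v env) phi.

(** The language has no terms, so an operation counts as definable when its graph is; index 0 holds
    the value. *)
Definition tdef (n : nat) (t : (nat -> U) -> U) : Prop :=
  pdef (S n) (fun v => v 0 = t (fun i => v (S i))).

Lemma vapp_lt n v env i : i < n -> vapp n v env i = v i.
Proof. intros H. unfold vapp. apply Nat.ltb_lt in H. now rewrite H. Qed.

Lemma vapp_ge n v env i : vapp n v env (n + i) = env i.
Proof.
  unfold vapp. assert (H : Nat.ltb (n + i) n = false) by (apply Nat.ltb_ge; lia).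
  rewrite H. f_equal. lia.
Qed.

Lemma vapp_scons n x v env : vapp (S n) (scons x v) env = scons x (vapp n v env).
Proof. apply functional_extensionality. intros [|i]; reflexivity. Qed.

Lemma pdef_ext n (P Q : (nat -> U) -> Prop) :
  (forall v, Q v <-> P v) -> pdef n P -> pdef n Q.
Proof.
  intros E (phi & env & HC & H). exists phi, env. split; [exact HC|].
  intros v. rewrite E. apply H.
Qed.

(** Since parameters sit behind the variables, the one at index n + i has to move to m + i. *)
Lemma pdef_rename n m (f : nat -> nat) Q :
  (forall i, i < n -> f i < m) -> pdef n Q -> pdef m (fun v => Q (fun i => v (f i))).
Proof.
  intros Hf (phi & env & HC & H).
  exists (rename (fun i => if Nat.ltb i n then f i else m + (i - n)) phi), env.
  split; [exact HC|]. intros v. rewrite H, sat_rename.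
  replace (vapp n (fun i => v (f i)) env) with
    (fun i => vapp m v env (if Nat.ltb i n then f i else m + (i - n))); [tauto|].
  apply functional_extensionality. intros i.
  destruct (Nat.ltb_spec i n) as [L|L].
  - rewrite !vapp_lt; auto.
  - rewrite vapp_ge. replace i with (n + (i - n)) at 2 by lia. now rewrite vapp_ge.
Qed.

(** The two formulas come with different parameter sequences. These are interleaved, the first on
    even and the second on odd positions. *)
Lemma pdef_imp n P Q : pdef n P -> pdef n Q -> pdef n (fun v => P v -> Q v).
Proof.
  intros (p & e & HC & H) (p' & e' & HC' & H').
  set (ee := fun i => if Nat.even i then e (Nat.div2 i) else e' (Nat.div2 i)).
  exists (f_imp (rename (fun i => if Nat.ltb i n then i else n + 2 * (i - n)) p)
           (rename (fun i => if Nat.ltb i n then i else n + (2 * (i - n) + 1)) p')), ee.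
  split; [intros i; unfold ee; destruct (Nat.even i); auto|].
  intros v. cbn [sat]. rewrite !sat_rename, H, H'.
  replace (fun i => vapp n v ee (if Nat.ltb i n then i else n + 2 * (i - n)))
    with (vapp n v e).
  2:{ apply functional_extensionality. intros i. destruct (Nat.ltb_spec i n) as [L|L].
      - now rewrite !vapp_lt.
      - rewrite vapp_ge. replace i with (n + (i - n)) at 1 by lia. rewrite vapp_ge.
        unfold ee. rewrite Nat.even_mul, Nat.div2_double. reflexivity. }
  replace (fun i => vapp n v ee (if Nat.ltb i n then i else n + (2 * (i - n) + 1)))
    with (vapp n v e').
  2:{ apply functional_extensionality. intros i. destruct (Nat.ltb_spec i n) as [L|L].
      - now rewrite !vapp_lt.
      - rewrite vapp_ge. replace i with (n + (i - n)) at 1 by lia. rewrite vapp_ge.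
        unfold ee. rewrite Nat.even_add, Nat.even_mul. cbn [orb Nat.even Bool.eqb].
        rewrite Nat.add_1_r, Nat.div2_succ_double. reflexivity. }
  tauto.
Qed.

Lemma pdef_all n (Q : (nat -> U) -> U -> Prop) :
  pdef (S n) (fun v => Q (fun i => v (S i)) (v 0)) -> pdef n (fun v => forall x, Q v x).
Proof.
  intros (p & e & HC & H). exists (f_all p), e. split; [exact HC|].
  intros v. cbn [sat]. split; intros K x.
  - rewrite <- vapp_scons. apply H. exact (K x).
  - specialize (K x). rewrite <- vapp_scons in K. apply H in K. exact K.
Qed.

End Definability.

(** A parameter sequence has to be filled even when the formula uses none of it. [C] will be
    everything for Separation and Replacement, and a single element for definability in the
    extension. *)
Class Params {U : structure} (C : U -> Prop) := params_nonempty : exists c, C c.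

Section DefinabilityClosure.
Context {U : structure} (C : U -> Prop) {HC : Params C}.
Implicit Types (P Q : (nat -> U) -> Prop) (t u w : (nat -> U) -> U).

(** A statement without variables is decided in the metatheory and replaced by a truth value, so [A]
    may be any proposition. *)
Lemma pdef_const n (A : Prop) : pdef C n (fun _ => A).
Proof.
  destruct HC as [c Hc]. destruct (classic A) as [a|a].
  - exists (f_imp f_false f_false), (fun _ => c). split; [auto|]. cbn. tauto.
  - exists f_false, (fun _ => c). split; [auto|]. cbn. tauto.
Qed.

Lemma pdef_not n P : pdef C n P -> pdef C n (fun v => ~ P v).
Proof. intros H. apply pdef_imp; [exact H|apply pdef_const]. Qed.

Lemma pdef_and n P Q : pdef C n P -> pdef C n Q -> pdef C n (fun v => P v /\ Q v).
Proof.
  intros H K. apply pdef_ext with (fun v => ~ (P v -> ~ Q v)).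
  - intros v. destruct (classic (P v)), (classic (Q v)); tauto.
  - apply pdef_not, pdef_imp, pdef_not; assumption.
Qed.

Lemma pdef_or n P Q : pdef C n P -> pdef C n Q -> pdef C n (fun v => P v \/ Q v).
Proof.
  intros H K. apply pdef_ext with (fun v => ~ P v -> Q v).
  - intros v. destruct (classic (P v)); tauto.
  - apply pdef_imp; [apply pdef_not|]; assumption.
Qed.

Lemma pdef_iff n P Q : pdef C n P -> pdef C n Q -> pdef C n (fun v => P v <-> Q v).
Proof. intros H K. apply pdef_and; apply pdef_imp; assumption. Qed.

Lemma pdef_ex n (Q : (nat -> U) -> U -> Prop) :
  pdef C (S n) (fun v => Q (fun i => v (S i)) (v 0)) -> pdef C n (fun v => exists x, Q v x).
Proof.
  intros H. apply pdef_ext with (fun v => ~ forall x, ~ Q v x).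
  - intros v. split.
    + intros [x Hx] N. exact (N x Hx).
    + intros N. apply NNPP. intros K. apply N. intros x Hx. eauto.
  - apply pdef_not, (pdef_all (Q := fun v x => ~ Q v x)), pdef_not. exact H.
Qed.

Lemma tdef_var n i : i < n -> tdef C n (fun v => v i).
Proof.
  intros Hi. destruct HC as [c Hc]. exists (f_eq 0 (S i)), (fun _ => c). split; [auto|].
  intros v. cbn [sat]. rewrite !vapp_lt by lia. tauto.
Qed.

Lemma tdef_const n c : C c -> tdef C n (fun _ => c).
Proof.
  intros Hc. exists (f_eq 0 (S n + 0)), (fun _ => c). split; [auto|].
  intros v. cbn [sat]. rewrite vapp_ge, vapp_lt by lia. tauto.
Qed.

(** Index 0 carries the value of a term, so a fresh variable has to be inserted at index 1. *)
Definition ins1 (i : nat) : nat := match i with 0 => 0 | S i => S (S i) end.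

Lemma tdef_weaken n t : tdef C n t -> tdef C (S n) (fun v => t (fun i => v (S i))).
Proof.
  intros H. apply (pdef_rename (m := S (S n)) (f := ins1)) in H; [exact H|].
  intros [|i]; cbn; lia.
Qed.

Lemma pdef_subst n Q t :
  tdef C n t -> pdef C (S n) Q -> pdef C n (fun v => Q (scons (t v) v)).
Proof.
  intros Ht HQ. apply pdef_ext with (fun v => exists x, x = t v /\ Q (scons x v)).
  - intros v. split; [eauto|]. intros (x & -> & H). exact H.
  - apply (pdef_ex (Q := fun v x => x = t v /\ Q (scons x v))).
    apply pdef_and; [exact Ht|].
    apply pdef_ext with (2 := HQ). intros v.
    replace (scons (v 0) (fun i => v (S i))) with v; [tauto|].
    apply functional_extensionality. intros [|i]; reflexivity.
Qed.

Lemma pdef_app1 (Q : U -> Prop) n t :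
  pdef C 1 (fun v => Q (v 0)) -> tdef C n t -> pdef C n (fun v => Q (t v)).
Proof.
  intros HQ Ht. apply (pdef_subst (Q := fun v => Q (v 0)) Ht).
  apply (pdef_rename (m := S n) (f := fun i => i)) in HQ; [exact HQ|lia].
Qed.

Lemma pdef_app2 (Q : U -> U -> Prop) n t u :
  pdef C 2 (fun v => Q (v 0) (v 1)) -> tdef C n t -> tdef C n u ->
  pdef C n (fun v => Q (t v) (u v)).
Proof.
  intros HQ Ht Hu.
  apply (pdef_subst (Q := fun v => Q (v 0) (u (fun i => v (S i)))) Ht).
  apply (pdef_subst (n := S n) (t := fun v => u (fun i => v (S i)))
           (Q := fun v => Q (v 1) (v 0))); [apply tdef_weaken, Hu|].
  (* Substitution pushes the arguments one at a time, which leaves them in reverse order. *)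
  apply (pdef_rename (m := S (S n)) (f := fun i => 1 - i)) in HQ; [exact HQ|lia].
Qed.

Lemma pdef_app3 (Q : U -> U -> U -> Prop) n t u w :
  pdef C 3 (fun v => Q (v 0) (v 1) (v 2)) -> tdef C n t -> tdef C n u -> tdef C n w ->
  pdef C n (fun v => Q (t v) (u v) (w v)).
Proof.
  intros HQ Ht Hu Hw.
  apply (pdef_subst (Q := fun v => Q (v 0) (u (fun i => v (S i))) (w (fun i => v (S i)))) Ht).
  apply (pdef_subst (n := S n) (t := fun v => u (fun i => v (S i)))
           (Q := fun v => Q (v 1) (v 0) (w (fun i => v (S (S i)))))); [apply tdef_weaken, Hu|].
  apply (pdef_subst (n := S (S n)) (t := fun v => w (fun i => v (S (S i))))
           (Q := fun v => Q (v 2) (v 1) (v 0))).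
  { apply (tdef_weaken (t := fun v => w (fun i => v (S i)))), tdef_weaken, Hw. }
  apply (pdef_rename (m := S (S (S n))) (f := fun i => 2 - i)) in HQ; [exact HQ|lia].
Qed.

Lemma pdef_app4 (Q : U -> U -> U -> U -> Prop) n t u w s :
  pdef C 4 (fun v => Q (v 0) (v 1) (v 2) (v 3)) ->
  tdef C n t -> tdef C n u -> tdef C n w -> tdef C n s ->
  pdef C n (fun v => Q (t v) (u v) (w v) (s v)).
Proof.
  intros HQ Ht Hu Hw Hs.
  apply (pdef_subst (Q := fun v => Q (v 0) (u (fun i => v (S i))) (w (fun i => v (S i)))
     (s (fun i => v (S i)))) Ht).
  apply (pdef_subst (n := S n) (t := fun v => u (fun i => v (S i)))
           (Q := fun v => Q (v 1) (v 0) (w (fun i => v (S (S i)))) (s (fun i => v (S (S i)))))); [apply tdef_weaken, Hu|].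
  apply (pdef_subst (n := S (S n)) (t := fun v => w (fun i => v (S (S i))))
           (Q := fun v => Q (v 2) (v 1) (v 0) (s (fun i => v (S (S (S i))))))).
  { apply (tdef_weaken (t := fun v => w (fun i => v (S i)))), tdef_weaken, Hw. }
  apply (pdef_subst (n := S (S (S n))) (t := fun v => s (fun i => v (S (S (S i)))))
           (Q := fun v => Q (v 3) (v 2) (v 1) (v 0))).
  { apply (tdef_weaken (t := fun v => s (fun i => v (S (S i))))),
      (tdef_weaken (t := fun v => s (fun i => v (S i)))), tdef_weaken, Hs. }
  apply (pdef_rename (m := S (S (S (S n)))) (f := fun i => 3 - i)) in HQ; [exact HQ|lia].
Qed.

Lemma pdef_eq n t u : tdef C n t -> tdef C n u -> pdef C n (fun v => t v = u v).
Proof.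
  intros Ht Hu. apply (pdef_subst (Q := fun v => v 0 = u (fun i => v (S i))) Ht Hu).
Qed.

Lemma pdef_mem n t u : tdef C n t -> tdef C n u -> pdef C n (fun v => t v ∈ u v).
Proof.
  apply (pdef_app2 (Q := fun x y => x ∈ y)).
  destruct HC as [c Hc]. exists (f_mem 0 1), (fun _ => c). split; [auto|]. cbn. tauto.
Qed.

Lemma tdef_app1 (F : U -> U) n t :
  tdef C 1 (fun v => F (v 0)) -> tdef C n t -> tdef C n (fun v => F (t v)).
Proof.
  intros HF Ht. apply (pdef_app2 (Q := fun x y => x = F y) HF (n := S n)
    (t := fun v => v 0) (u := fun v => t (fun i => v (S i)))).
  - apply tdef_var. lia.
  - apply tdef_weaken, Ht.
Qed.

Lemma tdef_app2 (F : U -> U -> U) n t u :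
  tdef C 2 (fun v => F (v 0) (v 1)) -> tdef C n t -> tdef C n u ->
  tdef C n (fun v => F (t v) (u v)).
Proof.
  intros HF Ht Hu. apply (pdef_app3 (Q := fun x y z => x = F y z) HF (n := S n)
    (t := fun v => v 0) (u := fun v => t (fun i => v (S i))) (w := fun v => u (fun i => v (S i)))).
  - apply tdef_var. lia.
  - apply tdef_weaken, Ht.
  - apply tdef_weaken, Hu.
Qed.

End DefinabilityClosure.

(** * Automatic proofs of first-order definability *)

Class Def1 {U : structure} (C : U -> Prop) (Q : U -> Prop) :=
  def1 : pdef C 1 (fun v => Q (v 0)).
Class Def2 {U : structure} (C : U -> Prop) (Q : U -> U -> Prop) :=
  def2 : pdef C 2 (fun v => Q (v 0) (v 1)).
Class Def3 {U : structure} (C : U -> Prop) (Q : U -> U -> U -> Prop) :=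
  def3 : pdef C 3 (fun v => Q (v 0) (v 1) (v 2)).
Class Def4 {U : structure} (C : U -> Prop) (Q : U -> U -> U -> U -> Prop) :=
  def4 : pdef C 4 (fun v => Q (v 0) (v 1) (v 2) (v 3)).
Class Fun1 {U : structure} (C : U -> Prop) (F : U -> U) :=
  fun1 : tdef C 1 (fun v => F (v 0)).
Class Fun2 {U : structure} (C : U -> Prop) (F : U -> U -> U) :=
  fun2 : tdef C 2 (fun v => F (v 0) (v 1)).

Ltac def_inst := solve [assumption | typeclasses eauto].

Ltac tdefn :=
  cbv beta;
  match goal with
  | |- tdef ?C _ (fun _ => ?c) => apply (tdef_const (C := C)); first [exact I | reflexivity | assumption]
  | |- tdef ?C _ (fun v => v _) => apply (tdef_var (C := C)); apply Nat.ltb_lt; reflexivity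
  | |- @tdef ?U ?C _ (fun v => ?F (@?t v) (@?u v)) =>
      lazymatch type of F with carrier U -> _ => idtac end;
      apply (tdef_app2 (C := C) (F := F)); [ change (Fun2 C F); def_inst | tdefn | tdefn]
  | |- @tdef ?U ?C _ (fun v => ?F (@?t v)) =>
      lazymatch type of F with carrier U -> _ => idtac end;
      apply (tdef_app1 (C := C) (F := F)); [ change (Fun1 C F); def_inst | tdefn]
  end.

Ltac defn_app :=
  match goal with
  | |- @pdef ?U ?C _ (fun v => ?Q (@?t v) (@?u v) (@?w v) (@?s v)) =>
      lazymatch type of Q with carrier U -> _ => idtac end;
      apply (pdef_app4 (C := C) (Q := Q)); [ change (Def4 C Q); def_inst | tdefn ..]
  | |- @pdef ?U ?C _ (fun v => ?Q (@?t v) (@?u v) (@?w v)) =>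
      lazymatch type of Q with carrier U -> _ => idtac end;
      apply (pdef_app3 (C := C) (Q := Q)); [ change (Def3 C Q); def_inst | tdefn ..]
  | |- @pdef ?U ?C _ (fun v => ?Q (@?t v) (@?u v)) =>
      lazymatch type of Q with carrier U -> _ => idtac end;
      apply (pdef_app2 (C := C) (Q := Q)); [ change (Def2 C Q); def_inst | tdefn ..]
  | |- @pdef ?U ?C _ (fun v => ?Q (@?t v)) =>
      lazymatch type of Q with carrier U -> _ => idtac end;
      apply (pdef_app1 (C := C) (Q := Q)); [ change (Def1 C Q); def_inst | tdefn ]
  end.

(** Propositions independent of the variables are caught first, and a non-dependent product is read
    as an implication before the clause for quantifiers is tried. *)
Ltac defn :=
  cbv beta;
  lazymatch goal with
  | |- pdef ?C _ (fun _ => ?A) => apply (pdef_const (C := C))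
  | |- pdef ?C _ (fun v => ~ _) => apply (pdef_not (C := C)); defn
  | |- pdef ?C _ (fun v => _ /\ _) => apply (pdef_and (C := C)); defn
  | |- pdef ?C _ (fun v => _ \/ _) => apply (pdef_or (C := C)); defn
  | |- pdef ?C _ (fun v => _ <-> _) => apply (pdef_iff (C := C)); defn
  | |- pdef ?C _ (fun v => exists x, _) => apply (pdef_ex (C := C)); defn
  | |- pdef ?C _ (fun v => _ = _) => apply (pdef_eq (C := C)); tdefn
  | |- pdef ?C _ (fun v => _ ∈ _) => apply (pdef_mem (C := C)); tdefn
  | |- pdef ?C _ (fun v => @?A v -> @?B v) => apply (pdef_imp (C := C)); defn
  | |- pdef ?C _ (fun v => forall x, _) => apply (pdef_all (C := C)); defn
  | |- _ => defn_app
  end.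

Ltac solve_def :=
  cbv beta delta [Def1 Def2 Def3 Def4]; defn.

Section DefInstances.
Context {U : structure} (C : U -> Prop) {HC : Params C}.
Global Instance def_mem : Def2 C (@mem U). Proof. solve_def. Qed.
Global Instance def_subset : Def2 C (@subset U). Proof. unfold subset, unique; solve_def. Qed.
Global Instance def_is_upair : Def3 C (@is_upair U). Proof. unfold is_upair; solve_def. Qed.
Global Instance def_is_succ : Def2 C (@is_succ U). Proof. unfold is_succ, unique; solve_def. Qed.
Global Instance def_is_opair : Def3 C (@is_opair U). Proof. unfold is_opair, unique; solve_def. Qed.
Global Instance def_rel : Def3 C (@rel U). Proof. unfold rel, unique; solve_def. Qed.
Global Instance def_is_relation : Def3 C (@is_relation U). Proof. unfold is_relation, unique; solve_def. Qed.
Global Instance def_is_fun : Def3 C (@is_fun U). Proof. unfold is_fun, unique; solve_def. Qed.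
Global Instance def_is_injection : Def3 C (@is_injection U). Proof. unfold is_injection, unique; solve_def. Qed.
Global Instance def_is_bijection : Def3 C (@is_bijection U). Proof. unfold is_bijection, unique; solve_def. Qed.
Global Instance def_equinumerous : Def2 C (@equinumerous U). Proof. unfold equinumerous, unique; solve_def. Qed.
Global Instance def_le_size : Def2 C (@le_size U). Proof. unfold le_size, unique; solve_def. Qed.
Global Instance def_transitive : Def1 C (@transitive U). Proof. unfold transitive, unique; solve_def. Qed.
Global Instance def_is_ordinal : Def1 C (@is_ordinal U). Proof. unfold is_ordinal, unique; solve_def. Qed.
Global Instance def_is_cardinal : Def1 C (@is_cardinal U). Proof. unfold is_cardinal, unique; solve_def. Qed.
Global Instance def_has_card : Def2 C (@has_card U). Proof. unfold has_card, unique; solve_def. Qed.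
Global Instance def_is_trcl : Def2 C (@is_trcl U). Proof. unfold is_trcl, unique; solve_def. Qed.
End DefInstances.

(** * Sets, pairs and functions *)

Existing Class ZFC.

Definition anyp {U : structure} : U -> Prop := fun _ => True.

Global Instance params_anyp (U : structure) (hU : ZFC U) : Params (@anyp U).
Proof. destruct (zfc_infinity hU) as [w _]. exists w. exact I. Qed.

Section Sets.
Context {U : structure} {hU : ZFC U}.
Implicit Types (a b c d e f x y z u w p q : U) (Q : U -> Prop).

Lemma ext a b : (forall z, z ∈ a <-> z ∈ b) -> a = b.
Proof. apply (zfc_extensionality hU). Qed.

Lemma separation a Q : Def1 anyp Q -> exists b, forall x, x ∈ b <-> x ∈ a /\ Q x.
Proof.
  intros (phi & env & _ & H). destruct (zfc_separation hU phi env a) as [b Hb].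
  exists b. intros x. rewrite Hb, (H (scons x env)), vapp_scons. cbn [scons].
  replace (vapp 0 env env) with env; [tauto|].
  apply functional_extensionality. intros i. unfold vapp. cbn. now rewrite Nat.sub_0_r.
Qed.

Lemma replacement a (Q : U -> U -> Prop) : Def2 anyp Q ->
  (forall x y y', x ∈ a -> Q x y -> Q x y' -> y = y') ->
  exists b, forall y, y ∈ b <-> exists x, x ∈ a /\ Q x y.
Proof.
  intros (phi & env & _ & H) Hf.
  assert (E : forall x y, Q x y <-> sat (scons x (scons y env)) phi).
  { intros x y. rewrite (H (scons x (scons y env))), !vapp_scons. cbn [scons].
    replace (vapp 0 env env) with env; [tauto|].
    apply functional_extensionality. intros i. unfold vapp. cbn. now rewrite Nat.sub_0_r. }
  destruct (zfc_replacement hU (phi := phi) (env := env) (a := a)) as [b Hb].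
  - intros x y y' Hx K K'. apply E in K, K'. eauto.
  - exists b. intros y. rewrite Hb.
    split; intros (x & Hx & K); exists x; (split; [exact Hx|]); apply E; exact K.
Qed.

(** [epsilon] makes this a total operation, available before [Q] is known to be first-order; only
    [in_sep] asks for that. *)
Definition sep a Q : U :=
  epsilon (inhabits a) (fun b => forall x, x ∈ b <-> x ∈ a /\ Q x).

Lemma in_sep a Q : Def1 anyp Q -> forall x, x ∈ sep a Q <-> x ∈ a /\ Q x.
Proof. intros HQ. exact (epsilon_spec (inhabits a) _ (separation a HQ)). Qed.

Definition upair a b : U :=
  proj1_sig (constructive_indefinite_description _ (zfc_pairing hU a b)).

Lemma in_upair a b z : z ∈ upair a b <-> z = a \/ z = b.
Proof. exact (proj2_sig (constructive_indefinite_description _ (zfc_pairing hU a b)) z). Qed.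

Definition bigcup a : U :=
  proj1_sig (constructive_indefinite_description _ (zfc_union hU a)).

Lemma in_bigcup a z : z ∈ bigcup a <-> exists x, x ∈ a /\ z ∈ x.
Proof. exact (proj2_sig (constructive_indefinite_description _ (zfc_union hU a)) z). Qed.

Definition pow a : U :=
  proj1_sig (constructive_indefinite_description _ (zfc_powerset hU a)).

Lemma in_pow a z : z ∈ pow a <-> subset z a.
Proof. exact (proj2_sig (constructive_indefinite_description _ (zfc_powerset hU a)) z). Qed.

Definition opair a b : U := upair (upair a a) (upair a b).
Definition cup a b : U := bigcup (upair a b).
Definition succ a : U := cup a (upair a a).

Lemma in_cup a b z : z ∈ cup a b <-> z ∈ a \/ z ∈ b.
Proof.
  unfold cup. rewrite in_bigcup. split.
  - intros (x & Hx & Hz). apply in_upair in Hx. destruct Hx as [-> | ->]; tauto.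
  - intros [H|H]; [exists a|exists b]; rewrite in_upair; tauto.
Qed.

Lemma in_succ a z : z ∈ succ a <-> z ∈ a \/ z = a.
Proof. unfold succ. rewrite in_cup, in_upair. tauto. Qed.

Lemma is_upairE z a b : is_upair z a b <-> z = upair a b.
Proof.
  split.
  - intros H. apply ext. intros y. rewrite in_upair. apply H.
  - intros -> y. apply in_upair.
Qed.

Lemma is_opairE z a b : is_opair z a b <-> z = opair a b.
Proof.
  split.
  - intros (u & v & Hu & Hv & Hz). apply is_upairE in Hu, Hv, Hz. now subst.
  - intros ->. exists (upair a a), (upair a b). now rewrite !is_upairE.
Qed.

Lemma is_succE x y : is_succ x y <-> y = succ x.
Proof.
  split.
  - intros H. apply ext. intros z. rewrite in_succ. apply H.
  - intros -> z. apply in_succ.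
Qed.

Lemma relE r a b : rel r a b <-> opair a b ∈ r.
Proof.
  split.
  - intros (z & Hz & H). apply is_opairE in Hz. now subst.
  - intros H. exists (opair a b). now rewrite is_opairE.
Qed.

Lemma upair_inj_same a b c : upair a b = upair c c -> a = c /\ b = c.
Proof.
  intros E. split.
  - assert (H : a ∈ upair c c) by (rewrite <- E; apply in_upair; auto).
    apply in_upair in H. tauto.
  - assert (H : b ∈ upair c c) by (rewrite <- E; apply in_upair; auto).
    apply in_upair in H. tauto.
Qed.

Lemma upair_inj a b b' : upair a b = upair a b' -> b = b'.
Proof.
  intros E.
  assert (H : b ∈ upair a b') by (rewrite <- E; apply in_upair; auto).
  assert (H' : b' ∈ upair a b) by (rewrite E; apply in_upair; auto).
  apply in_upair in H, H'. destruct H, H'; congruence.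
Qed.

Lemma opair_inj a b a' b' : opair a b = opair a' b' -> a = a' /\ b = b'.
Proof.
  unfold opair. intros E.
  assert (Ea : a = a').
  { assert (H : upair a a ∈ upair (upair a' a') (upair a' b'))
      by (rewrite <- E; apply in_upair; auto).
    apply in_upair in H. destruct H as [H|H].
    - apply upair_inj_same in H. tauto.
    - symmetry in H. apply upair_inj_same in H. symmetry. tauto. }
  subst a'. split; [reflexivity|]. apply upair_inj in E. apply upair_inj in E. exact E.
Qed.

Global Instance fun_upair : Fun2 anyp upair.
Proof.
  apply pdef_ext with (fun v => is_upair (v 0) (v 1) (v 2)); [intros v; symmetry; apply is_upairE|].
  solve_def.
Qed.

Global Instance fun_opair : Fun2 anyp opair.
Proof.
  apply pdef_ext with (fun v => is_opair (v 0) (v 1) (v 2)); [intros v; symmetry; apply is_opairE|].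
  solve_def.
Qed.

Global Instance fun_succ : Fun1 anyp succ.
Proof.
  apply pdef_ext with (fun v => is_succ (v 1) (v 0)); [intros v; symmetry; apply is_succE|].
  solve_def.
Qed.

Global Instance fun_cup : Fun2 anyp cup.
Proof.
  apply pdef_ext with (fun v => forall z, z ∈ v 0 <-> z ∈ v 1 \/ z ∈ v 2); [|solve_def].
  intros v. split.
  - intros E z. rewrite E. apply in_cup.
  - intros H. apply ext. intros z. rewrite in_cup. apply H.
Qed.

Definition emp : U :=
  sep (proj1_sig (constructive_indefinite_description _ (zfc_infinity hU))) (fun _ => False).

Lemma in_emp z : ~ z ∈ emp.
Proof. unfold emp. rewrite in_sep; [tauto|]. solve_def. Qed.

Lemma is_emptyE x : is_empty x <-> x = emp.
Proof.
  split.
  - intros H. apply ext. intros z. split; intros K; [destruct (H z K)|destruct (in_emp K)].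
  - intros -> z. apply in_emp.
Qed.

Lemma not_emp x : x <> emp -> exists y, y ∈ x.
Proof.
  intros H. apply NNPP. intros N. apply H, is_emptyE. intros z Hz. eauto.
Qed.

Definition prod a b : U :=
  sep (pow (pow (cup a b))) (fun z => exists x y, x ∈ a /\ y ∈ b /\ z = opair x y).

Lemma in_prod a b z : z ∈ prod a b <-> exists x y, x ∈ a /\ y ∈ b /\ z = opair x y.
Proof.
  unfold prod. rewrite in_sep by solve_def. split; [tauto|].
  intros H. split; [|exact H]. destruct H as (x & y & Hx & Hy & ->).
  apply in_pow. intros s Hs. apply in_pow. intros t Ht. apply in_cup.
  apply in_upair in Hs. destruct Hs as [-> | ->]; apply in_upair in Ht;
    destruct Ht as [-> | ->]; auto.
Qed.

Lemma opair_in_prod a b x y : opair x y ∈ prod a b <-> x ∈ a /\ y ∈ b.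
Proof.
  rewrite in_prod. split.
  - intros (x' & y' & Hx & Hy & E). apply opair_inj in E. destruct E; now subst.
  - intros [Hx Hy]. eauto 6.
Qed.

Global Instance fun_prod : Fun2 anyp prod.
Proof.
  apply pdef_ext with (fun v => forall z, z ∈ v 0 <->
     exists x y, x ∈ v 1 /\ y ∈ v 2 /\ z = opair x y); [|solve_def].
  intros v. split.
  - intros E z. rewrite E. apply in_prod.
  - intros H. apply ext. intros z. rewrite in_prod. apply H.
Qed.

Lemma subset_refl a : subset a a.
Proof. intros z Hz. exact Hz. Qed.

Lemma subset_antisym a b : subset a b -> subset b a -> a = b.
Proof. intros H K. apply ext. intros z. split; [apply H|apply K]. Qed.

Lemma minimal Q a : Def1 anyp Q -> (exists x, x ∈ a /\ Q x) ->
  exists x, x ∈ a /\ Q x /\ forall y, y ∈ x -> y ∈ a -> ~ Q y.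
Proof.
  intros HQ (x & Hx & HQx).
  destruct (zfc_foundation hU (x := sep a Q)) as (y & Hy & N).
  - exists x. apply in_sep; auto.
  - apply in_sep in Hy; [|exact HQ]. destruct Hy as [Hy HQy]. exists y. split; [|split]; auto.
    intros z Hz Hza HQz. apply (N z Hz). apply in_sep; auto.
Qed.

Lemma mem_irrefl a : ~ a ∈ a.
Proof.
  intros H. destruct (zfc_foundation hU (x := upair a a)) as (y & Hy & N).
  - exists a. apply in_upair. auto.
  - apply in_upair in Hy. assert (y = a) by tauto. subst y.
    apply (N a H). apply in_upair. auto.
Qed.

Lemma mem_asym a b : a ∈ b -> ~ b ∈ a.
Proof.
  intros H K. destruct (zfc_foundation hU (x := upair a b)) as (y & Hy & N).
  - exists a. apply in_upair; auto.
  - apply in_upair in Hy. destruct Hy as [-> | ->].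
    + apply (N b K), in_upair. auto.
    + apply (N a H), in_upair. auto.
Qed.

Lemma mem_no_cycle3 a b c : a ∈ b -> b ∈ c -> ~ c ∈ a.
Proof.
  intros H K L. destruct (zfc_foundation hU (x := cup (upair a b) (upair c c))) as (y & Hy & N).
  - exists a. apply in_cup. left. apply in_upair; auto.
  - apply in_cup in Hy. rewrite !in_upair in Hy. destruct Hy as [[-> | ->] | [-> | ->]].
    + apply (N c L), in_cup. right. apply in_upair; auto.
    + apply (N a H), in_cup. left. apply in_upair; auto.
    + apply (N b K), in_cup. left. apply in_upair; auto.
    + apply (N b K), in_cup. left. apply in_upair; auto.
Qed.

(** * Relations, injections and sizes *)

Lemma graph a b (Q : U -> U -> Prop) : Def2 anyp Q ->
  exists f, is_relation f a b /\ forall x y, rel f x y <-> x ∈ a /\ y ∈ b /\ Q x y.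
Proof.
  intros HQ.
  destruct (separation (prod a b) (Q := fun z => exists x y, z = opair x y /\ Q x y)) as [f Hf];
    [solve_def|].
  exists f. split.
  - intros z Hz. apply Hf in Hz. destruct Hz as [Hz _]. apply in_prod in Hz.
    destruct Hz as (x & y & Hx & Hy & ->). exists x, y. rewrite is_opairE. auto.
  - intros x y. rewrite relE, Hf, opair_in_prod. split.
    + intros ((Hx & Hy) & x' & y' & E & HQ'). apply opair_inj in E. destruct E; subst. auto.
    + intros (Hx & Hy & HQ'). split; [auto|]. eauto.
Qed.

Lemma relation_dom f a b x y : is_relation f a b -> rel f x y -> x ∈ a /\ y ∈ b.
Proof.
  intros Hf H. apply relE in H. destruct (Hf _ H) as (x' & y' & Hx & Hy & E).
  apply is_opairE in E. apply opair_inj in E. destruct E; now subst.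
Qed.

Lemma relation_ext f g a b a' b' : is_relation f a b -> is_relation g a' b' ->
  (forall x y, rel f x y <-> rel g x y) -> f = g.
Proof.
  intros Hf Hg H. apply ext. intros z. split; intros Hz.
  - destruct (Hf _ Hz) as (x & y & _ & _ & E). apply is_opairE in E. subst.
    apply relE, H, relE, Hz.
  - destruct (Hg _ Hz) as (x & y & _ & _ & E). apply is_opairE in E. subst.
    apply relE, H, relE, Hz.
Qed.

Lemma fun_dom f a b x y : is_fun f a b -> rel f x y -> x ∈ a /\ y ∈ b.
Proof. intros [H _]. apply relation_dom, H. Qed.

Lemma fun_total f a b x : is_fun f a b -> x ∈ a -> exists y, y ∈ b /\ rel f x y.
Proof.
  intros H Hx. destruct (proj2 H x Hx) as (y & Hy & _). exists y.
  split; [|exact Hy]. apply (fun_dom H Hy).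
Qed.

Lemma fun_unique f a b x y y' : is_fun f a b -> rel f x y -> rel f x y' -> y = y'.
Proof.
  intros H Hy Hy'. destruct (proj2 H x (proj1 (fun_dom H Hy))) as (z & _ & Hu).
  now rewrite <- (Hu y Hy), <- (Hu y' Hy').
Qed.

Lemma make_fun a b (Q : U -> U -> Prop) : Def2 anyp Q ->
  (forall x, x ∈ a -> exists y, y ∈ b /\ Q x y) ->
  (forall x y y', x ∈ a -> Q x y -> Q x y' -> y = y') ->
  exists f, is_fun f a b /\ forall x y, rel f x y <-> x ∈ a /\ y ∈ b /\ Q x y.
Proof.
  intros HQ Ht Hu. destruct (graph a b HQ) as (f & Hf & Hr). exists f. split; [|exact Hr].
  split; [exact Hf|]. intros x Hx. destruct (Ht x Hx) as (y & Hy & HQy). exists y. split.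
  - apply Hr; auto.
  - intros y' Hy'. apply Hr in Hy'. apply (Hu x); tauto.
Qed.

Lemma le_size_intro a b (Q : U -> U -> Prop) : Def2 anyp Q ->
  (forall x, x ∈ a -> exists y, y ∈ b /\ Q x y) ->
  (forall x y y', x ∈ a -> Q x y -> Q x y' -> y = y') ->
  (forall x x' y, x ∈ a -> x' ∈ a -> Q x y -> Q x' y -> x = x') ->
  le_size a b.
Proof.
  intros HQ Ht Hu Hi. destruct (make_fun HQ Ht Hu) as (f & Hf & Hr). exists f.
  split; [exact Hf|]. intros x x' y H H'. apply Hr in H, H'. apply (Hi x x' y); tauto.
Qed.

Lemma le_size_subset a b : subset a b -> le_size a b.
Proof.
  intros H. apply le_size_intro with (Q := fun x y => x = y); [solve_def| | |]; try congruence.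
  intros x Hx. eauto.
Qed.

Lemma le_size_trans a b c : le_size a b -> le_size b c -> le_size a c.
Proof.
  intros [f [Hf Hfi]] [g [Hg Hgi]].
  apply le_size_intro with (Q := fun x z => exists y, rel f x y /\ rel g y z); [solve_def| | |].
  - intros x Hx. destruct (fun_total Hf Hx) as (y & Hy & Hxy).
    destruct (fun_total Hg Hy) as (z & Hz & Hyz). eauto.
  - intros x z z' _ (y & Hy & Hz) (y' & Hy' & Hz').
    rewrite (fun_unique Hf Hy' Hy) in Hz'. exact (fun_unique Hg Hz Hz').
  - intros x x' z _ _ (y & Hy & Hz) (y' & Hy' & Hz').
    rewrite (Hgi _ _ _ Hz' Hz) in Hy'. exact (Hfi _ _ _ Hy Hy').
Qed.

Lemma le_size_prod a b a' b' : le_size a a' -> le_size b b' -> le_size (prod a b) (prod a' b').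
Proof.
  intros [f [Hf Hfi]] [g [Hg Hgi]].
  apply le_size_intro with (Q := fun p q => exists x y x' y',
    p = opair x y /\ q = opair x' y' /\ rel f x x' /\ rel g y y'); [solve_def| | |].
  - intros p Hp. apply in_prod in Hp. destruct Hp as (x & y & Hx & Hy & ->).
    destruct (fun_total Hf Hx) as (x' & Hx' & Hxx). destruct (fun_total Hg Hy) as (y' & Hy' & Hyy).
    exists (opair x' y'). rewrite opair_in_prod. eauto 10.
  - intros p q q' _ (x & y & x' & y' & -> & -> & Hx & Hy) (x1 & y1 & x1' & y1' & E & -> & Hx1 & Hy1).
    apply opair_inj in E. destruct E; subst x1 y1.
    f_equal; [exact (fun_unique Hf Hx Hx1)|exact (fun_unique Hg Hy Hy1)].
  - intros p q q' _ _ (x & y & x' & y' & -> & -> & Hx & Hy) (x1 & y1 & x1' & y1' & -> & E & Hx1 & Hy1).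
    apply opair_inj in E. destruct E; subst x1' y1'.
    f_equal; [exact (Hfi _ _ _ Hx Hx1)|exact (Hgi _ _ _ Hy Hy1)].
Qed.

Lemma le_size_pow a b : le_size a b -> le_size (pow a) (pow b).
Proof.
  intros [f [Hf Hfi]].
  apply le_size_intro with (Q := fun x y => forall z, z ∈ y <-> exists t, t ∈ x /\ rel f t z);
    [solve_def| | |].
  - intros x Hx. apply in_pow in Hx.
    destruct (separation b (Q := fun z => exists t, t ∈ x /\ rel f t z)) as [y Hy]; [solve_def|].
    exists y. split.
    + apply in_pow. intros z Hz. apply Hy in Hz. tauto.
    + intros z. rewrite Hy. split; [tauto|]. intros (t & Ht & Hz). split; [|eauto].
      apply (fun_dom Hf Hz).
  - intros x y y' _ H H'. apply ext. intros z. rewrite H, H'. tauto.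
  - intros x x' y Hx Hx' H H'. apply in_pow in Hx, Hx'.
    assert (K : forall x x', subset x a -> (forall z, z ∈ y <-> exists t, t ∈ x /\ rel f t z) ->
      (forall z, z ∈ y <-> exists t, t ∈ x' /\ rel f t z) -> subset x x').
    { clear x x' Hx Hx' H H'. intros x x' Hx H H' t Ht.
      destruct (fun_total Hf (Hx _ Ht)) as (z & _ & Hz).
      destruct (proj1 (H' z)) as (t' & Ht' & Hz'); [apply H; eauto|].
      now rewrite (Hfi _ _ _ Hz Hz'). }
    apply subset_antisym; eauto.
Qed.

Lemma bijection_le_size a b : equinumerous a b -> le_size a b.
Proof. intros (f & H & _). exists f. exact H. Qed.

Lemma make_bij a b (Q : U -> U -> Prop) : Def2 anyp Q ->
  (forall x, x ∈ a -> exists y, y ∈ b /\ Q x y) ->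
  (forall x y y', x ∈ a -> Q x y -> Q x y' -> y = y') ->
  (forall x x' y, x ∈ a -> x' ∈ a -> Q x y -> Q x' y -> x = x') ->
  (forall y, y ∈ b -> exists x, x ∈ a /\ Q x y) ->
  equinumerous a b.
Proof.
  intros HQ Ht Hu Hi Hs. destruct (make_fun HQ Ht Hu) as (f & Hf & Hr). exists f.
  split; [split; [exact Hf|]|].
  - intros x x' y H H'. apply Hr in H, H'. apply (Hi x x' y); tauto.
  - intros y Hy. destruct (Hs y Hy) as (x & Hx & H). exists x. apply Hr; auto.
Qed.

Lemma equinumerous_sym a b : equinumerous a b -> equinumerous b a.
Proof.
  intros (f & [Hf Hi] & Hs). apply make_bij with (Q := fun y x => rel f x y); [solve_def| | | |].
  - intros y Hy. destruct (Hs y Hy) as (x & Hx). exists x. split; [apply (fun_dom Hf Hx)|exact Hx].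
  - intros y x x' _ H H'. exact (Hi _ _ _ H H').
  - intros y y' x _ _ H H'. exact (fun_unique Hf H H').
  - intros x Hx. destruct (fun_total Hf Hx) as (y & Hy & H). eauto.
Qed.

Lemma equinumerous_trans a b c : equinumerous a b -> equinumerous b c -> equinumerous a c.
Proof.
  intros (f & [Hf Hfi] & Hfs) (g & [Hg Hgi] & Hgs).
  apply make_bij with (Q := fun x z => exists y, rel f x y /\ rel g y z); [solve_def| | | |].
  - intros x Hx. destruct (fun_total Hf Hx) as (y & Hy & Hxy).
    destruct (fun_total Hg Hy) as (z & Hz & Hyz). eauto.
  - intros x z z' _ (y & Hy & Hz) (y' & Hy' & Hz').
    rewrite (fun_unique Hf Hy' Hy) in Hz'. exact (fun_unique Hg Hz Hz').
  - intros x x' z _ _ (y & Hy & Hz) (y' & Hy' & Hz').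
    rewrite (Hgi _ _ _ Hz' Hz) in Hy'. exact (Hfi _ _ _ Hy Hy').
  - intros z Hz. destruct (Hgs z Hz) as (y & Hy). destruct (Hfs y) as (x & Hx);
      [apply (fun_dom Hg Hy)|]. exists x. split; [apply (fun_dom Hf Hx)|eauto].
Qed.

(** The axiom of choice is stated for pairwise disjoint families, so the candidates for x are tagged
    with x: the family consists of the sets of pairs (x, y) with [Q x y]. *)
Lemma choice_fun a b (Q : U -> U -> Prop) : Def2 anyp Q ->
  (forall x, x ∈ a -> exists y, y ∈ b /\ Q x y) ->
  exists f, is_fun f a b /\ forall x y, rel f x y -> Q x y.
Proof.
  intros HQ Ht.
  set (B := fun x s => forall z, z ∈ s <-> exists y, y ∈ b /\ Q x y /\ z = opair x y).
  assert (HB : Def2 anyp B) by (unfold B; solve_def).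
  destruct (@replacement a B HB) as [F HF].
  { intros x s s' _ H H'. apply ext. intros z. rewrite (H z), (H' z). tauto. }
  assert (EB : forall x, exists s, B x s).
  { intros x. destruct (separation (prod (upair x x) b)
      (Q := fun z => exists y, y ∈ b /\ Q x y /\ z = opair x y)) as [s Hs]; [solve_def|].
    exists s. intros z. rewrite Hs. split; [tauto|]. intros (y & Hy & HQy & ->).
    rewrite opair_in_prod, in_upair. eauto 10. }
  destruct (zfc_choice hU (a := F)) as [c Hc].
  - intros s Hs. apply HF in Hs. destruct Hs as (x & Hx & Hs).
    destruct (Ht x Hx) as (y & Hy & HQy). exists (opair x y). apply Hs. eauto.
  - intros s s' z Hs Hs' Hz Hz'. apply HF in Hs, Hs'.
    destruct Hs as (x & Hx & Hs). destruct Hs' as (x' & Hx' & Hs').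
    apply Hs in Hz as Kz. apply Hs' in Hz' as Kz'. destruct Kz as (y & _ & _ & ->).
    destruct Kz' as (y' & _ & _ & E). apply opair_inj in E. destruct E; subst x'.
    apply ext. intros z. rewrite (Hs z), (Hs' z). tauto.
  - destruct (@make_fun a b (fun x y => y ∈ b /\ Q x y /\ opair x y ∈ c)) as (f & Hf & Hr).
    + solve_def.
    + intros x Hx. destruct (EB x) as [s Hs].
      destruct (Hc s) as (z & [Hz Hzc] & _); [apply HF; eauto|].
      apply Hs in Hz. destruct Hz as (y & Hy & HQy & ->). eauto 6.
    + intros x y y' Hx (Hy1 & HQ1 & H1) (Hy2 & HQ2 & H2). destruct (EB x) as [s Hs].
      destruct (Hc s) as (z & _ & Hu); [apply HF; eauto|].
      assert (E : opair x y = opair x y').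
      { rewrite <- (Hu (opair x y)), <- (Hu (opair x y')); [reflexivity| |];
          (split; [apply Hs; eauto|assumption]). }
      apply opair_inj in E. tauto.
    + exists f. split; [exact Hf|]. intros x y H. apply Hr in H. tauto.
Qed.

End Sets.

(** * Ordinals *)

Section Ordinals.
Context {U : structure} {hU : ZFC U}.
Implicit Types (a b c d e f k m n w x y z u p q A X : U) (Q : U -> Prop).

Lemma ord_elem a b : is_ordinal a -> b ∈ a -> is_ordinal b.
Proof.
  intros [Ht Hl] Hb. split.
  - intros c Hc d Hd.
    assert (Hda : d ∈ a) by (apply (Ht c); [apply (Ht b); auto|auto]).
    destruct (Hl d b Hda Hb) as [H|[H|H]]; [exact H| |].
    + subst d. destruct (mem_asym Hc Hd).
    + destruct (mem_no_cycle3 Hd Hc H).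
  - intros y z Hy Hz. apply Hl; apply (Ht b); auto.
Qed.

Lemma ord_trans a b c : is_ordinal c -> a ∈ b -> b ∈ c -> a ∈ c.
Proof. intros [Ht _] H K. exact (Ht b K a H). Qed.

(** If the inclusion is proper, an ∈-minimal element of b \ a equals a. *)
Lemma ord_subset a b : is_ordinal a -> is_ordinal b -> subset a b -> a = b \/ a ∈ b.
Proof.
  intros Ha Hb H. destruct (classic (a = b)) as [E|E]; [auto|right].
  destruct (minimal (Q := fun x => ~ x ∈ a) (a := b)) as (x & Hx & Hxa & Hm); [solve_def| |].
  - apply NNPP. intros N. apply E, subset_antisym; [exact H|]. intros z Hz.
    apply NNPP. intros K. eauto.
  - replace a with x; [exact Hx|]. apply ext. intros y. split; intros Hy.
    + apply NNPP. intros K. apply (Hm y); auto. apply (ord_trans Hb Hy Hx).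
    + destruct (proj2 Hb y x (H _ Hy) Hx) as [K|[K|K]]; [exact K| |].
      * subst y. tauto.
      * destruct Hxa. apply (ord_trans Ha K Hy).
Qed.

Lemma ord_trich a b : is_ordinal a -> is_ordinal b -> a ∈ b \/ a = b \/ b ∈ a.
Proof.
  intros Ha Hb. set (c := sep a (fun x => x ∈ b)).
  assert (Hc : forall x, x ∈ c <-> x ∈ a /\ x ∈ b) by (apply in_sep; solve_def).
  assert (Oc : is_ordinal c).
  { split.
    - intros y Hy z Hz. apply Hc in Hy. apply Hc. split.
      + apply (ord_trans Ha Hz); tauto.
      + apply (ord_trans Hb Hz); tauto.
    - intros y z Hy Hz. apply Hc in Hy, Hz. apply (proj2 Ha); tauto. }
  destruct (ord_subset Oc Ha) as [E|E]; [intros x Hx; apply Hc in Hx; tauto| |].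
  - destruct (ord_subset Oc Hb) as [E'|E']; [intros x Hx; apply Hc in Hx; tauto| |].
    + right; left. congruence.
    + left. now rewrite <- E.
  - destruct (ord_subset Oc Hb) as [E'|E']; [intros x Hx; apply Hc in Hx; tauto| |].
    + right; right. now rewrite <- E'.
    + destruct (mem_irrefl (a := c)). apply Hc. auto.
Qed.

Lemma ord_mem_subset a b : is_ordinal b -> a ∈ b -> subset a b.
Proof. intros Hb H z Hz. exact (ord_trans Hb Hz H). Qed.

Lemma ord_not_mem a b : is_ordinal a -> is_ordinal b -> ~ a ∈ b -> subset b a.
Proof.
  intros Ha Hb H. destruct (ord_trich Ha Hb) as [K|[K|K]]; [tauto| |].
  - subst. apply subset_refl.
  - apply ord_mem_subset; assumption.
Qed.

Lemma ord_succ a : is_ordinal a -> is_ordinal (succ a).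
Proof.
  intros Ha. split.
  - intros y Hy z Hz. apply in_succ in Hy. apply in_succ. left. destruct Hy as [Hy| ->]; [|exact Hz].
    apply (ord_trans Ha Hz Hy).
  - intros y z Hy Hz. apply in_succ in Hy, Hz.
    apply ord_trich; [destruct Hy as [Hy| ->]|destruct Hz as [Hz| ->]]; auto;
      eapply ord_elem; eauto.
Qed.

Lemma succ_inj a b : succ a = succ b -> a = b.
Proof.
  intros E. assert (H : a ∈ succ b) by (rewrite <- E; apply in_succ; auto).
  assert (K : b ∈ succ a) by (rewrite E; apply in_succ; auto).
  apply in_succ in H, K. destruct H as [H|H]; [|exact H]. destruct K as [K|K]; [|auto].
  destruct (mem_asym H K).
Qed.

Lemma ord_min Q a : Def1 anyp Q -> is_ordinal a -> Q a ->
  exists b, is_ordinal b /\ subset b a /\ Q b /\ forall c, c ∈ b -> ~ Q c.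
Proof.
  intros HQ Ha HQa.
  destruct (minimal (Q := Q) (a := succ a)) as (b & Hb & HQb & Hm); [exact HQ| |].
  - exists a. split; [apply in_succ; auto|exact HQa].
  - assert (Os := ord_succ Ha). exists b. split; [apply (ord_elem Os Hb)|]. split; [|split; [exact HQb|]].
    + apply in_succ in Hb. destruct Hb as [Hb| ->]; [apply (ord_mem_subset Ha Hb)|apply subset_refl].
    + intros c Hc. apply (Hm c Hc). apply (ord_trans Os Hc Hb).
Qed.

(** Preimages are chosen with least code, so the axiom of choice is not involved. *)
Lemma le_size_surj a b k (Q : U -> U -> Prop) : Def2 anyp Q ->
  is_ordinal k -> le_size b k ->
  (forall x, x ∈ a -> exists y, y ∈ b /\ Q y x) ->
  (forall y x x', y ∈ b -> Q y x -> Q y x' -> x = x') ->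
  le_size a k.
Proof.
  intros HQ Hk [f [Hf Hi]] Ht Hu.
  apply le_size_intro with (Q := fun x i => (exists y, rel f y i /\ Q y x) /\
    forall j, j ∈ i -> ~ exists y, rel f y j /\ Q y x); [solve_def| | |].
  - intros x Hx. destruct (Ht x Hx) as (y & Hy & HQy).
    destruct (fun_total Hf Hy) as (i & Hi' & Hyi).
    destruct (ord_min (Q := fun i => exists y, rel f y i /\ Q y x) (a := i)) as (j & Hj & Hji & HQj & Hm);
      [solve_def|apply (ord_elem Hk Hi')|eauto|].
    exists j. split; [|split; [exact HQj|exact Hm]].
    destruct HQj as (y' & Hy' & _). apply (fun_dom Hf Hy').
  - intros x i i' _ [(y & Hy & HQy) Hm] [(y' & Hy' & HQy') Hm'].
    assert (O : is_ordinal i) by (apply (ord_elem Hk), (fun_dom Hf Hy)).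
    assert (O' : is_ordinal i') by (apply (ord_elem Hk), (fun_dom Hf Hy')).
    destruct (ord_trich O O') as [K|[K|K]]; [|exact K|].
    + destruct (Hm' _ K). eauto.
    + destruct (Hm _ K). eauto.
  - intros x x' i _ _ [(y & Hy & HQy) _] [(y' & Hy' & HQy') _].
    rewrite (Hi _ _ _ Hy' Hy) in HQy'. apply (Hu y); auto. apply (fun_dom Hf Hy).
Qed.

(** * Recursion along a well-founded relation on a set *)

(** Only sets of the structure are tested, because the structure may be ill-founded from the
    viewpoint of the metatheory. *)
Definition wf_on A (R : U -> U -> Prop) : Prop :=
  forall X, subset X A -> (exists x, x ∈ X) -> exists m, m ∈ X /\ forall y, y ∈ X -> ~ R y m.

Lemma wf_min A R Q : wf_on A R -> Def1 anyp Q -> (exists x, x ∈ A /\ Q x) ->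
  exists x, x ∈ A /\ Q x /\ forall y, y ∈ A -> R y x -> ~ Q y.
Proof.
  intros Hw HQ (x & Hx & HQx). destruct (Hw (sep A Q)) as (m & Hm & H).
  - intros y Hy. apply in_sep in Hy; tauto.
  - exists x. apply in_sep; auto.
  - apply in_sep in Hm; [|exact HQ]. exists m. split; [|split]; try tauto.
    intros y Hy Hr HQy. apply (H y); [apply in_sep; auto|exact Hr].
Qed.

(** Partial solutions of F(x) = H {F(x') : R x' x} whose domain is closed under predecessors. The
    step sees only the set of earlier values; this covers the Mostowski collapse, with H the
    identity, and canonical names, with H u = u × P. *)
Definition attempt A (R : U -> U -> Prop) (H : U -> U) (g : U) : Prop :=
  forall x y, rel g x y -> x ∈ A /\
    (forall x', x' ∈ A -> R x' x -> exists y', rel g x' y') /\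
    exists u, y = H u /\ forall z, z ∈ u <-> exists x', x' ∈ A /\ R x' x /\ rel g x' z.

Lemma attempt_unique A R H g g' : Def2 anyp R -> wf_on A R ->
  attempt A R H g -> attempt A R H g' ->
  forall x y y', rel g x y -> rel g' x y' -> y = y'.
Proof.
  intros HR Hw Hg Hg' x y y' Hy Hy'. apply NNPP. intros N.
  destruct (wf_min (A := A) (R := R)
    (Q := fun x => exists y y', rel g x y /\ rel g' x y' /\ y <> y')) as (m & Hm & HQ & Hmin);
    [exact Hw|solve_def| |].
  { exists x. split; [apply (Hg _ _ Hy)|eauto]. }
  destruct HQ as (t & t' & Ht & Ht' & Hne). apply Hne.
  destruct (Hg _ _ Ht) as (_ & Hd & u & -> & Hu).
  destruct (Hg' _ _ Ht') as (_ & Hd' & u' & -> & Hu'). f_equal. apply ext. intros z.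
  assert (K : forall x' s s', x' ∈ A -> R x' m -> rel g x' s -> rel g' x' s' -> s = s').
  { intros x' s s' Ha Hr Hs Hs'. apply NNPP. intros K. apply (Hmin x' Ha Hr). eauto. }
  rewrite Hu, Hu'. split; intros (x' & Ha & Hr & Hz); exists x'; (split; [exact Ha|split; [exact Hr|]]).
  - destruct (Hd' x' Ha Hr) as [s Hs]. now rewrite (K _ _ _ Ha Hr Hz Hs).
  - destruct (Hd x' Ha Hr) as [s Hs]. now rewrite <- (K _ _ _ Ha Hr Hs Hz).
Qed.

(** Attempts agree where both are defined, so their union [f] is again an attempt. At a minimal
    point m outside its domain, adding the pair (m, H u), with u the set of values below m, would
    give a larger attempt. Replacement provides the range [B]. *)
Lemma recursion A (R : U -> U -> Prop) (H : U -> U) :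
  Def2 anyp R -> Fun1 anyp H -> wf_on A R ->
  exists f B, is_fun f A B /\ (forall y, y ∈ B -> exists x, rel f x y) /\
    forall x y, rel f x y -> exists u, y = H u /\
      forall z, z ∈ u <-> exists x', x' ∈ A /\ R x' x /\ rel f x' z.
Proof.
  intros HR HH Hw.
  set (F := fun x y => exists g, attempt A R H g /\ rel g x y).
  assert (HA : Def1 anyp (attempt A R H)) by (unfold attempt; solve_def).
  assert (HF : Def2 anyp F) by (unfold F; solve_def).
  assert (Fu : forall x y y', F x y -> F x y' -> y = y').
  { intros x y y' (g & Hg & Hy) (g' & Hg' & Hy').
    exact (attempt_unique HR Hw Hg Hg' Hy Hy'). }
  destruct (@replacement _ _ A F HF) as [B HB]; [eauto|].
  destruct (graph A B HF) as (f & Hf & Hr).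
  assert (Hr' : forall x y, rel f x y <-> x ∈ A /\ F x y).
  { intros x y. rewrite Hr. split; [tauto|]. intros [Hx Hy]. split; [auto|split; [|auto]].
    apply HB. eauto. }
  assert (Fatt : attempt A R H f).
  { intros x y Hxy. apply Hr' in Hxy. destruct Hxy as [Hx (g & Hg & Hxy)].
    destruct (Hg _ _ Hxy) as (_ & Hd & u & Hy & Hu). split; [exact Hx|]. split.
    - intros x' Hx' Hrx. destruct (Hd x' Hx' Hrx) as [y' Hy']. exists y'. apply Hr'.
      split; [exact Hx'|]. exists g. auto.
    - exists u. split; [exact Hy|]. intros z. rewrite Hu.
      split; intros (x' & Ha & Hrx & Hz); exists x'; (split; [exact Ha|split; [exact Hrx|]]).
      + apply Hr'. split; [exact Ha|]. exists g. auto.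
      + apply Hr' in Hz. destruct (Hd x' Ha Hrx) as [z' Hz'].
        replace z with z'; [exact Hz'|]. apply (Fu x'); [exists g; auto|tauto]. }
  assert (Tot : forall x, x ∈ A -> exists y, F x y).
  { intros x Hx. apply NNPP. intros N.
    destruct (wf_min (A := A) (R := R) (Q := fun x => ~ exists y, F x y)) as (m & Hm & HQ & Hmin);
      [exact Hw|solve_def|eauto|].
    destruct (separation B (Q := fun z => exists x', x' ∈ A /\ R x' m /\ rel f x' z)) as [u Hu];
      [solve_def|].
    assert (Hu' : forall z, z ∈ u <-> exists x', x' ∈ A /\ R x' m /\ rel f x' z).
    { intros z. rewrite Hu. split; [tauto|]. intros K. split; [|exact K].
      destruct K as (x' & _ & _ & K). apply (relation_dom Hf K). }
    (* As m is not its own predecessor, adding a value at m leaves the set of values below m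
       unchanged. *)
    assert (Irr : ~ R m m).
    { destruct (Hw (upair m m)) as (m' & Hm' & K).
      - intros y Hy. apply in_upair in Hy. destruct Hy; now subst.
      - exists m. apply in_upair. auto.
      - apply in_upair in Hm'. assert (m' = m) by tauto. subst. apply K, in_upair. auto. }
    set (g := cup f (upair (opair m (H u)) (opair m (H u)))).
    assert (Hg : forall x y, rel g x y <-> rel f x y \/ x = m /\ y = H u).
    { intros a b. rewrite !relE. unfold g. rewrite in_cup, in_upair. split.
      - intros [K|K]; [auto|right]. apply opair_inj. tauto.
      - intros [K|[-> ->]]; auto. }
    assert (Nf : forall y, ~ rel f m y).
    { intros y Hy. apply HQ. exists y. apply Hr' in Hy. tauto. }
    apply HQ. exists (H u), g. split; [|apply Hg; auto].
    intros a b Hab. apply Hg in Hab. destruct Hab as [Hab|[-> ->]].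
    - destruct (Fatt _ _ Hab) as (Ha & Hd & u' & Hb & Hu''). split; [exact Ha|]. split.
      + intros x' Hx' Hrx. destruct (Hd x' Hx' Hrx) as [y' Hy']. exists y'. apply Hg. auto.
      + exists u'. split; [exact Hb|]. intros z. rewrite Hu''.
        split; intros (x' & Hx' & Hrx & Hz); exists x'; (split; [exact Hx'|split; [exact Hrx|]]).
        * apply Hg. auto.
        * apply Hg in Hz. destruct Hz as [Hz|[-> _]]; [exact Hz|].
          destruct (Hd m Hx' Hrx) as [y' Hy']. destruct (Nf _ Hy').
    - split; [exact Hm|]. split.
      + intros x' Hx' Hrx. assert (K : exists y, F x' y).
        { apply NNPP. apply (Hmin x' Hx' Hrx). }
        destruct K as [y' Hy']. exists y'. apply Hg. left. apply Hr'. auto.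
      + exists u. split; [reflexivity|]. intros z. rewrite Hu'.
        split; intros (x' & Hx' & Hrx & Hz); exists x'; (split; [exact Hx'|split; [exact Hrx|]]).
        * apply Hg. auto.
        * apply Hg in Hz. destruct Hz as [Hz|[-> _]]; [exact Hz|]. tauto. }
  exists f, B. split; [split; [exact Hf|]|split].
  - intros x Hx. destruct (Tot x Hx) as [y Hy]. exists y. split; [apply Hr'; auto|].
    intros y' Hy'. apply Hr' in Hy'. apply (Fu x); tauto.
  - intros y Hy. apply HB in Hy. destruct Hy as (x & Hx & Hy). exists x. apply Hr'. auto.
  - intros x y Hxy. apply Fatt, Hxy.
Qed.

(** Mostowski collapse of a linear relation. Two distinct points with the same value y are
    comparable and would give y ∈ y; the range is transitive and inherits linearity, hence is an
    ordinal. *)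
Lemma wo_collapse A (R : U -> U -> Prop) : Def2 anyp R -> wf_on A R ->
  (forall x y, x ∈ A -> y ∈ A -> R x y \/ x = y \/ R y x) ->
  exists f t, is_ordinal t /\ is_bijection f A t /\
    forall x y, rel f x y -> forall z, z ∈ y <-> exists x', x' ∈ A /\ R x' x /\ rel f x' z.
Proof.
  intros HR Hw Hl.
  assert (Hid : Fun1 anyp (fun x : U => x)) by (unfold Fun1; apply (tdef_var (C := anyp)); auto).
  destruct (recursion HR Hid Hw) as (f & t & Hf & Hs & Hrec).
  assert (Hrec' : forall x y, rel f x y -> forall z, z ∈ y <-> exists x', x' ∈ A /\ R x' x /\ rel f x' z).
  { intros x y Hxy. destruct (Hrec x y Hxy) as (u & -> & Hu). exact Hu. }
  assert (Mono : forall x x' y y', x ∈ A -> x' ∈ A -> R x' x -> rel f x y -> rel f x' y' -> y' ∈ y).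
  { intros x x' y y' Hx Hx' Hr Hy Hy'. apply (Hrec' x y Hy). eauto. }
  exists f, t. split; [split|split; [split; [split; [exact Hf|]|]|exact Hrec']].
  - intros y Hy z Hz. destruct (Hs y Hy) as [x Hx]. apply (Hrec' x y Hx) in Hz.
    destruct Hz as (x' & _ & _ & Hz). apply (fun_dom Hf Hz).
  - intros y z Hy Hz. destruct (Hs y Hy) as [x Hx]. destruct (Hs z Hz) as [x' Hx'].
    assert (Dx := proj1 (fun_dom Hf Hx)). assert (Dx' := proj1 (fun_dom Hf Hx')).
    destruct (Hl x x' Dx Dx') as [K|[K|K]].
    + left. exact (Mono _ _ _ _ Dx' Dx K Hx' Hx).
    + right; left. subst x'. exact (fun_unique Hf Hx Hx').
    + right; right. exact (Mono _ _ _ _ Dx Dx' K Hx Hx').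
  - intros x x' y Hx Hx'.
    assert (Dx := proj1 (fun_dom Hf Hx)). assert (Dx' := proj1 (fun_dom Hf Hx')).
    destruct (Hl x x' Dx Dx') as [K|[K|K]]; [|exact K|].
    + destruct (mem_irrefl (a := y)). exact (Mono x' x y y Dx' Dx K Hx' Hx).
    + destruct (mem_irrefl (a := y)). exact (Mono x x' y y Dx Dx' K Hx Hx').
  - exact Hs.
Qed.

Lemma mem_wf_on A : wf_on A (@mem U).
Proof.
  intros X _ HX. destruct (zfc_foundation hU HX) as (m & Hm & N). exists m. split; [exact Hm|].
  intros y Hy Hym. exact (N y Hym Hy).
Qed.

Lemma ordinal_of_subset X k : is_ordinal k -> subset X k ->
  exists t, is_ordinal t /\ subset t k /\ equinumerous X t.
Proof.
  intros Hk HX. destruct (wo_collapse (A := X) (R := @mem U)) as (f & t & Ht & Hb & Hrec).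
  - exact _.
  - apply mem_wf_on.
  - intros x y Hx Hy. apply (proj2 Hk); auto.
  - exists t. split; [exact Ht|]. split; [|exists f; exact Hb].
    destruct Hb as [[Hf Hi] Hs].
    (* The collapse never moves a point up: the least m lying below its image would be the image of
       some smaller x', and then x' would lie below its image too. *)
    assert (K : forall x y, rel f x y -> y = x \/ y ∈ x).
    { intros x y Hxy. apply NNPP. intros N.
      destruct (minimal (Q := fun x => exists y, rel f x y /\ ~ (y = x \/ y ∈ x)) (a := X))
        as (m & Hm & (y' & Hy' & Hny) & Hmin); [solve_def| |].
      { exists x. split; [apply (fun_dom Hf Hxy)|eauto]. }
      assert (Oy : is_ordinal y') by (apply (ord_elem Ht), (fun_dom Hf Hy')).
      assert (Om : is_ordinal m) by (apply (ord_elem Hk), HX, Hm).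
      destruct (ord_trich Oy Om) as [E|[E|E]]; [tauto|tauto|].
      apply (Hrec _ _ Hy') in E as (x' & Hx' & Hxm & Hr).
      apply (Hmin x' Hxm Hx'). exists m. split; [exact Hr|].
      intros [E|E]; [subst; exact (mem_irrefl Hxm)|exact (mem_asym E Hxm)]. }
    intros y Hy. destruct (Hs y Hy) as [x Hx]. assert (Dx := HX _ (proj1 (fun_dom Hf Hx))).
    destruct (K x y Hx) as [->|E]; [exact Dx|exact (ord_trans Hk E Dx)].
Qed.

(** The range of the injection is a subset of k, so its order type is at most k; the least ordinal
    equinumerous to X is the cardinal. *)
Lemma card_of X k : is_ordinal k -> le_size X k -> exists m, has_card X m /\ subset m k.
Proof.
  intros Hk (f & Hf & Hi).
  destruct (separation k (Q := fun y => exists x, rel f x y)) as [Y HY]; [solve_def|].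
  assert (E : equinumerous X Y).
  { apply make_bij with (Q := fun x y => rel f x y); [solve_def| | | |].
    - intros x Hx. destruct (fun_total Hf Hx) as (y & Hy & Hxy). exists y. rewrite HY. eauto.
    - intros x y y' _. apply (fun_unique Hf).
    - intros x x' y _ _. apply Hi.
    - intros y Hy. apply HY in Hy. destruct Hy as (_ & x & Hx). exists x.
      split; [apply (fun_dom Hf Hx)|exact Hx]. }
  destruct (@ordinal_of_subset Y k Hk) as (t & Ht & Htk & Eyt); [intros y Hy; apply HY in Hy; tauto|].
  assert (Ext := equinumerous_trans E Eyt).
  destruct (ord_min (Q := fun m => equinumerous X m) (a := t)) as (m & Hm & Hmt & EXm & Hmin);
    [solve_def|exact Ht|exact Ext|].
  exists m. split; [split; [split; [exact Hm|]|exact EXm]|intros z Hz; auto].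
  intros x Hx Hxm. apply (Hmin x Hx). apply (equinumerous_trans EXm), equinumerous_sym, Hxm.
Qed.

(** By [card_of], an injection into t turns into a bijection with an ordinal at most t. *)
Lemma cardinal_no_injection k t : is_cardinal k -> t ∈ k -> ~ le_size k t.
Proof.
  intros [Hk Hm] Ht Hle. assert (Ot := ord_elem Hk Ht).
  destruct (card_of Ot Hle) as (m & [[Om _] E] & Hs).
  apply (Hm m); [|apply equinumerous_sym, E].
  destruct (ord_subset Om Ot Hs) as [-> | K]; [exact Ht|exact (ord_trans Hk K Ht)].
Qed.

End Ordinals.

(** * Natural numbers and Gödel's pairing *)

Section GodelDefs.
Context {U : structure}.
Implicit Types (a b c g k m p q : U).

(** These notions are stated for a bare structure because they are also evaluated in the forcing
    extension, where no axioms are at hand. *)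
Definition is_max a b m := (m = a /\ subset b a) \/ (m = b /\ subset a b).

Definition godel_lt a' b' a b :=
  exists m m', is_max a b m /\ is_max a' b' m' /\
    (m' ∈ m \/ m' = m /\ (a' ∈ a \/ a' = a /\ b' ∈ b)).

Definition rel3 g a b c := exists p, is_opair p a b /\ rel g p c.

(** [g] is the collapse of Gödel's well-ordering of [k × k]. *)
Definition is_godel k g :=
  (forall a b, a ∈ k -> b ∈ k -> exists c, rel3 g a b c) /\
  forall a b c, a ∈ k -> b ∈ k -> rel3 g a b c ->
    forall d, d ∈ c <-> exists a' b', a' ∈ k /\ b' ∈ k /\ godel_lt a' b' a b /\ rel3 g a' b' d.

Definition godel_rel p' p :=
  exists a b a' b', is_opair p a b /\ is_opair p' a' b' /\ godel_lt a' b' a b.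

Context (C : U -> Prop) {HC : Params C}.
Global Instance def_is_max : Def3 C is_max. Proof. unfold is_max; solve_def. Qed.
Global Instance def_godel_lt : Def4 C godel_lt. Proof. unfold godel_lt; solve_def. Qed.
Global Instance def_rel3 : Def4 C rel3. Proof. unfold rel3; solve_def. Qed.
Global Instance def_is_godel : Def2 C is_godel. Proof. unfold is_godel; solve_def. Qed.
Global Instance def_godel_rel : Def2 C godel_rel. Proof. unfold godel_rel; solve_def. Qed.
Global Instance def_is_limit : Def1 C (@is_limit U). Proof. unfold is_limit; solve_def. Qed.
Global Instance def_is_omega : Def1 C (@is_omega U). Proof. unfold is_omega; solve_def. Qed.
Global Instance def_is_infinite_cardinal : Def1 C (@is_infinite_cardinal U).
Proof. unfold is_infinite_cardinal; solve_def. Qed.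
End GodelDefs.

Section Omega.
Context {U : structure} {hU : ZFC U}.
Implicit Types (a b c d e f k l m n w x y z u p q A X : U) (Q : U -> Prop).

Lemma limit_emp l : is_limit l -> emp ∈ l.
Proof.
  intros (Ol & [y Hy] & _).
  destruct (ord_min (Q := fun _ => True) (a := y)) as (b & Ob & Hb & _ & Hm);
    [solve_def|apply (ord_elem Ol Hy)|exact I|].
  replace emp with b; [|apply is_emptyE; intros z Hz; exact (Hm z Hz I)].
  destruct (ord_subset Ob (ord_elem Ol Hy) Hb) as [-> | K]; [exact Hy|exact (ord_trans Ol K Hy)].
Qed.

Lemma limit_succ l n : is_limit l -> n ∈ l -> succ n ∈ l.
Proof.
  intros (Ol & _ & Hl) Hn. assert (On := ord_elem Ol Hn).
  destruct (ord_trich (ord_succ On) Ol) as [K|[K|K]]; [exact K| |].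
  - exfalso. subst l. destruct (Hl n Hn) as (z & Hz & Hnz). apply in_succ in Hz.
    destruct Hz as [Hz| ->]; [exact (mem_asym Hz Hnz)|exact (mem_irrefl Hnz)].
  - apply in_succ in K. destruct K as [K| ->]; [destruct (mem_asym K Hn)|destruct (mem_irrefl Hn)].
Qed.

(** A least counterexample is neither zero nor a limit, so it has a greatest element y and equals y
    + 1. *)
Lemma omega_ind w Q : Def1 anyp Q -> is_omega w -> Q emp ->
  (forall n, n ∈ w -> Q n -> Q (succ n)) -> forall n, n ∈ w -> Q n.
Proof.
  intros HQ [(Ow & Hne & Hl) Hw] H0 HS n Hn. apply NNPP. intros N.
  destruct (minimal (Q := fun n => ~ Q n) (a := w)) as (m & Hm & HQm & Hmin); [solve_def|eauto|].
  assert (Om := ord_elem Ow Hm).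
  destruct (classic (m = emp)) as [E|E]; [now subst|].
  assert (K : exists y, y ∈ m /\ forall z, z ∈ m -> ~ y ∈ z).
  { apply NNPP. intros K. apply (Hw m Hm). split; [exact Om|split; [apply not_emp, E|]].
    intros y Hy. apply NNPP. intros K'. apply K. exists y. split; [exact Hy|]. intros z Hz Hyz. eauto. }
  destruct K as (y & Hy & Hmax).
  assert (E' : m = succ y).
  { apply ext. intros z. rewrite in_succ. split.
    - intros Hz. destruct (ord_trich (ord_elem Om Hz) (ord_elem Om Hy)) as [K|[K|K]]; auto.
      destruct (Hmax z Hz K).
    - intros [Hz| ->]; [exact (ord_trans Om Hz Hy)|exact Hy]. }
  apply HQm. rewrite E'. assert (Hyw : y ∈ w) by (exact (ord_trans Ow Hy Hm)).
  apply HS; [exact Hyw|]. apply NNPP. intros K. exact (Hmin y Hy Hyw K).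
Qed.

(** Pigeonhole by induction: an injection f of ω into n + 1 becomes one into n by sending i to f(i +
    1), or to f(0) in case f(i + 1) = n. *)
Lemma omega_not_le w n : is_omega w -> n ∈ w -> ~ le_size w n.
Proof.
  intros Hw. apply (omega_ind (Q := fun n => ~ le_size w n) (w := w)); [solve_def|exact Hw| |].
  - intros [f [Hf _]]. destruct (fun_total Hf (limit_emp (proj1 Hw))) as (y & Hy & _).
    exact (in_emp Hy).
  - clear n. intros n Hn N [f [Hf Hi]]. apply N.
    assert (Hz := limit_emp (proj1 Hw)).
    apply le_size_intro with (Q := fun i z => rel f (succ i) z /\ z <> n \/
      rel f (succ i) n /\ rel f emp z); [solve_def| | |].
    + intros i Hi'. destruct (fun_total Hf (limit_succ (proj1 Hw) Hi')) as (z & Hzn & Hfz).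
      destruct (classic (z = n)) as [-> | K].
      * destruct (fun_total Hf Hz) as (t & Ht & Hft). exists t. split; [|auto].
        apply in_succ in Ht. destruct Ht as [Ht| ->]; [exact Ht|].
        assert (E := Hi _ _ _ Hfz Hft). destruct (in_emp (z := i)). rewrite <- E. apply in_succ. auto.
      * exists z. split; [|auto]. apply in_succ in Hzn. tauto.
    + intros i z z' _ [[H H']|[H H']] [[K K']|[K K']].
      * exact (fun_unique Hf H K).
      * destruct H'. exact (fun_unique Hf H K).
      * destruct K'. exact (fun_unique Hf K H).
      * exact (fun_unique Hf H' K').
    + intros i i' z _ _ [[H H']|[H H']] [[K K']|[K K']].
      * exact (succ_inj (Hi _ _ _ H K)).
      * assert (E := Hi _ _ _ H K'). destruct (in_emp (z := i)). rewrite <- E. apply in_succ. auto.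
      * assert (E := Hi _ _ _ K H'). destruct (in_emp (z := i')). rewrite <- E. apply in_succ. auto.
      * exact (succ_inj (Hi _ _ _ H K)).
Qed.

Lemma le_size_add X n x : le_size X n -> le_size (cup X (upair x x)) (succ n).
Proof.
  intros [f [Hf Hi]].
  apply le_size_intro with (Q := fun y z => y ∈ X /\ rel f y z \/ ~ y ∈ X /\ z = n); [solve_def| | |].
  - intros y Hy. destruct (classic (y ∈ X)) as [K|K].
    + destruct (fun_total Hf K) as (z & Hz & Hyz). exists z. rewrite in_succ. auto.
    + exists n. rewrite in_succ. auto.
  - intros y z z' _ [[H H']|[H H']] [[K K']|[K K']]; try tauto; try congruence.
    exact (fun_unique Hf H' K').
  - intros y y' z Hy Hy' [[H H']|[H H']] [[K K']|[K K']].
    + exact (Hi _ _ _ H' K').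
    + subst z. destruct (mem_irrefl (proj2 (fun_dom Hf H'))).
    + subst z. destruct (mem_irrefl (proj2 (fun_dom Hf K'))).
    + apply in_cup in Hy, Hy'. rewrite in_upair in Hy, Hy'.
      destruct Hy as [Hy|Hy], Hy' as [Hy'|Hy']; try tauto.
      assert (y = x) by tauto. assert (y' = x) by tauto. congruence.
Qed.

(** Double induction: n × (m + 1) arises from n × m by adding the pairs (i, m) with i < n one at a
    time. *)
Lemma finite_square w n : is_omega w -> n ∈ w -> exists k, k ∈ w /\ le_size (prod n n) k.
Proof.
  intros Hw Hn. assert (H0 := limit_emp (proj1 Hw)).
  assert (K : forall m, m ∈ w -> exists k, k ∈ w /\ le_size (prod n m) k); [|auto].
  apply (omega_ind (Q := fun m => exists k, k ∈ w /\ le_size (prod n m) k)); [solve_def|exact Hw| |].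
  - exists emp. split; [exact H0|]. apply le_size_subset. intros z Hz. apply in_prod in Hz.
    destruct Hz as (x & y & _ & Hy & _). destruct (in_emp Hy).
  - intros m Hm IH.
    assert (K : forall i, i ∈ w -> exists k, k ∈ w /\
      le_size (cup (prod n m) (prod i (upair m m))) k).
    { apply (omega_ind (Q := fun i => exists k, k ∈ w /\
        le_size (cup (prod n m) (prod i (upair m m))) k)); [solve_def|exact Hw| |].
      - destruct IH as (k & Hk & Hle). exists k. split; [exact Hk|].
        apply le_size_trans with (2 := Hle), le_size_subset.
        intros z Hz. apply in_cup in Hz. destruct Hz as [Hz|Hz]; [exact Hz|].
        apply in_prod in Hz. destruct Hz as (x & _ & Hx & _). destruct (in_emp Hx).
      - intros i Hi (k & Hk & Hle). exists (succ k). split; [apply (limit_succ (proj1 Hw) Hk)|].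
        apply le_size_trans with (2 := le_size_add (opair i m) Hle), le_size_subset.
        intros z Hz. apply in_cup in Hz. apply in_cup. destruct Hz as [Hz|Hz].
        + left. apply in_cup. auto.
        + apply in_prod in Hz. destruct Hz as (x & y & Hx & Hy & ->).
          apply in_upair in Hy. assert (y = m) by tauto. subst y. apply in_succ in Hx.
          destruct Hx as [Hx| ->].
          * left. apply in_cup. right. apply opair_in_prod. split; [exact Hx|apply in_upair; auto].
          * right. apply in_upair. auto. }
    destruct (K n Hn) as (k & Hk & Hle). exists k. split; [exact Hk|].
    apply le_size_trans with (2 := Hle), le_size_subset.
    intros z Hz. apply in_prod in Hz. destruct Hz as (x & y & Hx & Hy & ->).
    apply in_cup. rewrite !opair_in_prod, in_upair. apply in_succ in Hy. tauto.
Qed.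

(** Hilbert's hotel: the new point k goes to 0, each natural number moves up by one, everything else
    stays. *)
Lemma le_size_succ w k : is_omega w -> subset w k -> le_size (succ k) k.
Proof.
  intros Hw Hk. assert (S' : forall n, n ∈ w -> succ n ∈ w) by (intros n; apply limit_succ, Hw).
  apply le_size_intro with (Q := fun x y => x = k /\ y = emp \/
    x <> k /\ (x ∈ w /\ y = succ x \/ ~ x ∈ w /\ y = x)); [solve_def| | |].
  - intros x Hx. apply in_succ in Hx. destruct (classic (x = k)) as [->|E].
    + exists emp. split; [|auto]. apply Hk, limit_emp, Hw.
    + destruct (classic (x ∈ w)) as [K|K].
      * exists (succ x). split; [|auto]. apply Hk, S', K.
      * exists x. split; [|auto 6]. tauto.
  - intros x y y' _ H K. intuition congruence.
  - assert (N : forall n, succ n <> emp).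
    { intros n E. destruct (in_emp (z := n)). rewrite <- E. apply in_succ. auto. }
    intros x x' y _ _ H K.
    destruct H as [[H1 H2]|[H1 [[H2 H3]|[H2 H3]]]], K as [[K1 K2]|[K1 [[K2 K3]|[K2 K3]]]].
    + congruence.
    + subst y. destruct (N x'). auto.
    + subst. destruct K2. apply limit_emp, Hw.
    + subst y. destruct (N x). auto.
    + apply succ_inj. congruence.
    + subst. destruct K2. auto.
    + subst. destruct H2. apply limit_emp, Hw.
    + subst. destruct H2. auto.
    + congruence.
Qed.

Lemma omega_infinite_cardinal w : is_omega w -> is_infinite_cardinal w.
Proof.
  intros Hw. split; [|exists w; split; [exact Hw|apply subset_refl]].
  split; [apply Hw|]. intros n Hn E. apply (omega_not_le Hw Hn), bijection_le_size, equinumerous_sym, E.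
Qed.

Lemma infinite_cardinal_limit k : is_infinite_cardinal k -> is_limit k.
Proof.
  intros [Ck (w & Hw & Hwk)]. assert (Ok := proj1 Ck). split; [exact Ok|split].
  - exists emp. apply Hwk, limit_emp, Hw.
  - intros a Ha. exists (succ a). split; [|apply in_succ; auto].
    assert (Oa := ord_elem Ok Ha). assert (Osa := ord_succ Oa).
    destruct (ord_trich Osa Ok) as [K|[K|K]]; [exact K| |].
    + destruct (classic (a ∈ w)) as [L|L].
      * apply Hwk, limit_succ; [apply Hw|exact L].
      (* For infinite a the successor of a injects into a, so it cannot be the cardinal k. *)
      * destruct (cardinal_no_injection Ck Ha). rewrite <- K at 1. apply (le_size_succ Hw).
        apply ord_not_mem; [exact Oa|apply Hw|exact L].
    + apply in_succ in K. destruct K as [K| ->]; [destruct (mem_asym K Ha)|destruct (mem_irrefl Ha)].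
Qed.

Lemma card_infinite w a : is_omega w -> is_ordinal a -> subset w a ->
  exists m, is_infinite_cardinal m /\ subset m a /\ equinumerous a m.
Proof.
  intros Hw Oa Hwa. destruct (card_of Oa (le_size_subset (subset_refl (a := a)))) as (m & [Cm E] & Hs).
  exists m. split; [|auto]. split; [exact Cm|]. exists w. split; [exact Hw|].
  apply ord_not_mem; [apply Cm|apply Hw|]. intros K. apply (omega_not_le Hw K).
  apply le_size_trans with a; [apply le_size_subset, Hwa|apply bijection_le_size, E].
Qed.

(** * Gödel's well-ordering of pairs and |κ × κ| = κ *)

Lemma max_exists a b : is_ordinal a -> is_ordinal b -> exists m, is_max a b m.
Proof.
  intros Oa Ob. destruct (ord_trich Oa Ob) as [K|[K|K]].
  - exists b. right. split; [auto|apply ord_mem_subset; auto].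
  - subst. exists b. left. split; [auto|apply subset_refl].
  - exists a. left. split; [auto|apply ord_mem_subset; auto].
Qed.

Lemma max_unique a b m m' : is_max a b m -> is_max a b m' -> m = m'.
Proof.
  intros [[-> H]|[-> H]] [[-> K]|[-> K]]; auto; apply subset_antisym; auto.
Qed.

Lemma max_in a b m k : a ∈ k -> b ∈ k -> is_max a b m -> m ∈ k.
Proof. intros Ha Hb [[-> _]|[-> _]]; auto. Qed.

Lemma max_le a b m : is_ordinal a -> is_ordinal b -> is_max a b m -> a ∈ succ m /\ b ∈ succ m.
Proof.
  intros Oa Ob. rewrite !in_succ. intros [[-> H]|[-> H]]; split; auto.
  - destruct (ord_subset Ob Oa H); auto.
  - destruct (ord_subset Oa Ob H); auto.
Qed.

(** Minimize the maximum of the coordinates first, then the first coordinate, then the second. *)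
Lemma godel_wf k : is_ordinal k -> wf_on (prod k k) godel_rel.
Proof.
  intros Ok X HX [p Hp].
  assert (Ho : forall a, a ∈ k -> is_ordinal a) by (intros a; apply ord_elem, Ok).
  assert (HX' : forall a b, opair a b ∈ X -> a ∈ k /\ b ∈ k).
  { intros a b H. apply HX, opair_in_prod in H. exact H. }
  destruct (minimal (Q := fun m => exists a b, opair a b ∈ X /\ is_max a b m) (a := k))
    as (m0 & Hm0 & (a0 & b0 & Hab0 & Hmax0) & Hmin0); [solve_def| |].
  { apply HX in Hp as Hp'. apply in_prod in Hp'. destruct Hp' as (a & b & Ha & Hb & ->).
    destruct (max_exists (Ho a Ha) (Ho b Hb)) as [m' Hm']. exists m'. split; [|eauto].
    exact (max_in Ha Hb Hm'). }
  destruct (minimal (Q := fun a => exists b, opair a b ∈ X /\ is_max a b m0) (a := k))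
    as (a & Ha & (b1 & Hab1 & Hmax1) & Hmin1); [solve_def| |].
  { exists a0. split; [apply (HX' _ _ Hab0)|eauto]. }
  destruct (minimal (Q := fun b => opair a b ∈ X /\ is_max a b m0) (a := k))
    as (b & Hb & (Hab & Hmax) & Hmin2); [solve_def| |].
  { exists b1. split; [apply (HX' _ _ Hab1)|eauto]. }
  exists (opair a b). split; [exact Hab|].
  intros p' Hp' (a1 & b2 & a' & b' & E & E' & Hlt). apply is_opairE in E, E'. subst p'.
  apply opair_inj in E. destruct E; subst a1 b2.
  destruct (HX' _ _ Hp') as [Ha' Hb'].
  destruct Hlt as (n & n' & Hn & Hn' & Hlt). rewrite (max_unique Hn Hmax) in Hlt.
  destruct Hlt as [Hlt|[-> [Hlt|[-> Hlt]]]].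
  - apply (Hmin0 n' Hlt); [exact (max_in Ha' Hb' Hn')|eauto].
  - apply (Hmin1 a' Hlt); eauto.
  - apply (Hmin2 b' Hlt); eauto.
Qed.

Lemma godel_total k p p' : is_ordinal k -> p ∈ prod k k -> p' ∈ prod k k ->
  godel_rel p p' \/ p = p' \/ godel_rel p' p.
Proof.
  intros Ok Hp Hp'. apply in_prod in Hp, Hp'.
  destruct Hp as (a & b & Ha & Hb & ->). destruct Hp' as (a' & b' & Ha' & Hb' & ->).
  assert (Ho : forall a, a ∈ k -> is_ordinal a) by (intros x; apply ord_elem, Ok).
  destruct (max_exists (Ho a Ha) (Ho b Hb)) as [m Hm].
  destruct (max_exists (Ho a' Ha') (Ho b' Hb')) as [m' Hm'].
  assert (Lt : forall a b a' b', godel_lt a b a' b' -> godel_rel (opair a b) (opair a' b')).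
  { intros c d c' d' H. exists c', d', c, d. rewrite !is_opairE. auto. }
  destruct (proj2 Ok m m' (max_in Ha Hb Hm) (max_in Ha' Hb' Hm')) as [K|[K|K]].
  - left. apply Lt. exists m', m. auto.
  - subst m'. destruct (proj2 Ok a a' Ha Ha') as [K|[K|K]].
    + left. apply Lt. exists m, m. auto 10.
    + subst a'. destruct (proj2 Ok b b' Hb Hb') as [K|[K|K]].
      * left. apply Lt. exists m, m. auto 10.
      * subst. auto.
      * right; right. apply Lt. exists m, m. auto 10.
    + right; right. apply Lt. exists m, m. auto 10.
  - right; right. apply Lt. exists m, m'. auto.
Qed.

Lemma rel3E g a b c : rel3 g a b c <-> rel g (opair a b) c.
Proof.
  split.
  - intros (p & Hp & H). apply is_opairE in Hp. now subst.
  - intros H. exists (opair a b). now rewrite is_opairE.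
Qed.

(** The values are determined by recursion along the well-ordering, so a least disagreement is
    impossible. Applied in [W], this identifies the pairing found in the extension with the one of
    [V]. *)
Lemma godel_unique k g g' a b c c' : is_ordinal k -> is_godel k g -> is_godel k g' ->
  a ∈ k -> b ∈ k -> rel3 g a b c -> rel3 g' a b c' -> c = c'.
Proof.
  intros Ok Hg Hg' Ha Hb Hc Hc'. apply NNPP. intros N.
  destruct (wf_min (A := prod k k) (R := godel_rel) (Q := fun p => exists a b c c',
     p = opair a b /\ rel3 g a b c /\ rel3 g' a b c' /\ c <> c'))
    as (p & Hp & HQ & Hmin); [apply godel_wf, Ok|solve_def| |].
  { exists (opair a b). rewrite opair_in_prod. eauto 10. }
  destruct HQ as (x & y & z & z' & -> & Hz & Hz' & Hne). apply Hne.
  apply opair_in_prod in Hp. destruct Hp as [Hx Hy].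
  assert (K : forall x' y' t t', x' ∈ k -> y' ∈ k -> godel_lt x' y' x y ->
     rel3 g x' y' t -> rel3 g' x' y' t' -> t = t').
  { intros x' y' t t' Hx' Hy' Hlt Ht Ht'. apply NNPP. intros K.
    apply (Hmin (opair x' y')); [apply opair_in_prod; auto| |eauto 10].
    exists x, y, x', y'. rewrite !is_opairE. auto. }
  apply ext. intros d. rewrite (proj2 Hg x y z Hx Hy Hz), (proj2 Hg' x y z' Hx Hy Hz').
  split; intros (x' & y' & Hx' & Hy' & Hlt & Hd); exists x', y'; (do 3 (split; [assumption|])).
  - destruct (proj1 Hg' x' y' Hx' Hy') as [t Ht]. now rewrite (K _ _ _ _ Hx' Hy' Hlt Hd Ht).
  - destruct (proj1 Hg x' y' Hx' Hy') as [t Ht]. now rewrite <- (K _ _ _ _ Hx' Hy' Hlt Ht Hd).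
Qed.

(** Let t be the order type of k × k. The diagonal embeds k, so t is not below k. If t were above k,
    then k would be the value at some pair (a, b), and the pairs below (a, b) would number k. But
    these lie in (m + 1) × (m + 1) with m the maximum of a and b, a set of size less than k by the
    induction hypothesis, or by [finite_square] when m is finite. *)
Lemma godel_step k : is_infinite_cardinal k ->
  (forall m, m ∈ k -> is_infinite_cardinal m -> le_size (prod m m) m) ->
  exists g, is_godel k g /\ is_bijection g (prod k k) k.
Proof.
  intros Hk IH. assert (Ck := proj1 Hk). assert (Ok := proj1 Ck).
  destruct (proj2 Hk) as (w & Hw & Hwk).
  destruct (wo_collapse (A := prod k k) (R := godel_rel)) as (f & t & Ot & Hb & Hrec);
    [exact _|apply godel_wf, Ok|intros x y; apply godel_total, Ok|].
  assert (E : t = k).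
  { destruct (ord_trich Ot Ok) as [K|[K|K]]; [|exact K|].
    - destruct (cardinal_no_injection Ck K). apply le_size_trans with (prod k k);
        [|exists f; apply Hb].
      apply le_size_intro with (Q := fun x p => p = opair x x); [solve_def| | |].
      + intros x Hx. exists (opair x x). rewrite opair_in_prod. auto.
      + congruence.
      + intros x x' y _ _ -> E. apply opair_inj in E. tauto.
    - exfalso. destruct Hb as [[Hf Hi] Hs].
      destruct (Hs k K) as [p Hp]. assert (Dp := proj1 (fun_dom Hf Hp)). apply in_prod in Dp.
      destruct Dp as (a & b & Ha & Hb & ->).
      assert (Oa := ord_elem Ok Ha). assert (Ob := ord_elem Ok Hb).
      destruct (max_exists Oa Ob) as [m Hm]. assert (Hmk := max_in Ha Hb Hm).
      assert (Om := ord_elem Ok Hmk).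
      assert (Hsm : succ m ∈ k) by (apply limit_succ; [apply infinite_cardinal_limit, Hk|exact Hmk]).
      assert (Osm := ord_elem Ok Hsm).
      assert (Hle : le_size k (prod (succ m) (succ m))).
      { apply le_size_intro with (Q := fun x p => rel f p x); [solve_def| | |].
        - intros x Hx. apply (Hrec _ _ Hp) in Hx. destruct Hx as (p' & Hp' & Hlt & Hx).
          exists p'. split; [|exact Hx].
          apply in_prod in Hp'. destruct Hp' as (a' & b' & Ha' & Hb' & ->).
          destruct Hlt as (a1 & b1 & a2 & b2 & E1 & E2 & Hlt). apply is_opairE in E1, E2.
          apply opair_inj in E1, E2. destruct E1, E2; subst a1 b1 a2 b2.
          destruct Hlt as (n & n' & Hn & Hn' & Hlt). rewrite (max_unique Hn Hm) in Hlt.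
          assert (Hs' : subset (succ n') (succ m)).
          { intros z Hz. apply in_succ in Hz. apply in_succ.
            assert (H' : n' ∈ m \/ n' = m) by tauto. destruct H' as [H'| ->]; [|exact Hz].
            left. destruct Hz as [Hz| ->]; [exact (ord_trans Om Hz H')|exact H']. }
          destruct (max_le (ord_elem Ok Ha') (ord_elem Ok Hb') Hn'). apply opair_in_prod. auto.
        - intros x p p' _ H H'. exact (Hi _ _ _ H H').
        - intros x x' p _ _ H H'. exact (fun_unique Hf H H'). }
      destruct (classic (succ m ∈ w)) as [L|L].
      + destruct (finite_square Hw L) as (n & Hn & Hn').
        apply (cardinal_no_injection Ck (Hwk _ Hn)), (le_size_trans Hle Hn').
      + destruct (card_infinite Hw Osm) as (n & Hn & Hns & En);
          [apply ord_not_mem; [exact Osm|apply Hw|exact L]|].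
        assert (Hnk : n ∈ k).
        { destruct (ord_subset (proj1 (proj1 Hn)) Osm Hns) as [-> | K']; [exact Hsm|].
          exact (ord_trans Ok K' Hsm). }
        apply (cardinal_no_injection Ck Hnk), (le_size_trans Hle).
        apply le_size_trans with (2 := IH n Hnk Hn).
        apply le_size_prod; apply bijection_le_size, En. }
  subst t. exists f. split; [|exact Hb]. destruct Hb as [[Hf Hi] Hs]. split.
  - intros a b Ha Hb. destruct (fun_total Hf (x := opair a b)) as (c & _ & Hc);
      [apply opair_in_prod; auto|]. exists c. apply rel3E, Hc.
  - intros a b c Ha Hb Hc d. apply rel3E in Hc. rewrite (Hrec _ _ Hc). split.
    + intros (p' & Hp' & Hlt & Hd). apply in_prod in Hp'. destruct Hp' as (a' & b' & Ha' & Hb' & ->).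
      exists a', b'. rewrite rel3E. do 2 (split; [assumption|]). split; [|exact Hd].
      destruct Hlt as (a1 & b1 & a2 & b2 & E1 & E2 & Hlt). apply is_opairE in E1, E2.
      apply opair_inj in E1, E2. destruct E1, E2; now subst a1 b1 a2 b2.
    + intros (a' & b' & Ha' & Hb' & Hlt & Hd). exists (opair a' b').
      rewrite opair_in_prod, <- rel3E. split; [auto|split; [|exact Hd]].
      exists a, b, a', b'. now rewrite !is_opairE.
Qed.

Theorem godel_exists k : is_infinite_cardinal k ->
  exists g, is_godel k g /\ is_bijection g (prod k k) k.
Proof.
  intros Hk. apply NNPP. intros N.
  destruct (ord_min (Q := fun k => is_infinite_cardinal k /\
     ~ exists g, is_godel k g /\ is_bijection g (prod k k) k) (a := k))
    as (m & Om & _ & [Hm Nm] & Hmin); [solve_def|apply Hk|auto|].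
  apply Nm, godel_step; [exact Hm|]. intros n Hn Hn'. apply NNPP. intros K.
  apply (Hmin n Hn). split; [exact Hn'|]. intros (g & _ & Hg). apply K. exists g. apply Hg.
Qed.

Lemma square_le k : is_infinite_cardinal k -> le_size (prod k k) k.
Proof. intros Hk. destruct (godel_exists Hk) as (g & _ & Hg). exists g. apply Hg. Qed.

End Omega.

(** * Unions of at most κ sets of size at most κ *)

Section Cardinals.
Context {U : structure} {hU : ZFC U}.
Implicit Types (a b c d e f k l m n w x y z u p q A F X : U) (Q : U -> Prop).

(** After choosing an injection into k for every X in F, a point is found from a pair: the index of
    some X containing it and its own index in X. This maps part of k × k onto the union. *)
Lemma union_le k F : is_infinite_cardinal k -> le_size F k ->
  (forall X, X ∈ F -> le_size X k) -> le_size (bigcup F) k.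
Proof.
  intros Hk [i [Hi Hii]] HF.
  destruct (@choice_fun _ _ F (pow (prod (bigcup F) k)) (fun X f => is_injection f X k))
    as (h & Hh & Hhi); [solve_def| |].
  { intros X HX. destruct (HF X HX) as [f Hf]. exists f. split; [|exact Hf].
    apply in_pow. intros z Hz. destruct (proj1 (proj1 Hf) z Hz) as (x & y & Hx & Hy & E).
    apply is_opairE in E. subst z. apply opair_in_prod. split; [apply in_bigcup; eauto|exact Hy]. }
  apply (@le_size_surj _ _ (bigcup F) (prod k k) k (fun p z => exists X f i1 j1,
     p = opair i1 j1 /\ rel i X i1 /\ rel h X f /\ rel f z j1));
    [solve_def|apply Hk|apply square_le, Hk| |].
  - intros z Hz. apply in_bigcup in Hz. destruct Hz as (X & HX & Hz).
    destruct (fun_total Hi HX) as (i1 & Hi1 & Hr). destruct (fun_total Hh HX) as (f & _ & Hf).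
    destruct (fun_total (proj1 (Hhi _ _ Hf)) Hz) as (j1 & Hj1 & Hr').
    exists (opair i1 j1). rewrite opair_in_prod. split; [auto|]. exists X, f, i1, j1. auto.
  - intros p z z' _ (X & f & i1 & j1 & -> & H1 & H2 & H3) (X' & f' & i2 & j2 & E & K1 & K2 & K3).
    apply opair_inj in E. destruct E; subst i2 j2.
    assert (X' = X) by exact (Hii _ _ _ K1 H1). subst X'.
    assert (f' = f) by exact (fun_unique Hh K2 H2). subst f'.
    exact (proj2 (Hhi _ _ H2) _ _ _ H3 K3).
Qed.

(** * Sets of hereditary size at most [k] *)

Lemma trcl_exists x t : subset x t -> transitive t -> exists s, is_trcl x s /\ subset s t.
Proof.
  intros Hx Ht.
  destruct (separation t (Q := fun y => forall s, subset x s -> transitive s -> y ∈ s)) as [s Hs];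
    [solve_def|].
  exists s. split; [|intros z Hz; apply Hs in Hz; tauto]. split; [|split].
  - intros z Hz. apply Hs. split; [auto|]. intros r Hr _. auto.
  - intros y Hy z Hz. apply Hs in Hy. destruct Hy as [Hy K]. apply Hs. split; [exact (Ht y Hy z Hz)|].
    intros r Hr Hr'. exact (Hr' y (K r Hr Hr') z Hz).
  - intros r Hr Hr' z Hz. apply Hs in Hz. apply Hz; auto.
Qed.

Lemma trcl_unique x t t' : is_trcl x t -> is_trcl x t' -> t = t'.
Proof.
  intros (H1 & H2 & H3) (K1 & K2 & K3). apply subset_antisym; auto.
Qed.

Section Hereditary.
Context (k M : U) (Hk : is_infinite_cardinal k) (HM : is_H_succ k M).

Lemma H_intro x t : subset x t -> transitive t -> le_size t k -> x ∈ M.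
Proof.
  intros Hx Ht Hle. apply HM. destruct (trcl_exists Hx Ht) as (s & Hs & Hst).
  exists s. split; [exact Hs|]. exact (le_size_trans (le_size_subset Hst) Hle).
Qed.

Lemma H_elim x : x ∈ M -> exists t, is_trcl x t /\ le_size t k.
Proof. apply HM. Qed.

Lemma H_transitive x y : y ∈ x -> x ∈ M -> y ∈ M.
Proof.
  intros Hy Hx. destruct (H_elim Hx) as (t & (Hxt & Ht & _) & Hle).
  apply (@H_intro y t); [|exact Ht|exact Hle]. apply Ht, Hxt, Hy.
Qed.

Lemma H_subset x y : subset y x -> x ∈ M -> y ∈ M.
Proof.
  intros Hy Hx. destruct (H_elim Hx) as (t & (Hxt & Ht & _) & Hle).
  apply (@H_intro y t); [|exact Ht|exact Hle]. intros z Hz. auto.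
Qed.

Lemma H_size x : x ∈ M -> le_size x k.
Proof.
  intros Hx. destruct (H_elim Hx) as (t & (Hxt & _) & Hle).
  exact (le_size_trans (le_size_subset Hxt) Hle).
Qed.

Lemma le_size_add_one X x : le_size X k -> le_size (cup X (upair x x)) k.
Proof.
  intros H. destruct (proj2 Hk) as (w & Hw & Hwk).
  exact (le_size_trans (le_size_add x H) (le_size_succ Hw Hwk)).
Qed.

(** The set x is itself made a member of t, because codes describe x as a point of a transitive
    set. *)
Lemma H_transitive_superset x : x ∈ M ->
  exists t, x ∈ t /\ transitive t /\ le_size t k /\ t ∈ M.
Proof.
  intros Hx. destruct (H_elim Hx) as (t & (Hxt & Ht & _) & Hle).
  exists (cup t (upair x x)).
  assert (T : transitive (cup t (upair x x))).
  { intros y Hy z Hz. apply in_cup in Hy. apply in_cup. left. destruct Hy as [Hy|Hy].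
    - exact (Ht y Hy z Hz).
    - apply in_upair in Hy. assert (y = x) by tauto. subst y. auto. }
  split; [|split; [exact T|split; [apply le_size_add_one, Hle|]]].
  - apply in_cup. right. apply in_upair. auto.
  - apply (H_intro (subset_refl (a := _)) T). apply le_size_add_one, Hle.
Qed.

(** The union of the transitive closures of the singletons {x} with x in X is transitive, contains
    X, and is a union of at most k sets of size at most k. *)
Lemma H_closed X : subset X M -> le_size X k -> X ∈ M.
Proof.
  intros HX Hle.
  destruct (@replacement _ _ X (fun x s => exists t, is_trcl x t /\ s = cup t (upair x x))) as [B HB];
    [solve_def| |].
  { intros x s s' _ (t & Ht & ->) (t' & Ht' & ->). now rewrite (trcl_unique Ht Ht'). }
  apply (@H_intro X (bigcup B)).
  - intros x Hx. destruct (H_elim (HX x Hx)) as (t & Ht & _). apply in_bigcup.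
    exists (cup t (upair x x)). split; [apply HB; eauto|]. apply in_cup. right. apply in_upair. auto.
  - intros y Hy z Hz. apply in_bigcup in Hy. destruct Hy as (s & Hs & Hy).
    apply in_bigcup. exists s. split; [exact Hs|].
    apply HB in Hs. destruct Hs as (x & _ & t & (Hxt & Ht & _) & ->).
    apply in_cup in Hy. apply in_cup. left. destruct Hy as [Hy|Hy].
    + exact (Ht y Hy z Hz).
    + apply in_upair in Hy. assert (y = x) by tauto. subst y. auto.
  - apply union_le; [exact Hk| |].
    + apply (@le_size_surj _ _ B X k (fun x s => exists t, is_trcl x t /\ s = cup t (upair x x)));
        [solve_def|apply Hk|exact Hle| |].
      * intros s Hs. apply HB in Hs. destruct Hs as (x & Hx & H). eauto.
      * intros x s s' _ (t & Ht & ->) (t' & Ht' & ->). now rewrite (trcl_unique Ht Ht').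
    + intros s Hs. apply HB in Hs. destruct Hs as (x & Hx & t & Ht & ->).
      destruct (H_elim (HX x Hx)) as (t' & Ht' & Hle').
      rewrite (trcl_unique Ht Ht'). apply le_size_add_one, Hle'.
Qed.

Lemma zero_in : emp ∈ k.
Proof. apply limit_emp, infinite_cardinal_limit, Hk. Qed.

Lemma succ_in a : a ∈ k -> succ a ∈ k.
Proof. apply limit_succ, infinite_cardinal_limit, Hk. Qed.

Lemma H_upair a b : a ∈ M -> b ∈ M -> upair a b ∈ M.
Proof.
  intros Ha Hb. apply H_closed.
  - intros z Hz. apply in_upair in Hz. destruct Hz; now subst.
  - apply le_size_intro with (Q := fun x y => x = a /\ y = emp \/ x <> a /\ y = succ emp);
      [solve_def| | |].
    + intros x Hx. destruct (classic (x = a)) as [E|E].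
      * exists emp. split; [apply zero_in|auto].
      * exists (succ emp). split; [apply succ_in, zero_in|auto].
    + intros x y y' _. intuition congruence.
    + assert (N : succ (U := U) emp <> emp).
      { intros E. destruct (in_emp (z := emp)). rewrite <- E at 2. apply in_succ. auto. }
      intros x x' y Hx Hx'. apply in_upair in Hx, Hx'. intuition congruence.
Qed.

Lemma H_opair a b : a ∈ M -> b ∈ M -> opair a b ∈ M.
Proof. intros Ha Hb. unfold opair. apply H_upair; apply H_upair; assumption. Qed.

Lemma H_cardinal : k ∈ M.
Proof.
  apply (@H_intro k k); [apply subset_refl|apply Hk|apply le_size_subset, subset_refl].
Qed.

Lemma H_prod a b : a ∈ M -> b ∈ M -> prod a b ∈ M.
Proof.
  intros Ha Hb. apply H_closed.
  - intros z Hz. apply in_prod in Hz. destruct Hz as (x & y & Hx & Hy & ->).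
    apply H_opair; eapply H_transitive; eassumption.
  - apply le_size_trans with (2 := square_le Hk). apply le_size_prod; apply H_size; assumption.
Qed.

Lemma H_relation r a b : is_relation r a b -> a ∈ M -> b ∈ M -> r ∈ M.
Proof.
  intros Hr Ha Hb. apply H_subset with (prod a b); [|apply H_prod; assumption].
  intros z Hz. destruct (Hr z Hz) as (x & y & Hx & Hy & E). apply is_opairE in E. subst.
  apply opair_in_prod. auto.
Qed.

End Hereditary.

(** * Cardinal exponentiation *)

Definition funs a b : U := sep (pow (prod a b)) (fun f => is_fun f a b).

Lemma in_funs a b f : f ∈ funs a b <-> is_fun f a b.
Proof.
  unfold funs. rewrite in_sep by solve_def. split; [tauto|]. intros H. split; [|exact H].
  apply in_pow. intros z Hz. destruct (proj1 H z Hz) as (x & y & Hx & Hy & E).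
  apply is_opairE in E. subst. apply opair_in_prod. auto.
Qed.

Global Instance fun_funs : Fun2 anyp funs.
Proof.
  apply pdef_ext with (fun v => forall f, f ∈ v 0 <-> is_fun f (v 1) (v 2)); [|solve_def].
  intros v. split.
  - intros E f. rewrite E. apply in_funs.
  - intros H. apply ext. intros f. rewrite in_funs. apply H.
Qed.

Lemma fun_codomain f a b b' : is_fun f a b -> (forall x y, rel f x y -> y ∈ b') -> is_fun f a b'.
Proof.
  intros [Hr Hf] H. split; [|exact Hf]. intros z Hz. destruct (Hr z Hz) as (x & y & Hx & _ & E).
  exists x, y. split; [exact Hx|split; [|exact E]]. apply (H x). exists z. auto.
Qed.

Lemma funs_mono a b b' : subset b b' -> subset (funs a b) (funs a b').
Proof.
  intros H f Hf. apply in_funs in Hf. apply in_funs, (fun_codomain Hf).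
  intros x y Hxy. apply H, (fun_dom Hf Hxy).
Qed.

(** Diagonal argument: if k ⊆ g, let F(x) be 1 when x codes a function with value 0 at x, and 0
    otherwise. The code a of F lies in k, hence in the domain of F, and F(a) = 0 iff F(a) = 1. *)
Lemma cantor k g : is_infinite_cardinal k -> is_ordinal g -> le_size (funs g k) k -> g ∈ k.
Proof.
  intros Hk Og [i [Hi Hii]]. apply NNPP. intros N.
  assert (Hs : subset k g) by (apply ord_not_mem; [exact Og|apply Hk|exact N]).
  assert (N1 : succ (U := U) emp <> emp).
  { intros E. destruct (in_emp (z := emp)). rewrite <- E at 2. apply in_succ. auto. }
  destruct (@make_fun _ _ g k (fun x y => (exists f, rel i f x /\ rel f x emp) /\ y = succ emp \/
     ~ (exists f, rel i f x /\ rel f x emp) /\ y = emp)) as (F & HF & HFr); [solve_def| | |].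
  - intros x _. destruct (classic (exists f, rel i f x /\ rel f x emp)).
    + exists (succ emp). split; [apply succ_in, zero_in; exact Hk|auto].
    + exists emp. split; [apply zero_in; exact Hk|auto].
  - intros x y y' _. intuition congruence.
  - destruct (fun_total Hi (x := F)) as (a & Ha & HFa); [apply in_funs, HF|].
    destruct (fun_total HF (Hs a Ha)) as (y & _ & Hy). assert (Hy' := Hy). apply HFr in Hy'.
    destruct Hy' as (_ & _ & [[(f & Hf & Hfa) ->]|[K ->]]).
    + rewrite (Hii _ _ _ Hf HFa) in Hfa. apply N1. exact (fun_unique HF Hy Hfa).
    + apply K. exists F. auto.
Qed.

Lemma succ_cardinal_exists k g : is_cardinal k -> g ∈ k ->
  exists d, is_succ_cardinal g d /\ subset d k.
Proof.
  intros Ck Hg. destruct (ord_min (Q := fun d => is_cardinal d /\ g ∈ d) (a := k))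
    as (d & Od & Hdk & [Cd Hgd] & Hmin); [solve_def|apply Ck|auto|].
  exists d. split; [|exact Hdk]. split; [exact Cd|split; [exact Hgd|]].
  intros m Cm Hgm. apply ord_not_mem; [apply Cm|exact Od|]. intros K. exact (Hmin m K (conj Cm Hgm)).
Qed.

Definition small_subsets d k : U := sep (pow k) (fun x => exists m, has_card x m /\ m ∈ d).

Lemma small_subsets_spec d k : is_small_subsets (small_subsets d k) d k.
Proof. intros x. unfold small_subsets. rewrite in_sep by solve_def. rewrite in_pow. tauto. Qed.

(** A cardinal below γ⁺ is at most γ. From here on γ⁺ no longer enters the argument. *)
Lemma small_subsets_iff q g d k : is_cardinal g -> is_succ_cardinal g d -> is_small_subsets q d k ->
  forall x, x ∈ q <-> subset x k /\ le_size x g.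
Proof.
  intros Cg (Cd & Hgd & Hmin) Hq x. rewrite (Hq x). split.
  - intros [Hx (m & [Cm E] & Hm)]. split; [exact Hx|].
    apply le_size_trans with m; [apply bijection_le_size, E|]. apply le_size_subset.
    apply ord_not_mem; [apply Cg|apply Cm|]. intros K.
    exact (mem_irrefl (Hmin m Cm K m Hm)).
  - intros [Hx Hle]. split; [exact Hx|]. destruct (card_of (proj1 Cg) Hle) as (m & Hm & Hs).
    exists m. split; [exact Hm|].
    destruct (ord_subset (proj1 (proj1 Hm)) (proj1 Cg) Hs) as [->|K]; [exact Hgd|].
    exact (ord_trans (proj1 Cd) K Hgd).
Qed.

Lemma subsets_in_H k M g q : is_infinite_cardinal k -> is_H_succ k M ->
  le_size (funs g k) k -> (forall x, x ∈ q -> subset x k /\ le_size x g) -> q ∈ M.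
Proof.
  intros Hk HM Hle Hq. apply (H_closed Hk HM).
  - intros x Hx. apply (H_subset HM) with k; [apply Hq, Hx|apply (H_cardinal Hk HM)].
  - apply (@le_size_surj _ _ q (funs g k) k (fun F x => forall y, y ∈ x <-> exists i, rel F i (succ y)));
      [solve_def|apply Hk|exact Hle| |].
    + intros x Hx. destruct (Hq x Hx) as [Hxk [f [Hf Hi]]].
      destruct (@make_fun _ _ g k (fun i z => (exists y, rel f y i /\ z = succ y) \/
        ~ (exists y, rel f y i) /\ z = emp)) as (F & HF & HFr); [solve_def| | |].
      * intros i _. destruct (classic (exists y, rel f y i)) as [[y Hy]|K].
        -- exists (succ y). split; [|eauto]. apply succ_in; [exact Hk|]. apply Hxk, (fun_dom Hf Hy).
        -- exists emp. split; [apply zero_in; exact Hk|auto].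
      * intros i z z' _ [(y & Hy & ->)|[K ->]] [(y' & Hy' & ->)|[K' ->]]; try tauto; try (exfalso; eauto; fail).
        now rewrite (Hi _ _ _ Hy Hy').
      * exists F. split; [apply in_funs, HF|]. intros y. split.
        -- intros Hy. destruct (fun_total Hf Hy) as (i & Hi' & Hyi). exists i. apply HFr.
           split; [exact Hi'|split; [|eauto]]. apply succ_in; [exact Hk|]. apply Hxk, Hy.
        -- intros [i Hyi]. apply HFr in Hyi. destruct Hyi as (_ & _ & [(y' & Hy' & E)|[_ E]]).
           ++ apply succ_inj in E. subst. apply (fun_dom Hf Hy').
           ++ destruct (in_emp (z := y)). rewrite <- E. apply in_succ. auto.
    + intros F x x' _ H H'. apply ext. intros y. rewrite (H y), (H' y). tauto.
Qed.

(** By induction, a function on n + 1 is determined by its restriction to n together with its value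
    at n. *)
Lemma finite_power_le k w n : is_infinite_cardinal k -> is_omega w -> n ∈ w ->
  le_size (funs n k) k.
Proof.
  intros Hk Hw. apply (omega_ind (Q := fun n => le_size (funs n k) k) (w := w));
    [solve_def|exact Hw| |].
  - apply le_size_intro with (Q := fun x y => y = emp); [solve_def| | |].
    + intros x _. exists emp. split; [apply zero_in, Hk|reflexivity].
    + congruence.
    + intros f f' _ Hf Hf' _ _. apply in_funs in Hf, Hf'.
      apply (relation_ext (proj1 Hf) (proj1 Hf')). intros x y.
      split; intros H; [apply (fun_dom Hf) in H|apply (fun_dom Hf') in H];
        destruct H as [H _]; destruct (in_emp H).
  - clear n. intros n Hn IH.
    apply le_size_trans with (prod (funs n k) k).
    2:{ apply le_size_trans with (2 := square_le Hk). apply le_size_prod; [exact IH|].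
        apply le_size_subset, subset_refl. }
    assert (Hlt : forall x, x ∈ n -> x ∈ succ n) by (intros x Hx; apply in_succ; auto).
    apply le_size_intro with (Q := fun f p => exists g y, p = opair g y /\ rel f n y /\
      is_fun g n k /\ forall x y, x ∈ n -> (rel g x y <-> rel f x y)); [solve_def| | |].
    + intros f Hf. apply in_funs in Hf.
      destruct (fun_total Hf (x := n)) as (y & Hy & Hny); [apply in_succ; auto|].
      destruct (@make_fun _ _ n k (fun x y => rel f x y)) as (g & Hg & Hgr); [solve_def| | |].
      * intros x Hx. apply (fun_total Hf); auto.
      * intros x z z' _. apply (fun_unique Hf).
      * exists (opair g y). rewrite opair_in_prod, in_funs. split; [auto|].
        exists g, y. split; [auto|split; [auto|split; [auto|]]].
        intros x z Hx. rewrite Hgr. split; [tauto|]. intros H. split; [auto|split; [|auto]].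
        apply (fun_dom Hf H).
    + intros f p p' Hf (g & y & -> & Hy & Hg & Hgr) (g' & y' & -> & Hy' & Hg' & Hgr').
      apply in_funs in Hf. f_equal; [|exact (fun_unique Hf Hy Hy')].
      apply (relation_ext (proj1 Hg) (proj1 Hg')). intros x z. split; intros H.
      * apply Hgr'; [apply (fun_dom Hg H)|]. apply Hgr; [apply (fun_dom Hg H)|exact H].
      * apply Hgr; [apply (fun_dom Hg' H)|]. apply Hgr'; [apply (fun_dom Hg' H)|exact H].
    + intros f f' p Hf Hf' (g & y & -> & Hy & Hg & Hgr) (g' & y' & E & Hy' & Hg' & Hgr').
      apply opair_inj in E. destruct E; subst g' y'. apply in_funs in Hf, Hf'.
      apply (relation_ext (proj1 Hf) (proj1 Hf')). intros x z. split; intros H.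
      * assert (D := proj1 (fun_dom Hf H)). apply in_succ in D. destruct D as [D| ->].
        -- apply Hgr', Hgr; auto.
        -- now rewrite (fun_unique Hf H Hy).
      * assert (D := proj1 (fun_dom Hf' H)). apply in_succ in D. destruct D as [D| ->].
        -- apply Hgr, Hgr'; auto.
        -- now rewrite (fun_unique Hf' H Hy').
Qed.

Lemma cof_subset k c : is_ordinal k -> is_cof k c -> subset c k.
Proof.
  intros Ok (Oc & _ & Hmin). apply ord_not_mem; [exact Ok|exact Oc|]. intros K.
  apply (Hmin k K). destruct (@make_fun _ _ k k (fun x y => x = y)) as (f & Hf & Hr);
    [solve_def|eauto|congruence|].
  exists f. split; [exact Hf|]. intros x Hx. exists x, x. split; [exact Hx|].
  split; [apply Hr; auto|auto].
Qed.

(** For infinite g below the cofinality, every function from g to k is bounded, hence maps into some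
    a < k. With m the cardinality of the maximum of g and a, the functions from g to a are subsets
    of g × a, so there are at most 2^m = m⁺ ≤ k of them. It remains to take a union over the k many
    a. *)
Lemma GCH_power_le k c g : GCH U -> is_infinite_cardinal k -> is_cof k c -> g ∈ c ->
  le_size (funs g k) k.
Proof.
  intros HG Hk Hc Hg. assert (Ck := proj1 Hk). assert (Ok := proj1 Ck).
  assert (Hgk : g ∈ k) by (apply (cof_subset Ok Hc), Hg). assert (Og := ord_elem Ok Hgk).
  destruct (proj2 Hk) as (w & Hw & Hwk).
  destruct (classic (g ∈ w)) as [L|L]; [exact (finite_power_le Hk Hw L)|].
  assert (Hwg : subset w g) by (apply ord_not_mem; [exact Og|apply Hw|exact L]).
  destruct (@replacement _ _ k (fun a X => X = funs g a)) as [B HB]; [solve_def|congruence|].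
  apply le_size_trans with (bigcup B).
  - apply le_size_subset. intros f Hf. apply in_funs in Hf.
    assert (K : exists a, a ∈ k /\ forall b y, b ∈ g -> rel f b y -> y ∈ a).
    { apply NNPP. intros N. apply (proj2 (proj2 Hc) g Hg). exists f. split; [exact Hf|].
      intros a Ha. apply NNPP. intros N'. apply N. exists a. split; [exact Ha|].
      intros b y Hb Hy. assert (Dy := proj2 (fun_dom Hf Hy)).
      destruct (proj2 Ok y a Dy Ha) as [K|[K|K]]; [exact K| |]; destruct N'; exists b, y; auto. }
    destruct K as (a & Ha & K). apply in_bigcup. exists (funs g a). split; [apply HB; eauto|].
    apply in_funs, (fun_codomain Hf). intros x y Hxy. apply (K x y); [apply (fun_dom Hf Hxy)|exact Hxy].
  - apply union_le; [exact Hk| |].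
    + apply (@le_size_surj _ _ B k k (fun a X => X = funs g a)); [solve_def|exact Ok| | |].
      * apply le_size_subset, subset_refl.
      * intros X HX. apply HB in HX. exact HX.
      * congruence.
    + intros X HX. apply HB in HX. destruct HX as (a & Ha & ->).
      assert (Oa := ord_elem Ok Ha).
      destruct (max_exists Og Oa) as [b Hb]. assert (Hbk := max_in Hgk Ha Hb).
      assert (Ob := ord_elem Ok Hbk).
      assert (Hgb : subset g b /\ subset a b).
      { destruct Hb as [[-> H]|[-> H]]; split; auto; apply subset_refl. }
      destruct (card_infinite Hw Ob) as (m & Hm & Hmb & E).
      { intros z Hz. apply (proj1 Hgb), Hwg, Hz. }
      assert (Hmk : m ∈ k).
      { destruct (ord_subset (proj1 (proj1 Hm)) Ob Hmb) as [->|K]; [exact Hbk|].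
        exact (ord_trans Ok K Hbk). }
      destruct (succ_cardinal_exists Ck Hmk) as (l & Hl & Hlk).
      assert (Hp := HG m l (pow m) Hm Hl (@in_pow _ _ m)).
      apply le_size_trans with (pow (prod g a)).
      { apply le_size_subset. intros f Hf. unfold funs in Hf. apply in_sep in Hf; [tauto|solve_def]. }
      apply le_size_trans with (pow m).
      * apply le_size_pow. apply le_size_trans with (2 := square_le Hm).
        apply le_size_prod.
        -- apply le_size_trans with (2 := bijection_le_size E). apply le_size_subset, Hgb.
        -- apply le_size_trans with (2 := bijection_le_size E). apply le_size_subset, Hgb.
      * apply le_size_trans with l; [apply bijection_le_size, Hp|apply le_size_subset, Hlk].
Qed.

(** * Cohen forcing *)

(** The conditions of length n are among the functions from n to ω, so [finite_power_le] and
    [union_le] apply with ω as the cardinal. *)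
Lemma Cohen_countable (P le : U) w : is_Cohen P le -> is_omega w -> le_size P w.
Proof.
  intros [(w' & b & Hw' & Hb & HP) _] Hw.
  assert (w' = w).
  { destruct (ord_trich (proj1 (proj1 Hw')) (proj1 (proj1 Hw))) as [K|[K|K]]; [|exact K|].
    - destruct (proj2 Hw _ K). apply Hw'.
    - destruct (proj2 Hw' _ K). apply Hw. }
  subst w'. assert (Hi := omega_infinite_cardinal Hw).
  destruct (@replacement _ _ w (fun n X => X = funs n b)) as [B HB]; [solve_def|congruence|].
  apply le_size_trans with (bigcup B).
  - apply le_size_subset. intros f Hf. apply HP in Hf. destruct Hf as (n & Hn & Hf).
    apply in_bigcup. exists (funs n b). split; [apply HB; eauto|apply in_funs, Hf].
  - apply union_le; [exact Hi| |].
    + apply (@le_size_surj _ _ B w w (fun a X => X = funs a b)); [solve_def|apply Hi| | |].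
      * apply le_size_subset, subset_refl.
      * intros X HX. apply HB in HX. exact HX.
      * congruence.
    + intros X HX. apply HB in HX. destruct HX as (n & Hn & ->).
      apply le_size_trans with (2 := finite_power_le Hi Hw Hn). apply le_size_subset, funs_mono.
      destruct Hb as (o & i & Ho & Hs & Hu). apply is_emptyE in Ho. apply is_succE in Hs. subst o i.
      intros z Hz. apply Hu in Hz. destruct Hz as [-> | ->].
      * apply zero_in, Hi.
      * apply succ_in, zero_in; exact Hi.
Qed.

Lemma Cohen_forcing (P le : U) : is_Cohen P le -> is_forcing P le.
Proof.
  intros [(w & b & Hw & Hb & HP) Hle].
  assert (HR : forall p q, rel le p q <-> p ∈ P /\ q ∈ P /\ subset q p).
  { intros p q. rewrite relE, Hle. split.
    - intros (f & g & Hf & Hg & Hs & E). apply is_opairE, opair_inj in E. destruct E; now subst.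
    - intros (Hp & Hq & Hs). exists p, q. rewrite is_opairE. auto. }
  split; [|split; [|split]].
  - exists emp. apply HP. exists emp. split; [apply limit_emp, Hw|]. split.
    + intros z Hz. destruct (in_emp Hz).
    + intros x Hx. destruct (in_emp Hx).
  - intros z Hz. apply Hle in Hz. destruct Hz as (f & g & Hf & Hg & _ & E). eauto 6.
  - intros p Hp. apply HR. split; [|split]; auto. apply subset_refl.
  - intros p q r H K. apply HR in H, K. apply HR. split; [tauto|split; [tauto|]].
    intros z Hz. apply H, K, Hz.
Qed.

Lemma Cohen_in_H k M (P le : U) : is_infinite_cardinal k -> is_H_succ k M -> is_Cohen P le ->
  opair P le ∈ M.
Proof.
  intros Hk HM HC. assert (Hf := Cohen_forcing HC).
  destruct (proj2 Hk) as (w & Hw & Hwk).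
  assert (HPw := Cohen_countable HC Hw). destruct HC as [(w' & b & Hw' & Hb & HP) _].
  assert (HPM : P ∈ M).
  { apply (H_closed Hk HM); [|exact (le_size_trans HPw (le_size_subset Hwk))].
    assert (Ew : subset w' k).
    { apply ord_not_mem; [apply Hk|apply Hw'|]. intros K.
      apply (proj2 Hw' _ K), infinite_cardinal_limit, Hk. }
    intros f Hf'. apply HP in Hf'. destruct Hf' as (n & Hn & Hf').
    assert (Hkk := H_cardinal Hk HM).
    apply (H_relation Hk HM (r := f) (a := k) (b := k)); [|exact Hkk|exact Hkk].
    intros z Hz. destruct (proj1 Hf' z Hz) as (x & y & Hx & Hy & E). exists x, y.
    split; [|split; [|exact E]].
    - apply (ord_trans (proj1 (proj1 Hk)) Hx (Ew _ Hn)).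
    - destruct Hb as (o & i & Ho & Hs & Hu). apply is_emptyE in Ho. apply is_succE in Hs. subst o i.
      apply Hu in Hy. destruct Hy as [-> | ->]; [apply zero_in, Hk|apply succ_in, zero_in; exact Hk]. }
  apply (H_opair Hk HM); [exact HPM|].
  apply (H_relation Hk HM (proj1 (proj2 Hf)) HPM HPM).
Qed.

End Cardinals.

(** * Absoluteness *)

Section Absoluteness.
Context {U1 U2 : structure} {i : U1 -> U2} (hi : transitive_embedding i).
Implicit Types (a b c d f g k m p q r x y z : U1).

Lemma emb_mem x y : i x ∈ i y <-> x ∈ y.
Proof. apply (te_mem hi). Qed.

Lemma emb_inj x y : i x = i y <-> x = y.
Proof. split; [apply (te_inj hi)|congruence]. Qed.

Lemma emb_pull u y : u ∈ i y -> exists x, u = i x /\ x ∈ y.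
Proof.
  intros H. destruct (te_trans hi H) as [x ->]. exists x. split; [reflexivity|].
  apply emb_mem, H.
Qed.

Lemma emb_subset x y : subset (i x) (i y) <-> subset x y.
Proof.
  split.
  - intros H z Hz. apply emb_mem, H, emb_mem, Hz.
  - intros H u Hu. destruct (emb_pull Hu) as (z & -> & Hz). apply emb_mem, H, Hz.
Qed.

Lemma emb_upair z a b : is_upair (i z) (i a) (i b) <-> is_upair z a b.
Proof.
  split.
  - intros H x. rewrite <- emb_mem, (H (i x)), !emb_inj. tauto.
  - intros H u. split.
    + intros Hu. destruct (emb_pull Hu) as (x & -> & Hx). rewrite !emb_inj. apply H, Hx.
    + intros [-> | ->]; apply emb_mem, H; auto.
Qed.

(** The components of a pair lie in its transitive closure. Hence quantifiers over components are
    bounded, which is what makes the notions below absolute. *)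
Lemma emb_opair_inv z u v : is_opair (i z) u v ->
  exists a b, u = i a /\ v = i b /\ is_opair z a b.
Proof.
  intros (s & t & Hs & Ht & Hz).
  assert (Ks : s ∈ i z) by (apply Hz; auto). assert (Kt : t ∈ i z) by (apply Hz; auto).
  destruct (emb_pull Ks) as (s' & -> & _). destruct (emb_pull Kt) as (t' & -> & _).
  assert (Ku : u ∈ i t') by (apply Ht; auto). assert (Kv : v ∈ i t') by (apply Ht; auto).
  destruct (emb_pull Ku) as (a & -> & _). destruct (emb_pull Kv) as (b & -> & _).
  exists a, b. split; [auto|split; [auto|]]. exists s', t'.
  split; [|split]; apply emb_upair; assumption.
Qed.

Lemma emb_opair z a b : is_opair (i z) (i a) (i b) <-> is_opair z a b.
Proof.
  split.
  - intros H. destruct (emb_opair_inv H) as (a' & b' & Ea & Eb & K).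
    apply emb_inj in Ea, Eb. now subst.
  - intros (s & t & Hs & Ht & Hz). exists (i s), (i t).
    split; [|split]; apply emb_upair; assumption.
Qed.

Lemma emb_rel_inv r u v : rel (i r) u v -> exists a b, u = i a /\ v = i b /\ rel r a b.
Proof.
  intros (z & Hz & Hr). destruct (emb_pull Hr) as (z' & -> & Hz').
  destruct (emb_opair_inv Hz) as (a & b & -> & -> & K). exists a, b.
  split; [auto|split; [auto|]]. exists z'. auto.
Qed.

Lemma emb_rel r a b : rel (i r) (i a) (i b) <-> rel r a b.
Proof.
  split.
  - intros H. destruct (emb_rel_inv H) as (a' & b' & Ea & Eb & K).
    apply emb_inj in Ea, Eb. now subst.
  - intros (z & Hz & Hr). exists (i z). rewrite emb_opair, emb_mem. auto.
Qed.

Lemma emb_transitive x : transitive (i x) <-> transitive x.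
Proof.
  split.
  - intros H y Hy. apply emb_subset, H, emb_mem, Hy.
  - intros H u Hu. destruct (emb_pull Hu) as (y & -> & Hy). apply emb_subset, H, Hy.
Qed.

Lemma emb_ordinal x : is_ordinal x -> is_ordinal (i x).
Proof.
  intros [Ht Hl]. split; [apply emb_transitive, Ht|]. intros u v Hu Hv.
  destruct (emb_pull Hu) as (y & -> & Hy). destruct (emb_pull Hv) as (z & -> & Hz).
  rewrite !emb_mem, emb_inj. auto.
Qed.

Lemma emb_relation r a b : is_relation (i r) (i a) (i b) <-> is_relation r a b.
Proof.
  split.
  - intros H z Hz. destruct (H (i z)) as (u & v & Hu & Hv & K); [apply emb_mem, Hz|].
    destruct (emb_pull Hu) as (x & -> & Hx). destruct (emb_pull Hv) as (y & -> & Hy).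
    exists x, y. apply emb_opair in K. auto.
  - intros H u Hu. destruct (emb_pull Hu) as (z & -> & Hz). destruct (H z Hz) as (x & y & Hx & Hy & K).
    exists (i x), (i y). rewrite !emb_mem, emb_opair. auto.
Qed.

Lemma emb_injection f a b : is_injection (i f) (i a) (i b) <-> is_injection f a b.
Proof.
  split.
  - intros [[Hr Hf] Hi]. split; [split; [apply emb_relation, Hr|]|].
    + intros x Hx. destruct (Hf (i x)) as (v & Hv & Hu); [apply emb_mem, Hx|].
      destruct (emb_rel_inv Hv) as (x' & y & E & -> & K). exists y. apply emb_rel in Hv.
      split; [exact Hv|]. intros y' Hy'. apply emb_inj, Hu, emb_rel, Hy'.
    + intros x x' y H H'. apply emb_inj, (Hi _ _ (i y)); apply emb_rel; assumption.
  - intros [[Hr Hf] Hi]. split; [split; [apply emb_relation, Hr|]|].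
    + intros u Hu. destruct (emb_pull Hu) as (x & -> & Hx). destruct (Hf x Hx) as (y & Hy & Hy').
      exists (i y). split; [apply emb_rel, Hy|]. intros v Hv.
      destruct (emb_rel_inv Hv) as (x' & y' & E & -> & K). apply emb_inj in E. subst x'.
      now rewrite (Hy' y' K).
    + intros u u' v H H'. destruct (emb_rel_inv H) as (x & y & -> & -> & K).
      destruct (emb_rel_inv H') as (x' & y' & -> & E & K'). apply emb_inj in E. subst y'.
      f_equal. exact (Hi _ _ _ K K').
Qed.

Lemma emb_max_inv a b u : is_max (i a) (i b) u -> exists m, u = i m.
Proof. intros [[-> _]|[-> _]]; eauto. Qed.

Lemma emb_max a b m : is_max (i a) (i b) (i m) <-> is_max a b m.
Proof. unfold is_max. rewrite !emb_subset, !emb_inj. tauto. Qed.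

Lemma emb_godel_lt a' b' a b : godel_lt (i a') (i b') (i a) (i b) <-> godel_lt a' b' a b.
Proof.
  split.
  - intros (u & u' & Hu & Hu' & H). destruct (emb_max_inv Hu) as [m ->].
    destruct (emb_max_inv Hu') as [m' ->]. exists m, m'. rewrite emb_max in Hu, Hu'.
    rewrite !emb_mem, !emb_inj in H. auto.
  - intros (m & m' & Hm & Hm' & H). exists (i m), (i m').
    rewrite !emb_max, !emb_mem, !emb_inj. auto.
Qed.

Lemma emb_rel3_inv g u v w : rel3 (i g) u v w ->
  exists a b c, u = i a /\ v = i b /\ w = i c /\ rel3 g a b c.
Proof.
  intros (p & Hp & H). destruct (emb_rel_inv H) as (p' & c & -> & -> & K).
  destruct (emb_opair_inv Hp) as (a & b & -> & -> & K'). exists a, b, c.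
  do 3 (split; [reflexivity|]). exists p'. auto.
Qed.

Lemma emb_rel3 g a b c : rel3 (i g) (i a) (i b) (i c) <-> rel3 g a b c.
Proof.
  split.
  - intros H. destruct (emb_rel3_inv H) as (a' & b' & c' & Ea & Eb & Ec & K).
    apply emb_inj in Ea, Eb, Ec. now subst.
  - intros (p & Hp & H). exists (i p). rewrite emb_opair, emb_rel. auto.
Qed.

Lemma emb_godel k g : is_godel (i k) (i g) <-> is_godel k g.
Proof.
  split.
  - intros [H H']. split.
    + intros a b Ha Hb. destruct (H (i a) (i b)) as [u Hu]; [apply emb_mem, Ha|apply emb_mem, Hb|].
      destruct (emb_rel3_inv Hu) as (a' & b' & c & Ea & Eb & -> & _).
      exists c. apply emb_rel3, Hu.
    + intros a b c Ha Hb Hc d.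
      rewrite <- emb_mem, (H' (i a) (i b) (i c)); [|apply emb_mem, Ha|apply emb_mem, Hb|apply emb_rel3, Hc].
      split.
      * intros (u & v & Hu & Hv & Hlt & K). destruct (emb_pull Hu) as (x & -> & Hx).
        destruct (emb_pull Hv) as (y & -> & Hy). exists x, y.
        rewrite emb_godel_lt in Hlt. rewrite emb_rel3 in K. auto.
      * intros (x & y & Hx & Hy & Hlt & K). exists (i x), (i y).
        rewrite !emb_mem, emb_godel_lt, emb_rel3. auto.
  - intros [H H']. split.
    + intros u v Hu Hv. destruct (emb_pull Hu) as (a & -> & Ha). destruct (emb_pull Hv) as (b & -> & Hb).
      destruct (H a b Ha Hb) as [c Hc]. exists (i c). apply emb_rel3, Hc.
    + intros u v w Hu Hv K d. destruct (emb_pull Hu) as (a & -> & Ha). destruct (emb_pull Hv) as (b & -> & Hb).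
      destruct (emb_rel3_inv K) as (a' & b' & c & Ea & Eb & -> & _). apply emb_rel3 in K. split.
      * intros Hd. destruct (emb_pull Hd) as (e & -> & He). apply (H' a b c Ha Hb K) in He.
        destruct He as (x & y & Hx & Hy & Hlt & L). exists (i x), (i y).
        rewrite !emb_mem, emb_godel_lt, emb_rel3. auto.
      * intros (u & v & Hu' & Hv' & Hlt & L). destruct (emb_pull Hu') as (x & -> & Hx).
        destruct (emb_pull Hv') as (y & -> & Hy). destruct (emb_rel3_inv L) as (x' & y' & e & Ex & Ey & -> & _).
        rewrite emb_godel_lt in Hlt. rewrite emb_rel3 in L. apply emb_mem, (H' a b c Ha Hb K). eauto 6.
Qed.

End Absoluteness.

(** * Forcing *)

Section Forcing.
Context {V W : structure} {hV : ZFC V} {hW : ZFC W}.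
Context (j : V -> W) (hj : transitive_embedding j).
Context (k M : V) (Hk : is_infinite_cardinal k) (HM : is_H_succ k M).
Context (P le : V) (HPM : P ∈ M) (HP : is_forcing P le).
Context (G : W) (HG : is_generic (j M) (j P) (j le) G).
Implicit Types (p q r s t x y z D F : V).

Lemma emb_opair_eq x y : j (opair x y) = opair (j x) (j y).
Proof. apply is_opairE, (emb_opair hj), is_opairE. reflexivity. Qed.

Lemma le_dom p q : rel le p q -> p ∈ P /\ q ∈ P.
Proof. apply relation_dom, HP. Qed.

Lemma le_refl p : p ∈ P -> rel le p p.
Proof. apply HP. Qed.

Lemma le_trans p q r : rel le p q -> rel le q r -> rel le p r.
Proof. apply HP. Qed.

Lemma filter_pull u : u ∈ G -> exists p, u = j p /\ p ∈ P.
Proof. intros H. apply (emb_pull hj). destruct HG as [[Hs _] _]. apply Hs, H. Qed.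

Lemma filter_up p q : j p ∈ G -> rel le p q -> j q ∈ G.
Proof. intros H K. destruct HG as [(_ & _ & Hu & _) _]. apply (Hu (j p)); [exact H|apply (emb_rel hj), K]. Qed.

Lemma filter_meet p q : j p ∈ G -> j q ∈ G -> exists r, j r ∈ G /\ rel le r p /\ rel le r q.
Proof.
  intros H K. destruct HG as [(_ & _ & _ & Hm) _]. destruct (Hm _ _ H K) as (u & Hu & H1 & H2).
  destruct (filter_pull Hu) as (r & -> & _). exists r. split; [exact Hu|].
  split; apply (emb_rel hj); assumption.
Qed.

(** Adding all conditions incompatible with p turns density below p into density; a condition of G
    is never incompatible with p. The dense set belongs to M because it is a subset of P. *)
Lemma generic_below (Q : V -> Prop) p : Def1 anyp Q -> j p ∈ G ->
  (forall q, rel le q p -> exists d, rel le d q /\ Q d) -> exists d, Q d /\ j d ∈ G.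
Proof.
  intros HQ Hp Hd.
  destruct (separation P (Q := fun q => Q q \/ ~ exists r, rel le r q /\ rel le r p)) as [E HE];
    [solve_def|].
  destruct HG as [_ Hgen]. destruct (Hgen (j E)) as (u & Hu & HuG).
  - apply (emb_mem hj), (H_subset HM (x := P)); [|exact HPM]. intros z Hz. apply HE in Hz. tauto.
  - split.
    + apply (emb_subset hj). intros z Hz. apply HE in Hz. tauto.
    + intros u Hu. destruct (emb_pull hj Hu) as (q & -> & Hq).
      assert (K : exists d, d ∈ E /\ rel le d q).
      { destruct (classic (exists r, rel le r q /\ rel le r p)) as [(r & Hrq & Hrp)|N].
        - destruct (Hd r Hrp) as (d & Hdr & HQd). assert (Hdq := le_trans Hdr Hrq).
          exists d. split; [|exact Hdq]. apply HE. split; [apply (le_dom Hdq)|auto].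
        - exists q. split; [apply HE; auto|apply le_refl, Hq]. }
      destruct K as (d & HdE & Hdq). exists (j d).
      rewrite (emb_mem hj), (emb_rel hj). auto.
  - destruct (emb_pull hj Hu) as (d & -> & Hd'). exists d. split; [|exact HuG].
    apply HE in Hd'. destruct Hd' as [_ [H|H]]; [exact H|].
    destruct H. destruct (filter_meet HuG Hp) as (r & _ & H1 & H2). eauto.
Qed.

Lemma generic_dense (Q : V -> Prop) : Def1 anyp Q ->
  (forall q, q ∈ P -> exists d, rel le d q /\ Q d) -> exists d, Q d /\ j d ∈ G.
Proof.
  intros HQ Hd. destruct HG as [(_ & [u Hu] & _) _].
  destruct (filter_pull Hu) as (p & -> & Hp). apply (generic_below (p := p) HQ Hu).
  intros q Hq. apply Hd, (le_dom Hq).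
Qed.

(** [tri F p t x] is read "p forces t = x̌". *)
Definition tri F p t x := opair p (opair t x) ∈ F.

(** The two clauses unfold the inclusions t ⊆ x̌ and x̌ ⊆ t, each through density below p. *)
Definition force_step F p t x :=
  (forall s r q, rel t s r -> rel le q p -> rel le q r ->
     exists q' y, rel le q' q /\ y ∈ x /\ tri F q' s y) /\
  (forall y q, y ∈ x -> rel le q p ->
     exists q' s r, rel le q' q /\ rel t s r /\ rel le q' r /\ tri F q' s y).

Local Instance def_tri : Def4 anyp tri.
Proof. unfold tri. solve_def. Qed.

Local Instance def_force_step : Def4 anyp force_step.
Proof. unfold force_step. solve_def. Qed.

Lemma force_step_mono F F' p t x : subset F F' -> force_step F p t x -> force_step F' p t x.
Proof.
  intros H [H1 H2]. split.
  - intros s r q K1 K2 K3. destruct (H1 s r q K1 K2 K3) as (q' & y & L1 & L2 & L3).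
    exists q', y. split; [|split]; auto. apply H, L3.
  - intros y q K1 K2. destruct (H2 y q K1 K2) as (q' & s & r & L1 & L2 & L3 & L4).
    exists q', s, r. do 3 (split; [assumption|]). apply H, L4.
Qed.

(** The forcing clauses are positive, so the Knaster-Tarski theorem gives a
    solution and no recursion on names is needed. *)
Lemma forcing_relation_exists : exists F, forall p t x, p ∈ P -> t ∈ M -> x ∈ M ->
  (tri F p t x <-> force_step F p t x).
Proof.
  (* Confining names and values to M makes the relation a set, so that it has an image under [j] in
     [W]. *)
  set (T := prod P (prod M M)).
  (* The union of all such [C] inside [T] is the greatest fixed point. *)
  set (post := fun C => forall p t x, tri C p t x -> force_step C p t x).
  assert (Hpost : Def1 anyp post) by (unfold post; solve_def).
  destruct (separation T (Q := fun z => exists C, subset C T /\ post C /\ z ∈ C)) as [F HF];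
    [solve_def|].
  destruct (separation T (Q := fun z => exists p t x, z = opair p (opair t x) /\ force_step F p t x))
    as [F' HF']; [solve_def|].
  assert (HFp : post F).
  { intros p t x H. apply HF in H. destruct H as (_ & C & HCT & HC & Hz).
    apply force_step_mono with C; [|apply HC, Hz]. intros z Hz'. apply HF. split; [apply HCT, Hz'|]. exists C. auto. }
  assert (HT : forall p t x, tri F' p t x <-> (p ∈ P /\ t ∈ M /\ x ∈ M) /\ force_step F p t x).
  { intros p t x. unfold tri at 1. rewrite HF'. unfold T. rewrite !opair_in_prod. split.
    - intros (H & p' & t' & x' & E & K). apply opair_inj in E. destruct E as [-> E].
      apply opair_inj in E. destruct E as [-> ->]. tauto.
    - intros [H K]. split; [tauto|]. exists p, t, x. auto. }
  assert (HFF : subset F F').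
  { intros z Hz. assert (K := Hz). apply HF in K. destruct K as [K _]. unfold T in K. apply in_prod in K.
    destruct K as (p & y & Hp & Hy & ->). apply in_prod in Hy. destruct Hy as (t & x & Ht & Hx & ->).
    apply HT. split; [auto|]. apply HFp, Hz. }
  exists F. intros p t x Hp Ht Hx. split; [apply HFp|]. intros H.
  apply HF. assert (K : tri F' p t x) by (apply HT; auto). split; [apply HF' in K; tauto|].
  exists F'. split; [intros z Hz; apply HF' in Hz; tauto|split; [|exact K]].
  intros q s y H'. apply HT in H'. apply force_step_mono with F; [exact HFF|tauto].
Qed.

Context (F : V) (HF : forall p t x, p ∈ P -> t ∈ M -> x ∈ M ->
  (tri F p t x <-> force_step F p t x)).

Lemma tri_le p q t x : t ∈ M -> x ∈ M -> rel le q p -> tri F p t x -> tri F q t x.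
Proof.
  intros Ht Hx Hqp H. destruct (le_dom Hqp) as [Hq Hp]. apply HF in H; auto. apply HF; auto.
  destruct H as [H1 H2]. split.
  - intros s r q0 K1 K2. apply H1; [exact K1|]. exact (le_trans K2 Hqp).
  - intros y q0 K1 K2. apply H2; [exact K1|]. exact (le_trans K2 Hqp).
Qed.

Lemma name_in_H t s r : rel t s r -> t ∈ M -> s ∈ M.
Proof.
  intros H Ht. apply relE in H. assert (K := H_transitive HM H Ht).
  apply (H_transitive HM (x := upair s s)); [apply in_upair; auto|].
  apply (H_transitive HM (x := opair s r)); [apply in_upair; auto|exact K].
Qed.

Context (f : W) (Hf : is_valuation G f).

Lemma valuation_defined t w s r : rel f (j t) w -> rel t s r -> exists u, rel f (j s) u.
Proof. intros Hw H. apply (proj1 (proj2 Hf _ _ Hw) (j s) (j r)), (emb_rel hj), H. Qed.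

Lemma valuation_mem t w u : rel f (j t) w ->
  (u ∈ w <-> exists s r, j r ∈ G /\ rel t s r /\ rel f (j s) u).
Proof.
  intros Hw. rewrite (proj2 (proj2 Hf _ _ Hw) u). split.
  - intros (s & r & Hr & H & Hy). destruct (emb_rel_inv hj H) as (s' & r' & -> & -> & K). eauto.
  - intros (s & r & Hr & H & Hy). exists (j s), (j r). rewrite (emb_rel hj). auto.
Qed.

(** Induction step of the truth lemma. It works for any solution of the forcing clauses, since the
    clause for x refers only to members of x. *)
Lemma truth_step x : x ∈ M ->
  (forall y, y ∈ x -> forall t w, t ∈ M -> rel f (j t) w ->
    (w = j y <-> exists p, j p ∈ G /\ tri F p t y)) ->
  forall t w, t ∈ M -> rel f (j t) w -> (w = j x <-> exists p, j p ∈ G /\ tri F p t x).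
Proof.
  intros Hx IH t w Ht Hw.
  assert (HGP : forall p, j p ∈ G -> p ∈ P).
  { intros p Hp. destruct (filter_pull Hp) as (p' & E & Hp'). apply (emb_inj hj) in E. now subst. }
  assert (HxM : forall y, y ∈ x -> y ∈ M) by (intros y Hy; exact (H_transitive HM Hy Hx)).
  split.
  - intros ->.
    (* A condition that does not force t = x̌ has an extension witnessing the failure: either it
       puts into t some s that no further extension identifies with a member of x, or it keeps some
       y in x out of t. The induction hypothesis excludes both kinds from G when the value of t is
       x. *)
    destruct (generic_dense (Q := fun p => force_step F p t x \/
      (exists s r, rel t s r /\ rel le p r /\ forall q y, rel le q p -> y ∈ x -> ~ tri F q s y) \/
      (exists y, y ∈ x /\ forall q s r, rel le q p -> rel t s r -> rel le q r -> ~ tri F q s y)))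
      as (p & HQ & HpG); [solve_def| |].
    { intros q Hq. destruct (classic (force_step F q t x)) as [K|K].
      { exists q. split; [apply le_refl, Hq|auto]. }
      apply not_and_or in K. destruct K as [K|K].
      - apply not_all_ex_not in K. destruct K as [s K]. apply not_all_ex_not in K. destruct K as [r K].
        apply not_all_ex_not in K. destruct K as [q1 K].
        apply imply_to_and in K. destruct K as [K1 K]. apply imply_to_and in K. destruct K as [K2 K].
        apply imply_to_and in K. destruct K as [K3 K]. exists q1. split; [exact K2|].
        right; left. exists s, r. split; [auto|split; [auto|]]. intros q2 y L1 L2 L3. apply K. eauto.
      - apply not_all_ex_not in K. destruct K as [y K]. apply not_all_ex_not in K. destruct K as [q1 K].
        apply imply_to_and in K. destruct K as [K1 K]. apply imply_to_and in K. destruct K as [K2 K].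
        exists q1. split; [exact K2|]. right; right. exists y. split; [exact K1|].
        intros q2 s r L1 L2 L3 L4. apply K. eauto 7. }
    destruct HQ as [HQ|[(s & r & Hsr & Hpr & HQ)|(y & Hy & HQ)]].
    + exists p. split; [exact HpG|]. apply HF; auto.
    + exfalso. destruct (valuation_defined Hw Hsr) as [z Hz].
      assert (Hzx : z ∈ j x).
      { apply (valuation_mem z Hw). exists s, r. split; [exact (filter_up HpG Hpr)|auto]. }
      destruct (emb_pull hj Hzx) as (y & -> & Hy).
      destruct (proj1 (IH y Hy s (j y) (name_in_H Hsr Ht) Hz) eq_refl) as (p' & Hp' & Htri).
      destruct (filter_meet HpG Hp') as (q & _ & Hqp & Hqp'). apply (HQ q y Hqp Hy).
      apply (tri_le (name_in_H Hsr Ht) (HxM y Hy) Hqp' Htri).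
    + exfalso. assert (K := Hy). apply (emb_mem hj), (valuation_mem _ Hw) in K.
      destruct K as (s & r & HrG & Hsr & Hy').
      destruct (proj1 (IH y Hy s (j y) (name_in_H Hsr Ht) Hy') eq_refl) as (p' & Hp' & Htri).
      destruct (filter_meet HpG Hp') as (q & HqG & Hqp & Hqp').
      destruct (filter_meet HqG HrG) as (q' & _ & H1 & H2).
      apply (HQ q' s r (le_trans H1 Hqp) Hsr H2).
      apply (tri_le (name_in_H Hsr Ht) (HxM y Hy) (le_trans H1 Hqp') Htri).
  - intros (p & HpG & Htri). apply HF in Htri; auto. destruct Htri as [H1 H2].
    apply ext. intros z. split; intros Hz.
    + apply (valuation_mem _ Hw) in Hz. destruct Hz as (s & r & HrG & Hsr & Hz).
      destruct (filter_meet HpG HrG) as (q & HqG & Hqp & Hqr).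
      destruct (generic_below (Q := fun q' => exists y, y ∈ x /\ tri F q' s y) (p := q))
        as (q' & (y & Hy & Htri) & Hq'); [solve_def|exact HqG| |].
      { intros q0 Hq0. destruct (H1 s r q0 Hsr (le_trans Hq0 Hqp) (le_trans Hq0 Hqr))
          as (q' & y & L1 & L2 & L3). eauto. }
      replace z with (j y); [apply (emb_mem hj), Hy|]. symmetry.
      apply (IH y Hy s z (name_in_H Hsr Ht) Hz). eauto.
    + destruct (emb_pull hj Hz) as (y & -> & Hy).
      destruct (generic_below (Q := fun q' => exists s r, rel t s r /\ rel le q' r /\ tri F q' s y) (p := p))
        as (q & (s & r & Hsr & Hqr & Htri) & Hq); [solve_def|exact HpG| |].
      { intros q0 Hq0. destruct (H2 y q0 Hy Hq0) as (q' & s & r & L1 & L2 & L3 & L4). eauto 8. }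
      destruct (valuation_defined Hw Hsr) as [z' Hz'].
      apply (valuation_mem _ Hw). exists s, r. split; [exact (filter_up Hq Hqr)|split; [exact Hsr|]].
      replace (j y) with z'; [exact Hz'|]. apply (IH y Hy s z' (name_in_H Hsr Ht) Hz'). eauto.
Qed.

(** The statement involves [f] and [G], so the induction on x has to take place in [W]. For that it
    is rephrased without [j] as a function: x and the name range over the set [j M], and forcing is
    membership in the set [j F]. *)
Lemma truth x t w : x ∈ M -> t ∈ M -> rel f (j t) w ->
  (w = j x <-> exists p, j p ∈ G /\ tri F p t x).
Proof.
  intros Hx Ht Hw. apply NNPP. intros N.
  set (Q := fun X : W => exists n w : W, n ∈ j M /\ rel f n w /\
    ~ (w = X <-> exists u : W, u ∈ G /\ opair u (opair n X) ∈ j F)).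
  assert (E : forall t x, (exists u : W, u ∈ G /\ opair u (opair (j t) (j x)) ∈ j F) <->
     exists p, j p ∈ G /\ tri F p t x).
  { intros s y. split.
    - intros (u & Hu & H). destruct (filter_pull Hu) as (p & -> & _). exists p. split; [exact Hu|].
      rewrite <- !emb_opair_eq in H. apply (emb_mem hj) in H. exact H.
    - intros (p & Hp & H). exists (j p). split; [exact Hp|].
      rewrite <- !emb_opair_eq. apply (emb_mem hj), H. }
  destruct (minimal (Q := Q) (a := j M)) as (X & HX & (t' & w' & Ht' & Hw' & HN) & Hmin).
  - unfold Q. solve_def.
  - exists (j x). split; [apply (emb_mem hj), Hx|]. exists (j t), w.
    rewrite (emb_mem hj), E. auto.
  - destruct (emb_pull hj HX) as (y & -> & Hy). destruct (emb_pull hj Ht') as (s & -> & Hs).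
    apply HN. rewrite E. apply (truth_step Hy); [|exact Hs|exact Hw'].
    intros z Hz s' w0 Hs' Hw0. apply NNPP. intros K.
    apply (Hmin (j z)); [apply (emb_mem hj), Hz|apply (emb_mem hj), (H_transitive HM Hz Hy)|].
    exists (j s'), w0. rewrite (emb_mem hj), E. auto.
Qed.

(** For each condition [p] leaving the set undecided, [a] contains the least
    ordinal that [p] does not decide. A condition deciding [A ∩ a] decides [A]. *)
Lemma approximation g t A : is_ordinal g -> le_size P g -> t ∈ M -> rel f (j t) A ->
  subset A (j k) ->
  (forall a, subset a k -> le_size a g ->
     exists b, forall x, x ∈ a -> (j x ∈ A <-> x ∈ b)) ->
  exists A0, A = j A0.
Proof.
  intros Og HPg Ht HA HAk Happ.
  (* This is stronger than p forcing x into the set, as one pair (s, r) of t must be responsible. By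
     [OA], every x in A nevertheless has such a condition in G. *)
  set (O := fun p x => exists s r, rel t s r /\ rel le p r /\ tri F p s x).
  assert (HkM : forall x, x ∈ k -> x ∈ M).
  { intros x Hx. exact (H_transitive HM Hx (H_cardinal Hk HM)). }
  assert (HO : Def2 anyp O) by (unfold O; solve_def).
  assert (Ole : forall p q x, x ∈ k -> rel le q p -> O p x -> O q x).
  { intros p q x Hx Hqp (s & r & H1 & H2 & H3). exists s, r. split; [exact H1|].
    split; [exact (le_trans Hqp H2)|]. exact (tri_le (name_in_H H1 Ht) (HkM x Hx) Hqp H3). }
  assert (OA : forall x, x ∈ k -> (j x ∈ A <-> exists p, j p ∈ G /\ O p x)).
  { intros x Hx. rewrite (valuation_mem _ HA). split.
    - intros (s & r & HrG & Hsr & Hs).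
      destruct (proj1 (truth (HkM x Hx) (name_in_H Hsr Ht) Hs) eq_refl) as (p & HpG & Hp).
      destruct (filter_meet HpG HrG) as (q & HqG & Hqp & Hqr). exists q. split; [exact HqG|].
      exists s, r. split; [exact Hsr|split; [exact Hqr|]].
      exact (tri_le (name_in_H Hsr Ht) (HkM x Hx) Hqp Hp).
    - intros (p & HpG & s & r & Hsr & Hpr & Hp).
      destruct (valuation_defined HA Hsr) as [z Hz]. exists s, r.
      split; [exact (filter_up HpG Hpr)|split; [exact Hsr|]].
      replace (j x) with z; [exact Hz|]. apply (truth (HkM x Hx) (name_in_H Hsr Ht) Hz). eauto. }
  (* Undecided: some extension of p puts x into the set, and some extension keeps it out for
     good. *)
  set (und := fun p x => (exists q, rel le q p /\ O q x) /\
     exists q, rel le q p /\ forall q', rel le q' q -> ~ O q' x).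
  assert (Hund : Def2 anyp und) by (unfold und; solve_def).
  set (least := fun p x => x ∈ k /\ und p x /\ forall y, y ∈ x -> ~ und p y).
  assert (Hleast : Def2 anyp least) by (unfold least; solve_def).
  destruct (separation k (Q := fun x => exists p, p ∈ P /\ least p x)) as [a Ha]; [solve_def|].
  destruct (Happ a) as [b Hb].
  { intros x Hx. apply Ha in Hx. tauto. }
  { apply (@le_size_surj _ _ a P g least); [exact Hleast|exact Og|exact HPg| |].
    - intros x Hx. apply Ha in Hx. tauto.
    - intros p x x' _ (H1 & H2 & H3) (K1 & K2 & K3).
      destruct (proj2 (proj1 (proj1 Hk)) x x' H1 K1) as [L|[L|L]]; [|exact L|].
      + destruct (K3 x L H2).
      + destruct (H3 x' L K2). }
  (* A bad condition contradicts [b] as the value of A ∩ a: at some x in a it puts in an x outside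
     [b], or keeps out an x of [b]. *)
  set (bad := fun p => exists x, x ∈ a /\
    (O p x /\ ~ x ∈ b \/ x ∈ b /\ forall q, rel le q p -> ~ O q x)).
  assert (Hbad : Def1 anyp bad) by (unfold bad; solve_def).
  destruct (generic_dense (Q := fun p => bad p \/ forall q, rel le q p -> ~ bad q))
    as (p & HQ & HpG); [solve_def| |].
  { intros q Hq. destruct (classic (exists q', rel le q' q /\ bad q')) as [(q' & H1 & H2)|N].
    - eauto.
    - exists q. split; [apply le_refl, Hq|]. right. intros q' H K. eauto. }
  assert (HpP : p ∈ P).
  { destruct (filter_pull HpG) as (p' & E & Hp'). apply (emb_inj hj) in E. now subst. }
  (* Since A ∩ a = b, no condition in G is bad; so p has no bad extension, which amounts to p
     forcing A ∩ a = b. *)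
  assert (Good : forall q, rel le q p -> ~ bad q).
  { destruct HQ as [HQ|HQ]; [exfalso|exact HQ].
    destruct HQ as (x & Hx & HQ). assert (Hxk : x ∈ k) by (apply Ha in Hx; tauto).
    specialize (Hb x Hx). rewrite (OA x Hxk) in Hb. destruct HQ as [[H1 H2]|[H1 H2]].
    - apply H2, Hb. eauto.
    - apply Hb in H1. destruct H1 as (p' & Hp' & HO').
      destruct (filter_meet HpG Hp') as (r & _ & Hr1 & Hr2).
      exact (H2 r Hr1 (Ole _ _ _ Hxk Hr2 HO')). }
  (* The least y left undecided by p lies in [a]. The extension that puts y in shows y ∈ b, and then
     the extension that keeps y out is bad. *)
  assert (Dec : forall x, x ∈ k -> ~ und p x).
  { intros x Hx Hu. destruct (minimal (Q := und p) (a := k)) as (y & Hy & Hpy & Hmin);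
      [unfold Def1; solve_def|eauto|].
    assert (Hya : y ∈ a).
    { apply Ha. split; [exact Hy|]. exists p. split; [exact HpP|]. split; [exact Hy|split; [exact Hpy|]].
      intros z Hz. apply (Hmin z Hz). apply (ord_trans (proj1 (proj1 Hk)) Hz Hy). }
    destruct Hpy as [(q & Hq & HOq) (q' & Hq' & HNq)].
    assert (Hyb : y ∈ b).
    { apply NNPP. intros K. apply (Good q Hq). exists y. auto. }
    apply (Good q' Hq'). exists y. auto. }
  destruct (separation k (Q := fun x => exists q, rel le q p /\ O q x)) as [A0 HA0]; [solve_def|].
  exists A0. apply ext. intros u. split; intros Hu.
  - destruct (emb_pull hj (HAk u Hu)) as (x & -> & Hx). apply (emb_mem hj), HA0. split; [exact Hx|].
    apply (OA x Hx) in Hu. destruct Hu as (p' & Hp' & HO').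
    destruct (filter_meet HpG Hp') as (r & _ & Hr1 & Hr2). exists r. split; [exact Hr1|].
    exact (Ole _ _ _ Hx Hr2 HO').
  - destruct (emb_pull hj Hu) as (x & -> & Hx). apply HA0 in Hx. destruct Hx as [Hx Hq].
    apply (OA x Hx).
    destruct (generic_below (Q := fun q => O q x) (p := p)) as (q & HOq & HqG);
      [solve_def|exact HpG| |eauto].
    intros q Hqp. apply NNPP. intros K. apply (Dec x Hx). split; [exact Hq|].
    exists q. split; [exact Hqp|]. intros q' H1 H2. eauto.
Qed.

End Forcing.

(** * Definability of the ground model *)

Section Codes.
Context {U : structure}.

(** [A] is the membership relation of the transitive set [T], transferred along
    [h] to a relation on [c = ⋃ q] and along [g] to a subset of [c]; the last
    clause characterizes the subsets of [c] in the ground model. *)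
Definition is_code (q x T h g A c : U) : Prop :=
  (forall u, u ∈ c <-> exists a, a ∈ q /\ u ∈ a) /\
  is_godel c g /\ x ∈ T /\ transitive T /\ is_injection h T c /\
  (forall d, d ∈ A <-> exists y z u v,
     y ∈ z /\ z ∈ T /\ rel h y u /\ rel h z v /\ rel3 g u v d) /\
  (forall a, a ∈ q -> exists b, b ∈ q /\ forall d, d ∈ b <-> d ∈ a /\ d ∈ A).

Definition coded (q x : U) : Prop := exists T h g A c, is_code q x T h g A c.

Global Instance def_coded (C : U -> Prop) {HC : Params C} : Def2 C coded.
Proof. unfold coded, is_code. solve_def. Qed.

End Codes.

Section CodeAbsoluteness.
Context {U1 U2 : structure} {i : U1 -> U2} (hi : transitive_embedding i).

(** A set of a transitive submodel has all its members there, so its equation with a class transfers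
    as soon as that class also consists of elements of the submodel. *)
Lemma emb_comprehension (A : U1) (Q1 : U1 -> Prop) (Q2 : U2 -> Prop) :
  (forall d, Q2 (i d) <-> Q1 d) -> (forall u, Q2 u -> exists d, u = i d) ->
  ((forall u, u ∈ i A <-> Q2 u) <-> (forall d, d ∈ A <-> Q1 d)).
Proof.
  intros H K. split.
  - intros L d. rewrite <- (emb_mem hi), L. apply H.
  - intros L u. split.
    + intros Hu. destruct (emb_pull hi Hu) as (d & -> & Hd). apply H, L, Hd.
    + intros Hu. destruct (K u Hu) as [d ->]. apply (emb_mem hi), L, H, Hu.
Qed.

(** Every quantifier in a code is bounded by the sets involved. The lemma is used for both [V] and
    the extension as submodels of [W], so the formula never has to be analyzed inside the
    extension. *)
Lemma emb_code q x T h g A c :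
  is_code (i q) (i x) (i T) (i h) (i g) (i A) (i c) <-> is_code q x T h g A c.
Proof.
  unfold is_code.
  rewrite (emb_godel hi), (emb_mem hi), (emb_transitive hi), (emb_injection hi).
  assert (E1 : (forall u, u ∈ i c <-> exists a, a ∈ i q /\ u ∈ a) <->
    (forall u, u ∈ c <-> exists a, a ∈ q /\ u ∈ a)).
  { apply emb_comprehension.
    - intros d. split.
      + intros (a & Ha & Hd). destruct (emb_pull hi Ha) as (a' & -> & Ha').
        apply (emb_mem hi) in Hd. eauto.
      + intros (a & Ha & Hd). exists (i a). now rewrite !(emb_mem hi).
    - intros u (a & Ha & Hd). destruct (emb_pull hi Ha) as (a' & -> & Ha').
      apply (te_trans hi Hd). }
  assert (E2 : (forall d, d ∈ i A <-> exists y z u v,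
     y ∈ z /\ z ∈ i T /\ rel (i h) y u /\ rel (i h) z v /\ rel3 (i g) u v d) <->
    (forall d, d ∈ A <-> exists y z u v,
     y ∈ z /\ z ∈ T /\ rel h y u /\ rel h z v /\ rel3 g u v d)).
  { apply emb_comprehension.
    - intros d. split.
      + intros (y & z & u & v & Hyz & Hz & Hu & Hv & Hd).
        destruct (emb_rel_inv hi Hu) as (y' & u' & -> & -> & _).
        destruct (emb_rel_inv hi Hv) as (z' & v' & -> & -> & _).
        exists y', z', u', v'. rewrite !(emb_mem hi) in *. rewrite !(emb_rel hi) in *.
        rewrite (emb_rel3 hi) in Hd. auto.
      + intros (y & z & u & v & H). exists (i y), (i z), (i u), (i v).
        rewrite !(emb_mem hi), !(emb_rel hi), (emb_rel3 hi). exact H.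
    - intros w (y & z & u & v & _ & _ & _ & _ & Hd).
      destruct (emb_rel3_inv hi Hd) as (a & b & d & _ & _ & -> & _). eauto. }
  assert (E3 : (forall a, a ∈ i q -> exists b, b ∈ i q /\ forall d, d ∈ b <-> d ∈ a /\ d ∈ i A) <->
    (forall a, a ∈ q -> exists b, b ∈ q /\ forall d, d ∈ b <-> d ∈ a /\ d ∈ A)).
  { assert (K : forall a b, (forall d, d ∈ i b <-> d ∈ i a /\ d ∈ i A) <->
      (forall d, d ∈ b <-> d ∈ a /\ d ∈ A)).
    { intros a b. apply emb_comprehension.
      - intros d. rewrite !(emb_mem hi). tauto.
      - intros u [Hu _]. apply (te_trans hi Hu). }
    split.
    - intros H a Ha. destruct (H (i a)) as (u & Hu & Hd); [apply (emb_mem hi), Ha|].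
      destruct (emb_pull hi Hu) as (b & -> & Hb). exists b. split; [exact Hb|]. apply K, Hd.
    - intros H u Hu. destruct (emb_pull hi Hu) as (a & -> & Ha). destruct (H a Ha) as (b & Hb & Hd).
      exists (i b). rewrite (emb_mem hi). split; [exact Hb|]. apply K, Hd. }
  rewrite E1, E2, E3. tauto.
Qed.

End CodeAbsoluteness.

Section Definable.
Context {V W : structure} {hV : ZFC V} {hW : ZFC W}.
Context (j : V -> W) (hj : transitive_embedding j).
Context (k M : V) (Hk : is_infinite_cardinal k) (HM : is_H_succ k M).
Context (P le : V) (HPM : P ∈ M) (HP : is_forcing P le).
Context (G : W) (HG : is_generic (j M) (j P) (j le) G).

(** The canonical name of [y] is [{(y', p) : y' a canonical name of a member
    of y, p ∈ P}], as [P] need not have a largest element. *)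
Lemma check_name x : x ∈ M ->
  exists t : W, t ∈ j M /\ is_name (j P) t /\ name_value G t (j x).
Proof.
  intros Hx. destruct (H_transitive_superset Hk HM Hx) as (T & HxT & HT & HTk & HTM).
  destruct (recursion (A := T) (R := @mem V) (H := fun u => prod u P))
    as (c & B & Hc & Hs & Hrec); [exact _|unfold Fun1; tdefn|apply mem_wf_on|].
  assert (Hrec' : forall y s, rel c y s -> forall z, z ∈ s <->
    exists y' s' p, y' ∈ y /\ rel c y' s' /\ p ∈ P /\ z = opair s' p).
  { intros y s Hys z. destruct (Hrec y s Hys) as (u & -> & Hu). rewrite in_prod. split.
    - intros (s' & p & Hs' & Hp & ->). apply Hu in Hs'. destruct Hs' as (y' & _ & Hy & Hr). eauto 8.
    - intros (y' & s' & p & Hy & Hr & Hp & ->). exists s', p. split; [|auto].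
      apply Hu. exists y'. split; [|auto]. apply (fun_dom Hc Hr). }
  (* By ∈-induction: the name of m is the product of P with a set of at most κ names already known
     to be in M. *)
  assert (HcM : forall y s, rel c y s -> s ∈ M).
  { intros y s Hys. apply NNPP. intros N.
    destruct (minimal (Q := fun y => exists s, rel c y s /\ ~ s ∈ M) (a := T))
      as (m & Hm & (r & Hr & Nr) & Hmin); [solve_def| |].
    { exists y. split; [apply (fun_dom Hc Hys)|eauto]. }
    apply Nr. destruct (Hrec m r Hr) as (u & -> & Hu). apply (H_prod Hk HM); [|exact HPM].
    apply (H_closed Hk HM).
    - intros z Hz. apply Hu in Hz. destruct Hz as (y' & Hy' & Hym & Hz). apply NNPP. intros K.
      apply (Hmin y' Hym Hy'). eauto.
    - apply (@le_size_surj _ _ u T k (fun y z => rel c y z)); [solve_def|apply Hk|exact HTk| |].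
      + intros z Hz. apply Hu in Hz. destruct Hz as (y' & Hy' & _ & Hz). eauto.
      + intros y' z z' _. apply (fun_unique Hc). }
  (* Distinct sets receive distinct names because P is nonempty: paired with [p0], the name of each
     member of y occurs in the name of y. *)
  assert (Hinj : forall y y' s, rel c y s -> rel c y' s -> y = y').
  { destruct (proj1 HP) as [p0 Hp0].
    assert (Hincl : forall y y' s, rel c y s -> rel c y' s -> forall z, z ∈ y ->
      exists r z', rel c z r /\ rel c z' r /\ z' ∈ y').
    { intros y y' s Hy Hy' z Hz.
      destruct (fun_total Hc (x := z)) as (r & _ & Hr).
      { apply (HT y); [apply (fun_dom Hc Hy)|exact Hz]. }
      assert (K : opair r p0 ∈ s) by (apply (Hrec' y s Hy); eauto 8).
      apply (Hrec' y' s Hy') in K. destruct K as (z' & r' & p & Hz' & Hr' & _ & E).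
      apply opair_inj in E. destruct E as [<- _]. eauto. }
    intros y y' s Hy Hy'. apply NNPP. intros N.
    destruct (minimal (Q := fun y => exists y' s, rel c y s /\ rel c y' s /\ y <> y') (a := T))
      as (m & Hm & (m' & r & Hr & Hr' & Hne) & Hmin); [solve_def| |].
    { exists y. split; [apply (fun_dom Hc Hy)|eauto]. }
    apply Hne. apply ext. intros z. split; intros Hz.
    - destruct (Hincl _ _ _ Hr Hr' z Hz) as (s' & z' & H1 & H2 & H3).
      replace z with z'; [exact H3|]. apply NNPP. intros K.
      apply (Hmin z Hz (proj1 (fun_dom Hc H1))). exists z', s'. auto.
    - destruct (Hincl _ _ _ Hr' Hr z Hz) as (s' & z' & H1 & H2 & H3).
      replace z with z'; [exact H3|]. apply NNPP. intros K.
      apply (Hmin z' H3 (proj1 (fun_dom Hc H2))). exists z, s'. auto. }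
  (* The valuation is the inverse of [c], single-valued by injectivity. *)
  destruct (graph B T (Q := fun s y => rel c y s)) as (f & Hf & Hfr); [solve_def|].
  assert (Hfr' : forall s y, rel f s y <-> rel c y s).
  { intros s y. rewrite Hfr. split; [tauto|]. intros H. destruct (fun_dom Hc H). auto. }
  destruct (fun_total Hc HxT) as (t & _ & Ht).
  exists (j t). split; [apply (emb_mem hj), (HcM x t Ht)|]. split.
  - exists (j B). split; [apply (emb_mem hj), (fun_dom Hc Ht)|].
    intros u v Hu Hv. destruct (emb_pull hj Hu) as (s & -> & Hs').
    destruct (emb_pull hj Hv) as (z & -> & Hz). destruct (Hs s Hs') as [y Hy].
    apply (Hrec' y s Hy) in Hz. destruct Hz as (y' & s' & p & _ & Hr & Hp & ->).
    exists (j s'), (j p). rewrite !(emb_mem hj), (emb_opair hj), is_opairE.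
    split; [apply (fun_dom Hc Hr)|auto].
  - exists (j f). split; [|apply (emb_rel hj), Hfr', Ht]. split.
    + intros u v v' H H'. destruct (emb_rel_inv hj H) as (s & y & -> & -> & K).
      destruct (emb_rel_inv hj H') as (s' & y' & E & -> & K'). apply (emb_inj hj) in E. subst s'.
      apply Hfr' in K, K'. now rewrite (Hinj _ _ _ K K').
    + intros u v H. destruct (emb_rel_inv hj H) as (s & y & -> & -> & K). apply Hfr' in K. split.
      * intros u' p' H'. destruct (emb_rel_inv hj H') as (s' & p & -> & -> & K').
        apply relE, (Hrec' y s K) in K'. destruct K' as (y' & s1 & p1 & Hy' & Hr & _ & E).
        apply opair_inj in E. destruct E as [<- _]. exists (j y'). apply (emb_rel hj), Hfr', Hr.
      * intros w. split.
        -- intros Hw. destruct (emb_pull hj Hw) as (y' & -> & Hy').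
           (* The name of y' occurs paired with every condition, so any member of the nonempty
              filter will do. *)
           destruct HG as [(HGs & [p' Hp'] & _) _].
           destruct (emb_pull hj (HGs _ Hp')) as (p & -> & Hp).
           destruct (fun_total Hc (x := y')) as (s' & _ & Hs').
           { apply (HT y); [apply (fun_dom Hc K)|exact Hy']. }
           exists (j s'), (j p). rewrite !(emb_rel hj), Hfr', relE. split; [exact Hp'|split; [|exact Hs']].
           apply (Hrec' y s K). eauto 8.
        -- intros (u' & p' & _ & H1 & H2). destruct (emb_rel_inv hj H1) as (s' & p & -> & -> & K').
           apply relE, (Hrec' y s K) in K'. destruct K' as (y' & s1 & p1 & Hy' & Hr & _ & E).
           apply opair_inj in E. destruct E as [<- _].
           destruct (emb_rel_inv hj H2) as (s2 & y2 & E & -> & K2). apply (emb_inj hj) in E. subst s2.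
           apply Hfr' in K2. rewrite (Hinj _ _ _ K2 Hr). apply (emb_mem hj), Hy'.
Qed.

(** * The extension as a transitive submodel of W *)

Let N : structure := extension (j M) (j P) G.
Let val : N -> W := @proj1_sig _ _.

(** A member of the value of t is the value of a component s of t. The name s is again in M, and the
    set of names and the valuation that serve for t serve for s. *)
Lemma extension_embedding : transitive_embedding val.
Proof.
  split.
  - intros [x Hx] [y Hy] E. cbn in E. subst y. f_equal. apply proof_irrelevance.
  - intros x y. reflexivity.
  - intros w [x (t & Ht & (S & HtS & HS) & f & Hf & Hr)] Hw. cbn in Hw.
    apply (proj2 (proj2 Hf _ _ Hr)) in Hw. destruct Hw as (s & p & Hp & Hsp & Hw).
    destruct (emb_pull hj Ht) as (t0 & -> & Ht0).
    destruct (emb_rel_inv hj Hsp) as (s0 & p0 & -> & -> & K).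
    assert (Hv : exists t, t ∈ j M /\ is_name (j P) t /\ name_value G t w).
    { exists (j s0). split; [apply (emb_mem hj), (name_in_H HM K Ht0)|]. split.
      - exists S. split; [|exact HS]. destruct Hsp as (z & Hz & Hzt).
        destruct (HS _ _ HtS Hzt) as (s' & p' & Hs' & _ & E). apply is_opairE in Hz, E.
        rewrite Hz in E. apply opair_inj in E. destruct E as [-> _]. exact Hs'.
      - exists f. auto. }
    exists (exist _ w Hv). reflexivity.
Qed.

Lemma ground_in_extension x : x ∈ M -> exists e : N, val e = j x.
Proof. intros Hx. exists (exist _ (j x) (check_name Hx)). reflexivity. Qed.

Lemma definable_intro (a : N) (Q : N -> Prop) : Def1 (fun c => c = a) Q ->
  (forall x, x ∈ j M <-> exists e, val e = x /\ Q e) ->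
  definable_in_extension (j M) (j P) G (val a).
Proof.
  intros (phi & env & Henv & H) HQ. exists a, phi. split; [reflexivity|]. intros x. rewrite HQ.
  assert (E : forall e, Q e <-> sat (scons e (fun _ => a)) phi).
  { intros e. rewrite (H (scons e (fun _ => a))), vapp_scons.
    replace (vapp 0 (fun _ => a) env) with (fun _ : nat => a); [tauto|].
    apply functional_extensionality. intros i. unfold vapp. cbn. now rewrite Henv. }
  split; intros (e & He & K); exists e; (split; [exact He|]); apply E; exact K.
Qed.

(** * Codes in the ground model and in the extension *)

Context (g q : V) (Cg : is_cardinal g) (HPg : le_size P g)
  (Hq : forall x, x ∈ q <-> subset x k /\ le_size x g).

(** Singletons are small enough because P is nonempty, so γ is at least 1. Hence κ can be recovered
    from the parameter. *)
Lemma small_cover u : u ∈ k <-> exists a, a ∈ q /\ u ∈ a.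
Proof.
  split.
  - intros Hu. exists (upair u u). split; [|apply in_upair; auto]. apply Hq. split.
    + intros z Hz. apply in_upair in Hz. destruct Hz; now subst.
    + apply le_size_trans with P; [|exact HPg]. destruct (proj1 HP) as [p Hp].
      apply le_size_intro with (Q := fun x y => y = p); [solve_def|eauto|congruence|].
      intros x x' y Hx Hx' _ _. apply in_upair in Hx, Hx'. intuition congruence.
  - intros (a & Ha & Hu). apply Hq in Ha. apply Ha, Hu.
Qed.

(** All witnesses are found in M, hence have canonical names and occur in the extension. The
    approximation clause holds since [q] is closed under subsets. *)
Lemma coded_of_ground x : x ∈ M ->
  exists T h d A, T ∈ M /\ h ∈ M /\ d ∈ M /\ A ∈ M /\ is_code q x T h d A k.
Proof.
  intros Hx. destruct (H_transitive_superset Hk HM Hx) as (T & HxT & HT & [h Hh] & HTM).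
  destruct (godel_exists Hk) as (d & Hd & Hbd).
  destruct (separation k (Q := fun c => exists y z u v,
    y ∈ z /\ z ∈ T /\ rel h y u /\ rel h z v /\ rel3 d u v c)) as [A HA]; [solve_def|].
  assert (HkM := H_cardinal Hk HM).
  exists T, h, d, A. split; [exact HTM|]. split; [|split; [|split]].
  - exact (H_relation Hk HM (proj1 (proj1 Hh)) HTM HkM).
  - exact (H_relation Hk HM (proj1 (proj1 (proj1 Hbd))) (H_prod Hk HM HkM HkM) HkM).
  - apply (H_subset HM (x := k)); [|exact HkM]. intros z Hz. apply HA in Hz. tauto.
  - split; [exact small_cover|]. split; [exact Hd|]. split; [exact HxT|]. split; [exact HT|].
    split; [exact Hh|]. split.
    + intros c. rewrite HA. split; [tauto|]. intros K. split; [|exact K].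
      destruct K as (y & z & u & v & _ & _ & _ & _ & K). apply rel3E in K.
      apply (fun_dom (proj1 (proj1 Hbd)) K).
    + intros a Ha. apply Hq in Ha. destruct Ha as [Hak Hag].
      destruct (separation a (Q := fun c => c ∈ A)) as [b Hb]; [solve_def|].
      assert (Hba : subset b a) by (intros z Hz; apply Hb in Hz; tauto).
      exists b. split; [|exact Hb]. apply Hq. split; [intros z Hz; auto|].
      exact (le_size_trans (le_size_subset Hba) Hag).
Qed.

(** By [approximation] the code A is the image of some A0 in [V]. There A0 decodes to a relation on
    κ that is well-founded because in [W] it is transferred from membership on T. Its collapse,
    built in [V], sends h(z) to z for every z in T, so x lies in the range [B], which is transitive
    and of size at most κ. *)
Lemma ground_of_coded (x T h d A c : N) : is_code (j q) (val x) (val T) (val h) (val d) (val A) (val c) ->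
  val x ∈ j M.
Proof.
  (* Only A must remember that it belongs to the extension, since [approximation] needs a name for
     it; the rest is treated as sets of [W]. *)
  generalize (val x) (val T) (val h) (val d) (val c). clear x T h d c.
  intros x T h d c (Hc & Hd & HxT & HT & Hh & HA & Happ).
  assert (Ok : is_ordinal k) by apply Hk.
  assert (Ec : c = j k).
  { apply ext. intros u. rewrite Hc. split.
    - intros (a & Ha & Hu). destruct (emb_pull hj Ha) as (a' & -> & Ha').
      destruct (emb_pull hj Hu) as (u' & -> & Hu'). apply (emb_mem hj), small_cover. eauto.
    - intros Hu. destruct (emb_pull hj Hu) as (u' & -> & Hu'). apply small_cover in Hu'.
      destruct Hu' as (a & Ha & Hu'). exists (j a). now rewrite !(emb_mem hj). }
  subst c. destruct (godel_exists Hk) as (d0 & Hd0 & [[Hfd Hid] Hsd]).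
  assert (Hjd0 : is_godel (j k) (j d0)) by (apply (emb_godel hj), Hd0).
  assert (Ojk : is_ordinal (j k)) by (apply (emb_ordinal hj), Ok).
  (* The pairing [d] found in the extension agrees on κ × κ with the image of [d0]. *)
  assert (Ed : forall a b w, a ∈ k -> b ∈ k ->
     (rel3 d (j a) (j b) w <-> exists w0, w = j w0 /\ rel3 d0 a b w0)).
  { intros a b w Ha Hb. destruct (proj1 Hd0 a b Ha Hb) as [w0 Hw0].
    destruct (proj1 Hd (j a) (j b)) as [w1 Hw1]; [apply (emb_mem hj), Ha|apply (emb_mem hj), Hb|].
    assert (K : forall w, rel3 d (j a) (j b) w -> w = j w0).
    { intros w' Hw'. apply (godel_unique Ojk Hd Hjd0 (a := j a) (b := j b));
        [apply (emb_mem hj), Ha|apply (emb_mem hj), Hb|exact Hw'|apply (emb_rel3 hj), Hw0]. }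
    split.
    - intros Hw. rewrite (K w Hw). eauto.
    - intros (w2 & -> & Hw2). assert (w2 = w0).
      { apply rel3E in Hw2, Hw0. exact (fun_unique Hfd Hw2 Hw0). }
      subst w2. now rewrite <- (K w1 Hw1). }
  assert (Hdom : forall y u, rel h y u -> y ∈ T /\ exists a, u = j a /\ a ∈ k).
  { intros y u Hyu. destruct (fun_dom (proj1 Hh) Hyu) as [Hy Hu]. split; [exact Hy|].
    exact (emb_pull hj Hu). }
  assert (HAk : subset (val A) (j k)).
  { intros w Hw. apply HA in Hw. destruct Hw as (y & z & u & v & _ & _ & Hu & Hv & Hw).
    destruct (Hdom _ _ Hu) as (_ & a & -> & Ha). destruct (Hdom _ _ Hv) as (_ & b & -> & Hb).
    apply (Ed a b w Ha Hb) in Hw. destruct Hw as (w0 & -> & Hw0). apply (emb_mem hj).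
    apply rel3E in Hw0. apply (fun_dom Hfd Hw0). }
  assert (KA : exists A0, val A = j A0).
  { destruct (proj2_sig A) as (t & Ht & _ & f & Hf & Hr).
    change (proj1_sig A) with (val A) in Hr. destruct (emb_pull hj Ht) as (t0 & -> & Ht0).
    destruct (forcing_relation_exists M P le) as [F HF].
    apply (approximation hj Hk HM HPM HP HG HF Hf (proj1 Cg) HPg Ht0 Hr HAk).
    intros a Hak Hag. destruct (Happ (j a)) as (u & Hu & Hd'); [apply (emb_mem hj), Hq; auto|].
    destruct (emb_pull hj Hu) as (b & -> & _). exists b. intros y Hy.
    rewrite <- (emb_mem hj y b), Hd', (emb_mem hj). tauto. }
  destruct KA as [A0 EA]. rewrite EA in *.
  set (R := fun a b => exists w, rel3 d0 a b w /\ w ∈ A0).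
  assert (HR : Def2 anyp R) by (unfold R; solve_def).
  assert (ER : forall a b, a ∈ k -> b ∈ k -> (R a b <->
     exists y z, y ∈ z /\ z ∈ T /\ rel h y (j a) /\ rel h z (j b))).
  { intros a b Ha Hb. split.
    - intros (w & Hw & HwA). apply (emb_mem hj), HA in HwA.
      destruct HwA as (y & z & u & v & Hyz & Hz & Hu & Hv & Hw').
      destruct (Hdom _ _ Hu) as (_ & a' & -> & Ha'). destruct (Hdom _ _ Hv) as (_ & b' & -> & Hb').
      apply (Ed a' b' _ Ha' Hb') in Hw'. destruct Hw' as (w0 & E & Hw0).
      apply (emb_inj hj) in E. subst w0. apply rel3E in Hw, Hw0.
      assert (E := Hid _ _ _ Hw Hw0). apply opair_inj in E. destruct E; subst a' b'. eauto 6.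
    - intros (y & z & Hyz & Hz & Hya & Hzb). destruct (proj1 Hd0 a b Ha Hb) as [w Hw].
      exists w. split; [exact Hw|]. apply (emb_mem hj), HA. exists y, z, (j a), (j b).
      do 4 (split; [assumption|]). apply Ed; eauto. }
  assert (Hwf : wf_on k R).
  { intros X HXk [b0 Hb0]. destruct (classic (exists y, y ∈ T /\ exists u, rel h y u /\ u ∈ j X)) as [K|K].
    - destruct (minimal (Q := fun y => exists u, rel h y u /\ u ∈ j X) (a := T))
        as (y & Hy & (u & Hyu & Hu) & Hmin); [solve_def|exact K|].
      destruct (emb_pull hj Hu) as (b & -> & Hb). exists b. split; [exact Hb|].
      intros a Ha Hab. apply (ER a b (HXk _ Ha) (HXk _ Hb)) in Hab.
      destruct Hab as (y' & z' & Hyz & Hz' & H1 & H2).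
      rewrite (proj2 Hh _ _ _ H2 Hyu) in Hyz. apply (Hmin y' Hyz).
      + apply (Hdom _ _ H1).
      + exists (j a). split; [exact H1|]. apply (emb_mem hj), Ha.
    - exists b0. split; [exact Hb0|]. intros a Ha Hab. apply (ER a b0 (HXk _ Ha) (HXk _ Hb0)) in Hab.
      destruct Hab as (y' & z' & _ & Hz' & _ & H2). apply K. exists z'. split; [exact Hz'|].
      exists (j b0). split; [exact H2|]. apply (emb_mem hj), Hb0. }
  assert (Hid' : Fun1 anyp (fun u : V => u)) by (unfold Fun1; apply (tdef_var (C := anyp)); auto).
  destruct (recursion HR Hid' Hwf) as (e & B & He & HB & Hrec).
  assert (Hrec' : forall b y, rel e b y -> forall z, z ∈ y <-> exists a, a ∈ k /\ R a b /\ rel e a z).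
  { intros b y Hby. destruct (Hrec b y Hby) as (u & -> & Hu). exact Hu. }
  (* The ∈-induction on T runs in [W], where T lives; the collapse enters it as the set [j e]. *)
  assert (Main : forall z u, z ∈ T -> rel h z u -> rel (j e) u z).
  { intros z0 u0 Hz0 Hu0. apply NNPP. intros K.
    destruct (minimal (Q := fun z => exists u, rel h z u /\ ~ rel (j e) u z) (a := T))
      as (z & Hz & (u & Hzu & Hnot) & Hmin); [solve_def|eauto|].
    destruct (Hdom _ _ Hzu) as (_ & b & -> & Hb). apply Hnot.
    destruct (fun_total He Hb) as (y0 & _ & Hy0).
    assert (Below : forall y a, y ∈ z -> rel h y (j a) -> rel (j e) (j a) y).
    { intros y a Hyz Hya. apply NNPP. intros L. apply (Hmin y Hyz); [apply (Hdom _ _ Hya)|eauto]. }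
    replace z with (j y0); [apply (emb_rel hj), Hy0|].
    apply ext. intros v. split; intros Hv.
    - destruct (emb_pull hj Hv) as (y & -> & Hy). apply (Hrec' b y0 Hy0) in Hy.
      destruct Hy as (a & Ha & Hab & Hay). apply (ER a b Ha Hb) in Hab.
      destruct Hab as (y' & z' & Hyz & Hz' & H1 & H2). rewrite (proj2 Hh _ _ _ H2 Hzu) in Hyz.
      assert (L := Below y' a Hyz H1). destruct (emb_rel_inv hj L) as (a1 & y1 & E & -> & L').
      apply (emb_inj hj) in E. subst a1. now rewrite (fun_unique He Hay L').
    - assert (HvT : v ∈ T) by (exact (HT z Hz v Hv)).
      destruct (fun_total (proj1 Hh) HvT) as (w & Hw & Hvw).
      destruct (emb_pull hj Hw) as (a & -> & Ha). assert (L := Below v a Hv Hvw).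
      destruct (emb_rel_inv hj L) as (a1 & y1 & E & -> & L'). apply (emb_inj hj) in E. subst a1.
      apply (emb_mem hj), (Hrec' b y0 Hy0). exists a. split; [exact Ha|split; [|exact L']].
      apply (ER a b Ha Hb). eauto 6. }
  destruct (fun_total (proj1 Hh) HxT) as (u & _ & Hxu).
  destruct (emb_rel_inv hj (Main x u HxT Hxu)) as (b & x0 & _ & -> & Hx0).
  apply (emb_mem hj), (H_intro HM (x := x0) (t := B)).
  - intros z Hz. apply (Hrec' b x0 Hx0) in Hz. destruct Hz as (a & _ & _ & Haz).
    apply (fun_dom He Haz).
  - intros y Hy z Hz. destruct (HB y Hy) as [b' Hb']. apply (Hrec' b' y Hb') in Hz.
    destruct Hz as (a & _ & _ & Haz). apply (fun_dom He Haz).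
  - apply (@le_size_surj _ _ B k k (fun b y => rel e b y)); [solve_def|exact Ok| | |].
    + apply le_size_subset, subset_refl.
    + intros y Hy. destruct (HB y Hy) as [b' Hb']. exists b'. split; [|exact Hb'].
      apply (fun_dom He Hb').
    + intros b' y y' _. apply (fun_unique He).
Qed.

Lemma ground_definable : q ∈ M -> definable_in_extension (j M) (j P) G (j q).
Proof.
  intros HqM. destruct (ground_in_extension HqM) as [a Ea]. rewrite <- Ea.
  assert (Params (fun c : N => c = a)) by (exists a; reflexivity).
  apply definable_intro with (Q := fun x => coded a x); [solve_def|].
  intros x. split.
  - intros Hx. destruct (emb_pull hj Hx) as (x0 & -> & Hx0).
    destruct (coded_of_ground Hx0) as (T & h & d & A & HT & Hh & Hd & HA & Hcode).
    destruct (ground_in_extension Hx0) as [x' Ex]. destruct (ground_in_extension HT) as [T' ET].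
    destruct (ground_in_extension Hh) as [h' Eh]. destruct (ground_in_extension Hd) as [d' Ed].
    destruct (ground_in_extension HA) as [A' EA].
    destruct (ground_in_extension (H_cardinal Hk HM)) as [k' Ek].
    exists x'. split; [exact Ex|]. exists T', h', d', A', k'.
    apply (emb_code extension_embedding). rewrite Ea, Ex, ET, Eh, Ed, EA, Ek.
    apply (emb_code hj), Hcode.
  - intros (x' & <- & T & h & d & A & c & Hcode).
    apply (emb_code extension_embedding) in Hcode. rewrite Ea in Hcode.
    exact (ground_of_coded Hcode).
Qed.

End Definable.

(** Common core of all parts, which differ in how they bound the number of functions from γ to κ by
    κ. By Cantor's argument this bound gives γ < κ, so γ⁺ exists below or at κ, and it also puts
    P_{γ⁺}(κ) into M. *)
Lemma ground_definable_from_small_subsets (V W : structure) {hV : ZFC V} {hW : ZFC W}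
  (j : V -> W) (hj : transitive_embedding j) (k M P le g : V) (G : W) :
  is_infinite_cardinal k -> is_H_succ k M -> P ∈ M -> is_forcing P le ->
  is_cardinal g -> le_size P g -> le_size (funs g k) k ->
  is_generic (j M) (j P) (j le) G ->
  exists d q, is_succ_cardinal g d /\ is_small_subsets q d k /\ q ∈ M /\
    definable_in_extension (j M) (j P) G (j q).
Proof.
  intros Hk HM HPM HP Cg HPg Hle HG.
  destruct (succ_cardinal_exists (proj1 Hk) (cantor Hk (proj1 Cg) Hle)) as (d & Hd & _).
  exists d, (small_subsets d k). assert (Hs := small_subsets_spec d k).
  assert (Hq := small_subsets_iff Cg Hd Hs).
  assert (HqM : small_subsets d k ∈ M).
  { apply (subsets_in_H (g := g) Hk HM Hle). intros x Hx. apply Hq, Hx. }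
  split; [exact Hd|split; [exact Hs|split; [exact HqM|]]].
  exact (ground_definable hj Hk HM HPM HP HG Cg HPg Hq HqM).
Qed.

Theorem theorem4p4
  (V W : structure) (hV : ZFC V) (hW : ZFC W)
  (j : V -> W) (hj : transitive_embedding j)
  (kappa M : V)
  (hkappa : is_infinite_cardinal kappa) (hM : is_H_succ kappa M) :
  (forall Q P le gamma : V,
     is_opair Q P le -> Q ∈ M -> is_forcing P le ->
     has_card P gamma -> exp_eq_self kappa gamma ->
     forall G : W, is_generic (j M) (j P) (j le) G ->
     exists delta q : V,
       is_succ_cardinal gamma delta /\ is_small_subsets q delta kappa /\
       q ∈ M /\ definable_in_extension (j M) (j P) G (j q))
  /\
  (GCH V ->
   forall c : V, is_cof kappa c ->
   (forall Q P le gamma : V,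
      is_opair Q P le -> Q ∈ M -> is_forcing P le ->
      has_card P gamma -> gamma ∈ c ->
      forall G : W, is_generic (j M) (j P) (j le) G ->
      exists b : V, b ∈ M /\ definable_in_extension (j M) (j P) G (j b))
   /\
   (forall w : V, is_omega w -> w ∈ c ->
      forall P le : V, is_Cohen P le ->
      forall G : W, is_generic (j M) (j P) (j le) G ->
      exists b : V, b ∈ M /\ definable_in_extension (j M) (j P) G (j b)))
  /\
  (weak_exp_eq_self kappa ->
   forall Q P le gamma : V,
     is_opair Q P le -> Q ∈ M -> is_forcing P le ->
     has_card P gamma -> gamma ∈ kappa ->
     forall G : W, is_generic (j M) (j P) (j le) G ->
     exists b : V, b ∈ M /\ definable_in_extension (j M) (j P) G (j b)).
Proof.
  assert (HPM : forall Q P le : V, is_opair Q P le -> Q ∈ M -> P ∈ M).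
  { intros Q P le H HQ. apply is_opairE in H. subst Q.
    apply (H_transitive hM (x := upair P P)); [apply in_upair; auto|].
    apply (H_transitive hM (x := opair P le)); [apply in_upair; auto|exact HQ]. }
  split; [|split].
  - intros Q P le g HQ HQM HP [Cg E] (e & He & Ee) G HG.
    apply (ground_definable_from_small_subsets hj hkappa hM (HPM _ _ _ HQ HQM) HP Cg
      (bijection_le_size E)); [|exact HG].
    apply le_size_trans with e; [|apply bijection_le_size, Ee].
    apply le_size_subset. intros f Hf. apply He, in_funs, Hf.
  - intros HGCH c Hc. split.
    + intros Q P le g HQ HQM HP [Cg E] Hg G HG.
      destruct (ground_definable_from_small_subsets hj hkappa hM (HPM _ _ _ HQ HQM) HP Cg
        (bijection_le_size E) (GCH_power_le HGCH hkappa Hc Hg) HG) as (d & q & _ & _ & H).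
      exists q. exact H.
    + intros w Hw Hwc P le HC G HG.
      (* Here γ is ω, as an upper bound on the size of P. *)
      destruct (ground_definable_from_small_subsets hj hkappa hM
        (HPM _ P le (proj2 (is_opairE _ _ _) eq_refl) (Cohen_in_H hkappa hM HC))
        (Cohen_forcing HC) (proj1 (omega_infinite_cardinal Hw)) (Cohen_countable HC Hw)
        (GCH_power_le HGCH hkappa Hc Hwc) HG) as (d & q & _ & _ & H).
      exists q. exact H.
  - intros (e & He & Ee) Q P le g HQ HQM HP [Cg E] Hg G HG.
    (* Since γ < κ, the functions from γ to κ are among those counted by κ^{<κ}. *)
    assert (Hle : le_size (funs g kappa) kappa).
    { apply le_size_trans with e; [|apply bijection_le_size, Ee].
      apply le_size_subset. intros f Hf. apply He. exists g. split; [exact Hg|apply in_funs, Hf]. }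
    destruct (ground_definable_from_small_subsets hj hkappa hM (HPM _ _ _ HQ HQM) HP Cg
      (bijection_le_size E) Hle HG) as (d & q & _ & _ & H).
    exists q. exact H.
Qed.
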